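(* Let $t_1\in\mathbb{R}$, let $T:\mathbb{Z}\to\mathbb{R}$ be the $2$-periodic sequence with $T(2j)=0$, $T(2j+1)=t_1$, and let $\omega\in\mathbb{R}$ be such that $\omega/2\pi$ is a Diophantine number. Then there exists $\epsilon>0$ such that for every $E\in[-\epsilon,\epsilon]$ the cocycle $(2\omega,B_E)$ is almost reducible.
   Context: For $E\in\mathbb{R}$ and $h\in\{0,1\}$ let $A_E(\theta,h)=\begin{pmatrix}E-T(h)\cos\theta&-1\\1&0\end{pmatrix}$ and $B_E(\theta)=A_E(\theta+\omega,1)A_E(\theta,0)$, $\theta\in S^1=\mathbb{R}/2\pi\mathbb{Z}$; this is the two-step transfer matrix of the operator $(H_\theta u)(n)=u(n+1)+u(n-1)+T(n)\cos(\theta+n\omega)u(n)$ on $\ell^2(\mathbb{Z})$, and $(2\omega,B_E)$ denotes the cocycle $(\theta,v)\mapsto(\theta+2\omega,B_E(\theta)v)$. A number $\alpha$ is Diophantine if there exist $\gamma>0,\tau>0$ with $|q\alpha-p|\ge\gamma|q|^{-\tau}$ for all $p\in\mathbb{Z}$, $q\in\mathbb{Z}\setminus\{0\}$. An analytic cocycle $(\beta,B)$, $B:S^1\to SL(2,\mathbb{R})$, is almost reducible if there exist $h>0$ and a sequence of maps $Z_n:S^1\to PSL(2,\mathbb{R})$ extending analytically to the strip $|\mathrm{Im}\,\theta|<h$ such that $Z_n(\theta+\beta)B(\theta)Z_n(\theta)^{-1}$ converges to a constant matrix uniformly on that strip. *)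

(* Defs.v *)
From Stdlib Require Import Reals ZArith Lra.
From Coquelicot Require Import Coquelicot.
Open Scope R_scope.

Definition diophantine (a : R) : Prop :=
  exists gamma tau : R, 0 < gamma /\ 0 < tau /\
    forall (p q : Z), q <> 0%Z ->
      Rabs (IZR q * a - IZR p) >= gamma * Rpower (Rabs (IZR q)) (- tau).

Definition Tseq (t1 : R) (n : Z) : R := if Z.even n then 0 else t1.

Record M2 := mkM2 { m11 : C ; m12 : C ; m21 : C ; m22 : C }.

Definition M2mul (A B : M2) : M2 :=
  mkM2 (m11 A * m11 B + m12 A * m21 B)%C (m11 A * m12 B + m12 A * m22 B)%C
       (m21 A * m11 B + m22 A * m21 B)%C (m21 A * m12 B + m22 A * m22 B)%C.

Definition M2det (A : M2) : C := (m11 A * m22 A - m12 A * m21 A)%C.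

(** Inverse of a matrix of determinant 1 (adjugate). *)
Definition M2inv1 (A : M2) : M2 :=
  mkM2 (m22 A) (- m12 A)%C (- m21 A)%C (m11 A).

Definition M2scal (s : C) (A : M2) : M2 :=
  mkM2 (s * m11 A)%C (s * m12 A)%C (s * m21 A)%C (s * m22 A)%C.

(** Complex cosine: cos(x+iy) = cos x cosh y - i sin x sinh y. *)
Definition ccos (z : C) : C :=
  (cos (fst z) * ((exp (snd z) + exp (- snd z)) / 2),
   - (sin (fst z) * ((exp (snd z) - exp (- snd z)) / 2))).

Definition A_E (t1 E : R) (theta : C) (h : Z) : M2 :=
  mkM2 (RtoC E - RtoC (Tseq t1 h) * ccos theta)%C (RtoC (-1)) (RtoC 1) (RtoC 0).

Definition B_E (t1 omega E : R) (theta : C) : M2 :=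
  M2mul (A_E t1 E (theta + RtoC omega)%C 1%Z) (A_E t1 E theta 0%Z).

Definition in_strip (h : R) (z : C) : Prop := Rabs (Im z) < h.

(** Z : R/2piZ -> PSL(2,R), extending analytically to |Im| < h, represented
    by a lift Z : C -> M2 which is holomorphic on the strip, real with
    determinant 1, and 2pi-periodic up to a global sign (the sign ambiguity
    of PSL(2,R)). *)
Definition analytic_PSL2R_on_strip (h : R) (Z : C -> M2) : Prop :=
  (forall z, in_strip h z ->
     ex_derive (fun w => m11 (Z w)) z /\ ex_derive (fun w => m12 (Z w)) z /\
     ex_derive (fun w => m21 (Z w)) z /\ ex_derive (fun w => m22 (Z w)) z) /\
  (forall x : R, Im (m11 (Z (RtoC x))) = 0 /\ Im (m12 (Z (RtoC x))) = 0 /\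
                 Im (m21 (Z (RtoC x))) = 0 /\ Im (m22 (Z (RtoC x))) = 0) /\
  (forall z, in_strip h z -> M2det (Z z) = RtoC 1) /\
  (exists s : R, (s = 1 \/ s = -1) /\
     forall z, in_strip h z -> Z (z + RtoC (2 * PI))%C = M2scal (RtoC s) (Z z)).

Definition almost_reducible (beta : R) (B : C -> M2) : Prop :=
  exists h : R, 0 < h /\
  exists Zs : nat -> C -> M2,
    (forall n, analytic_PSL2R_on_strip h (Zs n)) /\
    exists Cst : M2,
      forall eps : R, 0 < eps -> exists N : nat, forall n : nat, (N <= n)%nat ->
        forall z, in_strip h z ->
          let M := M2mul (M2mul (Zs n (z + RtoC beta)%C) (B z)) (M2inv1 (Zs n z)) in
          Cmod (m11 M - m11 Cst)%C < eps /\ Cmod (m12 M - m12 Cst)%C < eps /\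
          Cmod (m21 M - m21 Cst)%C < eps /\ Cmod (m22 M - m22 Cst)%C < eps.

(* Main.v *)
(* For E = 0 the cocycle is the negative of a unipotent one, and solving one cohomological equation conjugates
   it to -I; hence for small E the cocycle is conjugate to a trigonometric polynomial close to a constant, and
   a KAM scheme applies. All conjugations are trigonometric polynomials with exact determinant one, obtained
   from three nilpotent matrices spanning sl2, so the analysis reduces to weighted l^1 norms of coefficients.

   At scale mu the cocycle is (I + F) A with F of size mu^-P on the strip of width 1 + 2/mu. If no frequency
   0 < |k| <= mu^2 is resonant with the constant A, i.e. no e^{ikb} is close to the square of an eigenvalue of
   A, all these modes are removed and the remaining ones are tiny on the strip of width 1 + 1/mu. Otherwise A
   is elliptic, hence conjugate to a rotation with polynomial loss, and by the Diophantine condition the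
   resonant frequency n is the only one up to mu^4: all other modes up to mu^4 are removed, and rotating by
   -nz/2 makes the resonant one constant. The norm e^{|n|h} of this rotation is at most e^{mu^2 h}, and is
   absorbed by the gain e^{-mu^4 (h - h')} = e^{-mu^3}. Doubling mu at each step, the widths never
   fall below 1. Constant parts stay bounded, so a subsequence of them converges. *)
Require Import Defs.
From Stdlib Require Import Reals ZArith Lra Lia List Bool Classical ClassicalEpsilon.
From Coquelicot Require Import Coquelicot.
Open Scope R_scope.

(** * Complex exponentials *)

(** No arithmetic condition is imposed on the rotation number, so resonances may occur at infinitely
    many scales. Accordingly no bound on the conjugations is ever asked for: they are entire, and
    only the conjugated cocycle is measured, on a strip of width above 1. Three points make this
    close up. Modes are eliminated without loss of width. Finitely many divisors have a common lower
    bound, so the part to be removed can be halved as often as desired at a fixed width; width is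
    spent only on the tail beyond the cutoff. In particular the precision can be chosen after the
    norm of the rotation that will follow is known. Conjugations with values in SL(2) cannot remove
    scalar modes. If $I+G+sI$ has determinant one and $G$ is traceless, then $2s+s^2=G^2$, so the
    scalar part oscillates no more than the traceless one, up to an arbitrarily small error. Finally
    the constant part must not drift, although the change of basis to a rotation is large near
    parabolic matrices. After a resonant step it is close to a rotation, hence bounded by an
    absolute constant, and nonresonant steps only add summable amounts. *)

Definition e (x : R) (z : C) : C :=
  (exp (- (x * snd z)) * cos (x * fst z), exp (- (x * snd z)) * sin (x * fst z)).

Lemma e_plus_freq (x y : R) (z : C) : e (x + y) z = (e x z * e y z)%C.
Proof.
  unfold e, Cmult; simpl.
  replace (- ((x + y) * snd z)) with (- (x * snd z) + - (y * snd z)) by ring.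
  rewrite exp_plus, !Rmult_plus_distr_r, cos_plus, sin_plus.
  apply injective_projections; simpl; ring.
Qed.

Lemma e_plus (x : R) (z w : C) : e x (z + w)%C = (e x z * e x w)%C.
Proof.
  unfold e, Cmult, Cplus; simpl.
  replace (- (x * (snd z + snd w))) with (- (x * snd z) + - (x * snd w)) by ring.
  rewrite exp_plus, !Rmult_plus_distr_l, cos_plus, sin_plus.
  apply injective_projections; simpl; ring.
Qed.

Lemma e_0_freq (z : C) : e 0 z = 1%C.
Proof.
  unfold e. rewrite !Rmult_0_l, Ropp_0, exp_0, cos_0, sin_0.
  apply injective_projections; simpl; ring.
Qed.

Lemma e_0 (x : R) : e x 0%C = 1%C.
Proof.
  unfold e; simpl. rewrite !Rmult_0_r, Ropp_0, exp_0, cos_0, sin_0.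
  apply injective_projections; simpl; ring.
Qed.

Lemma e_opp_l (x : R) (z : C) : (e (- x) z * e x z)%C = 1%C.
Proof.
  rewrite <- e_plus_freq. replace (- x + x) with 0 by ring. apply e_0_freq.
Qed.

Lemma e_conj (x : R) (z : C) : e x (Cconj z) = Cconj (e (- x) z).
Proof.
  unfold e, Cconj; simpl.
  replace (- (x * - snd z)) with (x * snd z) by ring.
  replace (- (- x * snd z)) with (x * snd z) by ring.
  replace (- x * fst z) with (- (x * fst z)) by ring.
  rewrite cos_neg, sin_neg. apply injective_projections; simpl; ring.
Qed.

Lemma Cmod_e (x : R) (z : C) : Cmod (e x z) = exp (- (x * snd z)).
Proof.
  unfold Cmod, e; simpl.
  replace (_ + _) with (exp (- (x * snd z)) * exp (- (x * snd z))
     * (Rsqr (sin (x * fst z)) + Rsqr (cos (x * fst z)))) by (unfold Rsqr; ring).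
  rewrite sin2_cos2, Rmult_1_r. apply sqrt_square. left; apply exp_pos.
Qed.

Lemma exp_le (x y : R) : x <= y -> exp x <= exp y.
Proof.
  intros [H | ->]; [left; now apply exp_increasing | apply Rle_refl].
Qed.

Lemma Cmod_e_le (x h : R) (z : C) :
  Rabs (snd z) <= h -> Cmod (e x z) <= exp (Rabs x * h).
Proof.
  intros H. rewrite Cmod_e. apply exp_le.
  apply Rle_trans with (Rabs (- (x * snd z))); [apply Rle_abs|].
  rewrite Rabs_Ropp, Rabs_mult. apply Rmult_le_compat_l; [apply Rabs_pos | exact H].
Qed.

Lemma Cmod_e_RtoC (x y : R) : Cmod (e x (RtoC y)) = 1.
Proof. rewrite Cmod_e. simpl. rewrite Rmult_0_r, Ropp_0. apply exp_0. Qed.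

Lemma e_2PI (k : Z) : e (IZR k) (RtoC (2 * PI)) = 1%C.
Proof.
  unfold e; simpl. rewrite Rmult_0_r, Ropp_0, exp_0.
  assert (Hs : sin (IZR k * (2 * PI)) = 0).
  { apply sin_eq_0_1. exists (2 * k)%Z. rewrite mult_IZR. ring. }
  assert (Hp : sin (IZR k * PI) = 0) by (apply sin_eq_0_1; exists k; ring).
  assert (Hc : cos (IZR k * (2 * PI)) = 1).
  { replace (IZR k * (2 * PI)) with (2 * (IZR k * PI)) by ring.
    rewrite cos_2a_sin, Hp. ring. }
  rewrite Hs, Hc. apply injective_projections; simpl; ring.
Qed.

Lemma e_half_2PI (k : Z) :
  exists s : R, (s = 1 \/ s = -1) /\ e (IZR k / 2) (RtoC (2 * PI)) = RtoC s.
Proof.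
  unfold e; simpl. rewrite Rmult_0_r, Ropp_0, exp_0.
  replace (IZR k / 2 * (2 * PI)) with (IZR k * PI) by field.
  assert (Hp : sin (IZR k * PI) = 0) by (apply sin_eq_0_1; exists k; ring).
  exists (cos (IZR k * PI)). split.
  - pose proof (sin2_cos2 (IZR k * PI)) as H. rewrite Hp in H. unfold Rsqr in H.
    assert (H1 : (cos (IZR k * PI) - 1) * (cos (IZR k * PI) + 1) = 0) by nra.
    apply Rmult_integral in H1. lra.
  - rewrite Hp. unfold RtoC. apply injective_projections; simpl; ring.
Qed.

(* The two normed-module structures on C over itself have the same norm but different uniform structures. *)
Lemma ex_derive_C_NormedModule (f : C -> C) (z : C) :
  @ex_derive C_AbsRing (AbsRing_NormedModule C_AbsRing) f z ->
  @ex_derive C_AbsRing C_NormedModule f z.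
Proof.
  intros [l [_ H]]. exists l. split.
  - apply is_linear_scal_l.
  - intros x Hx eps. exact (H x Hx eps).
Qed.

(** * Complex differentiability of the exponentials *)

Definition cderiv (f : C -> C) : Prop :=
  forall z, @ex_derive C_AbsRing (AbsRing_NormedModule C_AbsRing) f z.

Lemma cderiv_const (c : C) : cderiv (fun _ => c).
Proof. intros z. apply ex_derive_const. Qed.

Lemma cderiv_plus (f g : C -> C) : cderiv f -> cderiv g -> cderiv (fun z => f z + g z)%C.
Proof. intros Hf Hg z. exact (@ex_derive_plus C_AbsRing (AbsRing_NormedModule C_AbsRing) f g z (Hf z) (Hg z)). Qed.

Lemma cderiv_mult (f g : C -> C) : cderiv f -> cderiv g -> cderiv (fun z => f z * g z)%C.
Proof.
  intros Hf Hg z. destruct (Hf z) as [df Hdf], (Hg z) as [dg Hdg].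
  eexists. apply (is_derive_mult f g z df dg Hdf Hdg). intros; apply Cmult_comm.
Qed.

Lemma cderiv_ext (f g : C -> C) : (forall z, f z = g z) -> cderiv f -> cderiv g.
Proof. intros H Hf z. exact (@ex_derive_ext C_AbsRing (AbsRing_NormedModule C_AbsRing) f g z H (Hf z)). Qed.

Lemma derivable_pt_lim_0_bound (f : R -> R) (f0 l : R) :
  f 0 = f0 -> derivable_pt_lim f 0 l ->
  forall eps, 0 < eps -> exists d, 0 < d /\
    forall x, Rabs x < d -> Rabs (f x - f0 - l * x) <= eps * Rabs x.
Proof.
  intros <- H eps He. destruct (H eps He) as [d Hd]. exists d.
  split; [apply cond_pos|]. intros x Hx.
  destruct (Req_dec x 0) as [-> | Hx0].
  - rewrite Rmult_0_r, Rabs_R0, !Rminus_diag, Rabs_R0. lra.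
  - specialize (Hd x Hx0 Hx). rewrite Rplus_0_l in Hd.
    replace (f x - f 0 - l * x) with (((f x - f 0) / x - l) * x) by (field; exact Hx0).
    rewrite Rabs_mult. apply Rmult_le_compat_r; [apply Rabs_pos | lra].
Qed.

Lemma Cmod_le_abs (z : C) : Cmod z <= Rabs (fst z) + Rabs (snd z).
Proof.
  unfold Cmod. apply Rsqr_incr_0_var.
  - rewrite Rsqr_sqrt by nra. unfold Rsqr.
    rewrite <- (pow2_abs (fst z)), <- (pow2_abs (snd z)).
    pose proof (Rabs_pos (fst z)); pose proof (Rabs_pos (snd z)). nra.
  - pose proof (Rabs_pos (fst z)); pose proof (Rabs_pos (snd z)); lra.
Qed.

(** Real and imaginary parts of the first-order expansion of $e^{a+ib}$ at 0, assembled from the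
    real derivatives of exp, cos and sin; the functional equation of [e] carries it to every
    point. *)
Lemma expi_expansion (eps : R) : 0 < eps -> exists d, 0 < d /\
  forall a b, Rabs a < d -> Rabs b < d ->
    Rabs (exp a * cos b - 1 - a) <= eps * (Rabs a + Rabs b) /\
    Rabs (exp a * sin b - b) <= eps * (Rabs a + Rabs b).
Proof.
  intros He. set (eta := Rmin (eps / 8) (1 / 4)).
  assert (Hn : 0 < eta) by (apply Rmin_glb_lt; lra).
  assert (Hn1 : eta <= eps / 8) by apply Rmin_l.
  assert (Hn2 : eta <= 1 / 4) by apply Rmin_r.
  pose proof (derivable_pt_lim_exp 0) as De. rewrite exp_0 in De.
  pose proof (derivable_pt_lim_cos 0) as Dc. rewrite sin_0, Ropp_0 in Dc.
  pose proof (derivable_pt_lim_sin 0) as Ds. rewrite cos_0 in Ds.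
  destruct (derivable_pt_lim_0_bound exp 1 1 exp_0 De eta Hn) as [d1 [Hd1 H1]].
  destruct (derivable_pt_lim_0_bound cos 1 0 cos_0 Dc eta Hn) as [d2 [Hd2 H2]].
  destruct (derivable_pt_lim_0_bound sin 0 1 sin_0 Ds eta Hn) as [d3 [Hd3 H3]].
  exists (Rmin (Rmin d1 d2) (Rmin d3 eta)). split.
  { apply Rmin_glb_lt; apply Rmin_glb_lt; assumption. }
  intros a b Ha Hb.
  assert (Hle : forall u, Rabs u < Rmin (Rmin d1 d2) (Rmin d3 eta) ->
     Rabs u < d1 /\ Rabs u < d2 /\ Rabs u < d3 /\ Rabs u < eta).
  { intros u Hu. repeat split; eapply Rlt_le_trans; try exact Hu;
    unfold Rmin; repeat destruct Rle_dec; lra. }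
  apply Hle in Ha, Hb.
  specialize (H1 a (proj1 Ha)). specialize (H2 b (proj1 (proj2 Hb))).
  specialize (H3 b (proj1 (proj2 (proj2 Hb)))).
  replace (cos b - 1 - 0 * b) with (cos b - 1) in H2 by ring.
  replace (sin b - 0 - 1 * b) with (sin b - b) in H3 by ring.
  replace (exp a - 1 - 1 * a) with (exp a - 1 - a) in H1 by ring.
  assert (Hc : Rabs (cos b) <= 1).
  { apply Rabs_le. split; [apply COS_bound | apply COS_bound]. }
  assert (Hs : Rabs (sin b) <= 2 * Rabs b).
  { replace (sin b) with ((sin b - b) + b) by ring.
    eapply Rle_trans; [apply Rabs_triang|].
    pose proof (Rabs_pos b). nra. }
  assert (Hea : Rabs (exp a - 1) <= 2 * eta).
  { replace (exp a - 1) with ((exp a - 1 - a) + a) by ring.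
    eapply Rle_trans; [apply Rabs_triang|].
    pose proof (Rabs_pos a). nra. }
  pose proof (Rabs_pos a) as Pa. pose proof (Rabs_pos b) as Pb.
  assert (Ea : eta * Rabs a <= eps / 8 * Rabs a) by (apply Rmult_le_compat_r; lra).
  assert (Eb : eta * Rabs b <= eps / 8 * Rabs b) by (apply Rmult_le_compat_r; lra).
  assert (Fa : 0 <= eps * Rabs a) by nra.
  assert (Fb : 0 <= eps * Rabs b) by nra.
  split.
  - replace (exp a * cos b - 1 - a) with ((exp a - 1 - a) * cos b + (1 + a) * (cos b - 1)) by ring.
    eapply Rle_trans; [apply Rabs_triang|]. rewrite !Rabs_mult.
    assert (Rabs (1 + a) <= 2).
    { eapply Rle_trans; [apply Rabs_triang|]. rewrite Rabs_R1. lra. }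
    assert (X1 := Rmult_le_compat _ _ _ _ (Rabs_pos _) (Rabs_pos _) H1 Hc).
    assert (X2 := Rmult_le_compat _ _ _ _ (Rabs_pos _) (Rabs_pos _) H H2).
    lra.
  - replace (exp a * sin b - b) with ((exp a - 1) * sin b + (sin b - b)) by ring.
    eapply Rle_trans; [apply Rabs_triang|]. rewrite !Rabs_mult.
    assert (X1 := Rmult_le_compat _ _ _ _ (Rabs_pos _) (Rabs_pos _) Hea Hs).
    lra.
Qed.

Lemma cderiv_e (x : R) : cderiv (e x).
Proof.
  intros z. exists (e x z * (Ci * RtoC x))%C. split; [apply is_linear_scal_l|].
  intros y Hy eps.
  destruct (@is_filter_lim_locally_unique C_AbsRing (AbsRing_NormedModule C_AbsRing) z y Hy).
  (* The radius $d/|x|$ used below makes no sense for the constant function [e 0]. *)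
  destruct (Req_dec x 0) as [-> | Hx].
  { apply filter_forall. intros w.
    change (Cmod (e 0 w - e 0 z - (w - z) * (e 0 z * (Ci * RtoC 0)))%C <= eps * Cmod (w - z)%C).
    rewrite !e_0_freq.
    assert (H0 : forall u : C, (1 - 1 - u * (1 * (Ci * RtoC 0)))%C = RtoC 0) by (intros; ring).
    rewrite H0, Cmod_0. apply Rmult_le_pos; [left; apply cond_pos | apply Cmod_ge_0]. }
  set (K := Cmod (e x z)).
  assert (HK : 0 < K) by (unfold K; rewrite Cmod_e; apply exp_pos).
  assert (Hax : 0 < Rabs x) by (apply Rabs_pos_lt; exact Hx).
  assert (He' : 0 < eps / (4 * K * Rabs x)).
  { apply Rdiv_lt_0_compat; [apply cond_pos|]. nra. }
  destruct (expi_expansion _ He') as [d [Hd H]].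
  assert (Hd' : 0 < d / Rabs x) by (apply Rdiv_lt_0_compat; lra).
  exists (mkposreal _ Hd'). intros w Hw.
  change (Cmod (w - z)%C < d / Rabs x) in Hw.
  change (Cmod (e x w - e x z - (w - z) * (e x z * (Ci * RtoC x)))%C <= eps * Cmod (w - z)%C).
  set (v := (w - z)%C) in *.
  replace w with (z + v)%C by (unfold v; ring). rewrite e_plus.
  replace (e x z * e x v - e x z - v * (e x z * (Ci * RtoC x)))%C
    with (e x z * (e x v - 1 - v * (Ci * RtoC x)))%C by ring.
  rewrite Cmod_mult. fold K.
  assert (Hv1 : Rabs (fst v) <= Cmod v /\ Rabs (snd v) <= Cmod v).
  { pose proof (Rmax_Cmod v). split; eapply Rle_trans; try exact H0; [apply Rmax_l | apply Rmax_r]. }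
  assert (Hxv : Rabs x * Cmod v < d).
  { apply Rmult_lt_reg_r with (/ Rabs x); [apply Rinv_0_lt_compat; lra|].
    replace (Rabs x * Cmod v * / Rabs x) with (Cmod v) by (field; lra). exact Hw. }
  destruct (H (- (x * snd v)) (x * fst v)) as [Hr Hi].
  { rewrite Rabs_Ropp, Rabs_mult. nra. }
  { rewrite Rabs_mult. nra. }
  rewrite Rabs_Ropp, !Rabs_mult in Hr, Hi.
  assert (Hb : Cmod (e x v - 1 - v * (Ci * RtoC x)) <= eps / K * Cmod v).
  { eapply Rle_trans; [apply Cmod_le_abs|].
    replace (fst (e x v - 1 - v * (Ci * RtoC x))%C)
      with (exp (- (x * snd v)) * cos (x * fst v) - 1 - - (x * snd v))
      by (unfold e; simpl; ring).
    replace (snd (e x v - 1 - v * (Ci * RtoC x))%C)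
      with (exp (- (x * snd v)) * sin (x * fst v) - x * fst v)
      by (unfold e; simpl; ring).
    eapply Rle_trans; [apply Rplus_le_compat; [exact Hr | exact Hi]|].
    apply Rle_trans with (eps / (4 * K * Rabs x) * (4 * (Rabs x * Cmod v))).
    - rewrite <- Rmult_plus_distr_l. apply Rmult_le_compat_l; [lra|]. nra.
    - right. field. lra. }
  apply Rle_trans with (K * (eps / K * Cmod v)).
  - apply Rmult_le_compat_l; lra.
  - right. field. lra.
Qed.

(** * Matrix-valued trigonometric polynomials *)

Definition M0 : M2 := mkM2 0 0 0 0.
Definition I2 : M2 := mkM2 1 0 0 1.
Definition Madd (A B : M2) : M2 :=
  mkM2 (m11 A + m11 B)%C (m12 A + m12 B)%C (m21 A + m21 B)%C (m22 A + m22 B)%C.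
Definition Mconj (A : M2) : M2 :=
  mkM2 (Cconj (m11 A)) (Cconj (m12 A)) (Cconj (m21 A)) (Cconj (m22 A)).
Definition nm (A : M2) : R := Cmod (m11 A) + Cmod (m12 A) + Cmod (m21 A) + Cmod (m22 A).
Definition mtr (A : M2) : C := (m11 A + m22 A)%C.

Infix "*m" := M2mul (at level 40, left associativity).
Infix "+m" := Madd (at level 50, left associativity).
Infix "*s" := M2scal (at level 40, left associativity).

Ltac munfold := unfold Madd, M2mul, M2scal, M2inv1, M0, I2, Mconj, mtr, M2det in *; cbn [m11 m12 m21 m22] in *.
Ltac mring := intros; repeat match goal with A : M2 |- _ => destruct A end;
  munfold; try (f_equal; ring); try ring.

Lemma Madd_0_r A : A +m M0 = A. Proof. mring. Qed.
Lemma Madd_0_l A : M0 +m A = A. Proof. mring. Qed.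
Lemma Madd_assoc A B D : A +m (B +m D) = A +m B +m D. Proof. mring. Qed.
Lemma Madd_comm A B : A +m B = B +m A. Proof. mring. Qed.
Lemma Mmul_assoc A B D : A *m (B *m D) = A *m B *m D. Proof. mring. Qed.
Lemma Mmul_add_l A B D : (A +m B) *m D = A *m D +m B *m D. Proof. mring. Qed.
Lemma Mmul_add_r A B D : D *m (A +m B) = D *m A +m D *m B. Proof. mring. Qed.
Lemma Mmul_1_l A : I2 *m A = A. Proof. mring. Qed.
Lemma Mmul_1_r A : A *m I2 = A. Proof. mring. Qed.
Lemma Mmul_0_l A : M0 *m A = M0. Proof. mring. Qed.
Lemma Mmul_0_r A : A *m M0 = M0. Proof. mring. Qed.
Lemma Mscal_mul_l c A B : (c *s A) *m B = c *s (A *m B). Proof. mring. Qed.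
Lemma Mscal_mul_r c A B : A *m (c *s B) = c *s (A *m B). Proof. mring. Qed.
Lemma Mscal_add c A B : c *s (A +m B) = c *s A +m c *s B. Proof. mring. Qed.
Lemma Mscal_add_l c d A : (c + d)%C *s A = c *s A +m d *s A. Proof. mring. Qed.
Lemma Mscal_scal c d A : c *s (d *s A) = (c * d)%C *s A. Proof. mring. Qed.
Lemma Mscal_1 A : 1%C *s A = A. Proof. mring. Qed.
Lemma Mscal_0_l A : 0%C *s A = M0. Proof. mring. Qed.
Lemma Mscal_0_r c : c *s M0 = M0. Proof. mring. Qed.
Lemma Mdet_mul A B : M2det (A *m B) = (M2det A * M2det B)%C. Proof. mring. Qed.
Lemma Mdet_inv A : M2det (M2inv1 A) = M2det A. Proof. mring. Qed.
Lemma Mdet_I2 : M2det I2 = 1%C. Proof. mring. Qed.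
Lemma Minv_mul A B : M2inv1 (A *m B) = M2inv1 B *m M2inv1 A. Proof. mring. Qed.

Lemma Minv_r A : M2det A = 1%C -> A *m M2inv1 A = I2.
Proof. destruct A; munfold; intros H; f_equal; try ring; rewrite <- H; ring. Qed.
Lemma Minv_l A : M2det A = 1%C -> M2inv1 A *m A = I2.
Proof. destruct A; munfold; intros H; f_equal; try ring; rewrite <- H; ring. Qed.

Lemma Mconj_mul A B : Mconj (A *m B) = Mconj A *m Mconj B.
Proof. destruct A, B; munfold; f_equal; rewrite Cplus_conj, !Cmult_conj; reflexivity. Qed.
Lemma Mconj_add A B : Mconj (A +m B) = Mconj A +m Mconj B.
Proof. destruct A, B; munfold; f_equal; apply Cplus_conj. Qed.
Lemma Mconj_scal c A : Mconj (c *s A) = Cconj c *s Mconj A.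
Proof. destruct A; munfold; f_equal; apply Cmult_conj. Qed.
Lemma Mconj_inv A : Mconj (M2inv1 A) = M2inv1 (Mconj A).
Proof. destruct A; munfold; f_equal; apply Copp_conj. Qed.
Lemma Mconj_conj A : Mconj (Mconj A) = A.
Proof. destruct A; munfold; f_equal; apply Cconj_conj. Qed.
Lemma Cconj_RtoC (x : R) : Cconj (RtoC x) = RtoC x.
Proof. unfold Cconj, RtoC; simpl. f_equal. ring. Qed.
Lemma Mconj_I2 : Mconj I2 = I2.
Proof. munfold. rewrite !Cconj_RtoC. reflexivity. Qed.
Lemma Mconj_M0 : Mconj M0 = M0.
Proof. munfold. rewrite !Cconj_RtoC. reflexivity. Qed.

Lemma nm_ge_0 A : 0 <= nm A.
Proof. unfold nm. pose proof Cmod_ge_0 as H.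
  pose proof (H (m11 A)); pose proof (H (m12 A)); pose proof (H (m21 A)); pose proof (H (m22 A)); lra. Qed.
Lemma nm_M0 : nm M0 = 0.
Proof. unfold nm; simpl. rewrite Cmod_0. ring. Qed.
Lemma nm_I2 : nm I2 = 2.
Proof. unfold nm; simpl. rewrite Cmod_0, Cmod_1. ring. Qed.
Lemma nm_add A B : nm (A +m B) <= nm A + nm B.
Proof. unfold nm, Madd; simpl. pose proof Cmod_triangle as H.
  pose proof (H (m11 A) (m11 B)); pose proof (H (m12 A) (m12 B));
  pose proof (H (m21 A) (m21 B)); pose proof (H (m22 A) (m22 B)); lra. Qed.
Lemma nm_scal c A : nm (c *s A) = Cmod c * nm A.
Proof. unfold nm; simpl. rewrite !Cmod_mult. ring. Qed.
Lemma nm_conj A : nm (Mconj A) = nm A.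
Proof. unfold nm; simpl. rewrite !Cmod_conj. reflexivity. Qed.
Lemma nm_inv A : nm (M2inv1 A) = nm A.
Proof. unfold nm; simpl. rewrite !Cmod_opp. ring. Qed.
Lemma nm_mul A B : nm (A *m B) <= nm A * nm B.
Proof.
  destruct A as [a b c d], B as [a' b' c' d']; unfold nm, M2mul; cbn [m11 m12 m21 m22].
  assert (H : forall u v w x, Cmod (u * v + w * x)%C <= Cmod u * Cmod v + Cmod w * Cmod x).
  { intros. eapply Rle_trans; [apply Cmod_triangle|]. rewrite !Cmod_mult. lra. }
  pose proof (H a a' b c'); pose proof (H a b' b d'); pose proof (H c a' d c'); pose proof (H c b' d d').
  pose proof (Cmod_ge_0 a); pose proof (Cmod_ge_0 b); pose proof (Cmod_ge_0 c); pose proof (Cmod_ge_0 d).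
  pose proof (Cmod_ge_0 a'); pose proof (Cmod_ge_0 b'); pose proof (Cmod_ge_0 c'); pose proof (Cmod_ge_0 d').
  assert (0 <= Cmod a * Cmod c') by (apply Rmult_le_pos; assumption).
  assert (0 <= Cmod a * Cmod d') by (apply Rmult_le_pos; assumption).
  assert (0 <= Cmod b * Cmod a') by (apply Rmult_le_pos; assumption).
  assert (0 <= Cmod b * Cmod b') by (apply Rmult_le_pos; assumption).
  assert (0 <= Cmod c * Cmod c') by (apply Rmult_le_pos; assumption).
  assert (0 <= Cmod c * Cmod d') by (apply Rmult_le_pos; assumption).
  assert (0 <= Cmod d * Cmod a') by (apply Rmult_le_pos; assumption).
  assert (0 <= Cmod d * Cmod b') by (apply Rmult_le_pos; assumption).
  lra.
Qed.

Definition lin (T : M2 -> M2) : Prop :=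
  (forall a b, T (a +m b) = T a +m T b) /\ (forall c a, T (c *s a) = c *s T a).

Lemma lin_M0 T : lin T -> T M0 = M0.
Proof. intros [_ H]. specialize (H 0%C M0). rewrite !Mscal_0_l in H. exact H. Qed.

(** Reality on the real axis in reflected form, which is algebraic and passes to products, inverses
    and real shifts. *)
Definition realsym (f : C -> M2) : Prop := forall z, f (Cconj z) = Mconj (f z).

(* Trigonometric polynomials are unreduced lists of monomials: several monomials may carry the same frequency. *)
Definition tp := list (Z * M2).

Fixpoint ev (F : tp) (z : C) : M2 :=
  match F with
  | nil => M0
  | p :: F' => e (IZR (fst p)) z *s snd p +m ev F' z
  end.

Fixpoint fsum {T : Type} (w : T -> R) (l : list T) : R :=
  match l with nil => 0 | x :: l' => w x + fsum w l' end.

Definition wt (h : R) (k : Z) : R := exp (Rabs (IZR k) * h).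
Definition nrm (h : R) (F : tp) : R := fsum (fun p => nm (snd p) * wt h (fst p)) F.
(** Measures how far the function is from being constant without naming the constant, which changes
    from one step to the next. *)
Definition osc (h : R) (F : tp) : R :=
  fsum (fun p => if Z.eqb (fst p) 0 then 0 else nm (snd p) * wt h (fst p)) F.

Definition tmap (T : Z -> M2 -> M2) (F : tp) : tp :=
  map (fun p => (fst p, T (fst p) (snd p))) F.
Definition tmul (F G : tp) : tp :=
  flat_map (fun p => map (fun q => ((fst p + fst q)%Z, snd p *m snd q)) G) F.
Definition tshift (b : R) (F : tp) : tp := tmap (fun k a => e (IZR k) (RtoC b) *s a) F.
Definition tstar (F : tp) : tp := map (fun p => ((- fst p)%Z, Mconj (snd p))) F.
Definition tscal (c : C) (F : tp) : tp := tmap (fun _ a => c *s a) F.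
(** In an unreduced list, reality of the function does not make the listed coefficients symmetric.
    Averaging with the reflection restores this symmetry, so that operations performed mode by mode
    yield real functions. *)
Definition tsym (F : tp) : tp := tscal (RtoC (/ 2)) F ++ tscal (RtoC (/ 2)) (tstar F).

(** * Weighted norms of the coefficient lists *)

Lemma wt_pos h k : 0 < wt h k. Proof. apply exp_pos. Qed.

Lemma wt_opp h k : wt h (- k) = wt h k.
Proof. unfold wt. rewrite opp_IZR, Rabs_Ropp. reflexivity. Qed.

Lemma wt_0 h : wt h 0 = 1.
Proof. unfold wt. rewrite Rabs_R0, Rmult_0_l. apply exp_0. Qed.

Lemma wt_add_le h k l : 0 <= h -> wt h (k + l) <= wt h k * wt h l.
Proof.
  intros Hh. unfold wt. rewrite <- exp_plus. apply exp_le.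
  rewrite plus_IZR, <- Rmult_plus_distr_r. apply Rmult_le_compat_r; [exact Hh | apply Rabs_triang].
Qed.

Lemma fsum_app {T} (w : T -> R) l l' : fsum w (l ++ l') = fsum w l + fsum w l'.
Proof. induction l; simpl; [ring | rewrite IHl; ring]. Qed.

Lemma fsum_map {T U} (f : T -> U) w l : fsum w (map f l) = fsum (fun x => w (f x)) l.
Proof. induction l; simpl; [reflexivity | rewrite IHl; ring]. Qed.

Lemma fsum_flat_map {T U} (f : T -> list U) w l :
  fsum w (flat_map f l) = fsum (fun x => fsum w (f x)) l.
Proof. induction l; simpl; [reflexivity | rewrite fsum_app, IHl; ring]. Qed.

Lemma fsum_le {T} (w w' : T -> R) l : (forall x, w x <= w' x) -> fsum w l <= fsum w' l.
Proof. intros H; induction l; simpl; [lra | specialize (H a); lra]. Qed.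

Lemma fsum_ext {T} (w w' : T -> R) l : (forall x, w x = w' x) -> fsum w l = fsum w' l.
Proof. intros H; induction l; simpl; [reflexivity | rewrite H, IHl; reflexivity]. Qed.

Lemma fsum_ge_0 {T} (w : T -> R) l : (forall x, 0 <= w x) -> 0 <= fsum w l.
Proof. intros H; induction l; simpl; [lra | specialize (H a); lra]. Qed.

Lemma fsum_scal {T} c (w : T -> R) l : fsum (fun x => c * w x) l = c * fsum w l.
Proof. induction l; simpl; [ring | rewrite IHl; ring]. Qed.

Lemma fsum_plus {T} (w w' : T -> R) l : fsum (fun x => w x + w' x) l = fsum w l + fsum w' l.
Proof. induction l; simpl; [ring | rewrite IHl; ring]. Qed.

Lemma nrm_ge_0 h F : 0 <= nrm h F.
Proof. apply fsum_ge_0. intros [k a]; simpl. apply Rmult_le_pos; [apply nm_ge_0 | left; apply wt_pos]. Qed.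

Lemma osc_ge_0 h F : 0 <= osc h F.
Proof.
  apply fsum_ge_0. intros [k a]; simpl. destruct Z.eqb; [lra|].
  apply Rmult_le_pos; [apply nm_ge_0 | left; apply wt_pos].
Qed.

Lemma osc_le_nrm h F : osc h F <= nrm h F.
Proof.
  apply fsum_le. intros [k a]; simpl.
  assert (0 <= nm a * wt h k) by (apply Rmult_le_pos; [apply nm_ge_0 | left; apply wt_pos]).
  destruct Z.eqb; lra.
Qed.

Lemma nrm_app h F G : nrm h (F ++ G) = nrm h F + nrm h G. Proof. apply fsum_app. Qed.
Lemma osc_app h F G : osc h (F ++ G) = osc h F + osc h G. Proof. apply fsum_app. Qed.

Lemma tmap_cons T k a F : tmap T ((k, a) :: F) = (k, T k a) :: tmap T F.
Proof. reflexivity. Qed.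
Lemma tstar_cons k a F : tstar ((k, a) :: F) = ((- k)%Z, Mconj a) :: tstar F.
Proof. reflexivity. Qed.

Lemma tmap_app T F G : tmap T (F ++ G) = tmap T F ++ tmap T G.
Proof. apply map_app. Qed.

Lemma tmap_tmap T S F : tmap T (tmap S F) = tmap (fun k a => T k (S k a)) F.
Proof. unfold tmap. rewrite map_map. reflexivity. Qed.

Lemma tmap_ext T S F : (forall k a, T k a = S k a) -> tmap T F = tmap S F.
Proof. intros H. apply map_ext. intros [k a]; simpl. rewrite H. reflexivity. Qed.

Lemma nrm_tmap_le2 h T S c F : (forall k a, nm (T k a) <= c * nm (S k a)) ->
  nrm h (tmap T F) <= c * nrm h (tmap S F).
Proof.
  intros H. unfold nrm, tmap. rewrite !fsum_map, <- fsum_scal. apply fsum_le.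
  intros [k a]; simpl. rewrite <- Rmult_assoc.
  apply Rmult_le_compat_r; [left; apply wt_pos | apply H].
Qed.

Lemma tmap_id F : tmap (fun _ a => a) F = F.
Proof. unfold tmap. rewrite <- (map_id F) at 2. apply map_ext. intros [k a]; reflexivity. Qed.

Lemma nrm_tmap_le h T c F : (forall k a, nm (T k a) <= c * nm a) ->
  nrm h (tmap T F) <= c * nrm h F.
Proof.
  intros H. rewrite <- (tmap_id F) at 2. apply nrm_tmap_le2. exact H.
Qed.

Lemma osc_tmap_le h T c F : (forall k a, nm (T k a) <= c * nm a) ->
  osc h (tmap T F) <= c * osc h F.
Proof.
  intros H. unfold osc, tmap. rewrite fsum_map, <- fsum_scal. apply fsum_le.
  intros [k a]; simpl. destruct Z.eqb; [lra|]. rewrite <- Rmult_assoc.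
  apply Rmult_le_compat_r; [left; apply wt_pos | apply H].
Qed.

Lemma nrm_tscal h c F : nrm h (tscal c F) <= Cmod c * nrm h F.
Proof. apply nrm_tmap_le. intros; rewrite nm_scal; lra. Qed.

Lemma osc_tscal h c F : osc h (tscal c F) <= Cmod c * osc h F.
Proof. apply osc_tmap_le. intros; rewrite nm_scal; lra. Qed.

Lemma nrm_tshift h b F : nrm h (tshift b F) <= nrm h F.
Proof.
  rewrite <- (Rmult_1_l (nrm h F)). apply nrm_tmap_le.
  intros; rewrite nm_scal, Cmod_e_RtoC; lra.
Qed.

Lemma nrm_tstar h F : nrm h (tstar F) = nrm h F.
Proof.
  unfold nrm, tstar. rewrite fsum_map. apply fsum_ext.
  intros [k a]; simpl. rewrite nm_conj, wt_opp. reflexivity.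
Qed.

Lemma nrm_tmul h F G : 0 <= h -> nrm h (tmul F G) <= nrm h F * nrm h G.
Proof.
  intros Hh. unfold nrm, tmul. rewrite fsum_flat_map.
  rewrite Rmult_comm, <- fsum_scal. apply fsum_le. intros [k a]; simpl.
  rewrite fsum_map; simpl. rewrite Rmult_comm, <- fsum_scal.
  apply fsum_le. intros [l b]; simpl.
  apply Rle_trans with ((nm a * nm b) * (wt h k * wt h l)); [|right; ring].
  apply Rmult_le_compat; [apply nm_ge_0 | left; apply wt_pos | apply nm_mul | apply wt_add_le, Hh].
Qed.

(** A product monomial of nonzero frequency has at least one factor of nonzero frequency. *)
Lemma osc_tmul h F G : 0 <= h ->
  osc h (tmul F G) <= osc h F * nrm h G + nrm h F * osc h G.
Proof.
  intros Hh. unfold osc at 1, tmul. rewrite fsum_flat_map.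
  unfold osc at 1, nrm at 2.
  rewrite (Rmult_comm (fsum _ F)), (Rmult_comm (fsum _ F) (osc h G)), <- !fsum_scal, <- fsum_plus.
  apply fsum_le. intros [k a]; simpl. rewrite fsum_map; simpl.
  unfold nrm, osc.
  rewrite (Rmult_comm (fsum _ G)), (Rmult_comm (fsum _ G)), <- !fsum_scal, <- fsum_plus.
  apply fsum_le. intros [l b]; simpl.
  assert (Hab : nm (a *m b) * wt h (k + l) <= (nm a * wt h k) * (nm b * wt h l)).
  { apply Rle_trans with ((nm a * nm b) * (wt h k * wt h l)); [|right; ring].
    apply Rmult_le_compat; [apply nm_ge_0 | left; apply wt_pos | apply nm_mul | apply wt_add_le, Hh]. }
  assert (0 <= (nm a * wt h k) * (nm b * wt h l)).
  { repeat apply Rmult_le_pos; try apply nm_ge_0; left; apply wt_pos. }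
  destruct (Z.eqb_spec k 0), (Z.eqb_spec l 0), (Z.eqb_spec (k + l) 0); try lia; lra.
Qed.

(** * From lists to functions on the strip *)

Lemma ev_app F G z : ev (F ++ G) z = ev F z +m ev G z.
Proof. induction F; simpl; [rewrite Madd_0_l; reflexivity | rewrite IHF, Madd_assoc; reflexivity]. Qed.

Lemma ev_tmap_lin T F z : lin T -> ev (tmap (fun _ => T) F) z = T (ev F z).
Proof.
  intros HT. induction F as [|[k a] F IH].
  - symmetry. apply lin_M0, HT.
  - rewrite tmap_cons. cbn [ev fst snd]. rewrite IH. destruct HT as [H1 H2]. rewrite H1, H2. reflexivity.
Qed.

Lemma ev_tmap_add T S F z :
  ev (tmap (fun k a => T k a +m S k a) F) z = ev (tmap T F) z +m ev (tmap S F) z.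
Proof.
  induction F as [|[k a] F IH]; [symmetry; apply Madd_0_l|].
  rewrite !tmap_cons. cbn [ev fst snd]. rewrite IH. mring.
Qed.

Lemma lin_scal c : lin (fun a => c *s a).
Proof. split; mring. Qed.
Lemma lin_mul_r A : lin (fun a => a *m A).
Proof. split; mring. Qed.

Lemma ev_tscal c F z : ev (tscal c F) z = c *s ev F z.
Proof. apply (ev_tmap_lin (fun a => c *s a)), lin_scal. Qed.

Lemma ev_tshift b F z : ev (tshift b F) z = ev F (z + RtoC b)%C.
Proof.
  unfold tshift. induction F as [|[k a] F IH]; [reflexivity|].
  rewrite tmap_cons. cbn [ev fst snd]. rewrite IH, e_plus, Mscal_scal. reflexivity.
Qed.

Lemma ev_tmul F G z : ev (tmul F G) z = ev F z *m ev G z.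
Proof.
  induction F as [|[k a] F IH]; simpl; [rewrite Mmul_0_l; reflexivity|].
  rewrite ev_app, IH, Mmul_add_l. f_equal. clear.
  induction G as [|[l b] G IH]; simpl; [rewrite Mmul_0_r; reflexivity|].
  rewrite IH, Mmul_add_r. f_equal.
  rewrite plus_IZR, e_plus_freq, Mscal_mul_l, Mscal_mul_r, Mscal_scal. reflexivity.
Qed.

Lemma ev_tstar F z : ev (tstar F) z = Mconj (ev F (Cconj z)).
Proof.
  induction F as [|[k a] F IH]; [symmetry; apply Mconj_M0|].
  rewrite tstar_cons. cbn [ev fst snd]. rewrite IH, Mconj_add, Mconj_scal, e_conj, Cconj_conj, opp_IZR. reflexivity.
Qed.

Lemma Mscal_half A : RtoC (/ 2) *s A +m RtoC (/ 2) *s A = A.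
Proof.
  rewrite <- Mscal_add_l, <- RtoC_plus. replace (/ 2 + / 2) with 1 by field. apply Mscal_1.
Qed.

Lemma ev_tsym F z : realsym (ev F) -> ev (tsym F) z = ev F z.
Proof.
  intros H. unfold tsym. rewrite ev_app, !ev_tscal, ev_tstar.
  rewrite <- H, Cconj_conj. apply Mscal_half.
Qed.

Lemma realsym_tmap_tsym T F : (forall k, lin (T k)) ->
  (forall k a, T (- k)%Z (Mconj a) = Mconj (T k a)) -> realsym (ev (tmap T (tsym F))).
Proof.
  intros Hl Hc.
  assert (H1 : forall G z, ev (tmap T (tscal (RtoC (/ 2)) G)) z = RtoC (/ 2) *s ev (tmap T G) z).
  { intros G z. rewrite <- ev_tscal. unfold tscal. rewrite !tmap_tmap. f_equal. apply tmap_ext.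
    intros k a. apply (proj2 (Hl k)). }
  assert (H2 : forall z, ev (tmap T (tstar F)) z = Mconj (ev (tmap T F) (Cconj z))).
  { intros z. rewrite <- ev_tstar. f_equal. unfold tmap, tstar. rewrite !map_map.
    apply map_ext. intros [k a]; simpl. rewrite Hc. reflexivity. }
  intros z. unfold tsym. rewrite tmap_app, !ev_app, !H1, !H2, Cconj_conj.
  rewrite Mconj_add, !Mconj_scal, Mconj_conj, Cconj_RtoC. apply Madd_comm.
Qed.

Lemma nrm_tmap_tsym h T F : (forall k, lin (T k)) ->
  (forall k a, T (- k)%Z (Mconj a) = Mconj (T k a)) -> nrm h (tmap T (tsym F)) <= nrm h (tmap T F).
Proof.
  intros Hl Hc.
  assert (H1 : forall G, nrm h (tmap T (tscal (RtoC (/ 2)) G)) <= / 2 * nrm h (tmap T G)).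
  { intros G. unfold tscal. rewrite tmap_tmap. apply nrm_tmap_le2.
    intros k a. rewrite (proj2 (Hl k)), nm_scal, Cmod_R, Rabs_pos_eq; lra. }
  assert (H2 : nrm h (tmap T (tstar F)) = nrm h (tmap T F)).
  { rewrite <- (nrm_tstar h (tmap T F)). f_equal. unfold tmap, tstar. rewrite !map_map.
    apply map_ext. intros [k a]; simpl. rewrite Hc. reflexivity. }
  unfold tsym. rewrite tmap_app, nrm_app.
  pose proof (H1 F). pose proof (H1 (tstar F)). rewrite H2 in *. lra.
Qed.

Lemma nrm_tsym h F : nrm h (tsym F) <= nrm h F.
Proof.
  pose proof (nrm_tmap_tsym h (fun _ a => a) F ltac:(intros; split; reflexivity)
    ltac:(reflexivity)) as H. rewrite !tmap_id in H. exact H.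
Qed.

Lemma nm_ev h F z : Rabs (snd z) <= h -> nm (ev F z) <= nrm h F.
Proof.
  intros Hz. induction F as [|[k a] F IH]; simpl; [rewrite nm_M0; apply Rle_refl|].
  eapply Rle_trans; [apply nm_add|]. apply Rplus_le_compat; [|exact IH].
  rewrite nm_scal, Rmult_comm. apply Rmult_le_compat_l; [apply nm_ge_0 | apply Cmod_e_le, Hz].
Qed.

Lemma nm_ev_0 h F : 0 <= h -> nm (ev F 0%C) <= nrm h F.
Proof. intros Hh. apply nm_ev. simpl. rewrite Rabs_R0. exact Hh. Qed.

(** Each nonconstant mode contributes $|e^{ikz}-1|\le 1+e^{|k|h}\le 2e^{|k|h}$. This turns small
    [osc] into uniform closeness to a constant. *)
Lemma nm_ev_sub h F z : 0 <= h -> Rabs (snd z) <= h ->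
  nm (ev F z +m (RtoC (-1)) *s ev F 0%C) <= 2 * osc h F.
Proof.
  intros Hh Hz. induction F as [|[k a] F IH]; simpl.
  { rewrite Mscal_0_r, Madd_0_r, nm_M0. unfold osc; simpl. lra. }
  rewrite e_0, Mscal_1.
  replace (_ +m _) with ((e (IZR k) z - 1)%C *s a +m (ev F z +m RtoC (-1) *s ev F 0%C)) by mring.
  eapply Rle_trans; [apply nm_add|]. rewrite nm_scal.
  unfold osc in *; simpl. rewrite Rmult_plus_distr_l. apply Rplus_le_compat; [|exact IH].
  destruct (Z.eqb_spec k 0) as [->|Hk].
  - rewrite e_0_freq. replace (1 - 1)%C with (RtoC 0) by ring. rewrite Cmod_0. lra.
  - replace (2 * (nm a * wt h k)) with ((2 * wt h k) * nm a) by ring.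
    apply Rmult_le_compat_r; [apply nm_ge_0|].
    replace (e (IZR k) z - 1)%C with (e (IZR k) z + - (1))%C by ring.
    eapply Rle_trans; [apply Cmod_triangle|]. rewrite Cmod_m1.
    assert (H1 : 1 <= wt h k).
    { unfold wt. rewrite <- exp_0. apply exp_le, Rmult_le_pos; [apply Rabs_pos | exact Hh]. }
    pose proof (Cmod_e_le (IZR k) h z Hz). unfold wt in *. lra.
Qed.

(** * Analytic conjugations *)

Definition mderiv (f : C -> M2) : Prop :=
  cderiv (fun w => m11 (f w)) /\ cderiv (fun w => m12 (f w)) /\
  cderiv (fun w => m21 (f w)) /\ cderiv (fun w => m22 (f w)).

Lemma mderiv_mul f g : mderiv f -> mderiv g -> mderiv (fun z => f z *m g z).
Proof.
  intros [f1 [f2 [f3 f4]]] [g1 [g2 [g3 g4]]].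
  repeat split; simpl; apply cderiv_plus; apply cderiv_mult; assumption.
Qed.

Lemma mderiv_add f g : mderiv f -> mderiv g -> mderiv (fun z => f z +m g z).
Proof.
  intros [f1 [f2 [f3 f4]]] [g1 [g2 [g3 g4]]].
  repeat split; simpl; apply cderiv_plus; assumption.
Qed.

Lemma mderiv_const A : mderiv (fun _ => A).
Proof. repeat split; apply cderiv_const. Qed.

Lemma mderiv_ext f g : (forall z, f z = g z) -> mderiv f -> mderiv g.
Proof.
  intros H [f1 [f2 [f3 f4]]]. repeat split; intros z.
  - apply (cderiv_ext (fun w => m11 (f w))); [intros; rewrite H; reflexivity | exact f1].
  - apply (cderiv_ext (fun w => m12 (f w))); [intros; rewrite H; reflexivity | exact f2].
  - apply (cderiv_ext (fun w => m21 (f w))); [intros; rewrite H; reflexivity | exact f3].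
  - apply (cderiv_ext (fun w => m22 (f w))); [intros; rewrite H; reflexivity | exact f4].
Qed.

Lemma mderiv_e x A : mderiv (fun z => e x z *s A).
Proof.
  split; [|split; [|split]]; exact (cderiv_mult _ _ (cderiv_e x) (cderiv_const _)).
Qed.

Lemma mderiv_ev F : mderiv (ev F).
Proof.
  induction F as [|[k a] F IH]; simpl; [apply mderiv_const|].
  apply mderiv_add; [apply mderiv_e | exact IH].
Qed.

Lemma ev_2PI F z : ev F (z + RtoC (2 * PI))%C = ev F z.
Proof.
  induction F as [|[k a] F IH]; simpl; [reflexivity|].
  rewrite IH, e_plus, e_2PI, Cmult_1_r. reflexivity.
Qed.

(* Conjugations of the scheme; they are entire, so that no strip enters. *)
Definition adm (Z : C -> M2) : Prop :=
  mderiv Z /\ realsym Z /\ (forall z, M2det (Z z) = 1%C) /\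
  exists s : R, (s = 1 \/ s = -1) /\ forall z, Z (z + RtoC (2 * PI))%C = RtoC s *s Z z.

Lemma adm_mul Z Y : adm Z -> adm Y -> adm (fun z => Z z *m Y z).
Proof.
  intros [Z1 [Z2 [Z3 [s [Hs Z4]]]]] [Y1 [Y2 [Y3 [t [Ht Y4]]]]].
  split; [apply mderiv_mul; assumption|].
  split; [intros z; rewrite Z2, Y2, Mconj_mul; reflexivity|].
  split; [intros z; rewrite Mdet_mul, Z3, Y3; ring|].
  exists (s * t). split; [nra|]. intros z.
    rewrite Z4, Y4, Mscal_mul_l, Mscal_mul_r, Mscal_scal, RtoC_mult. reflexivity.
Qed.

Lemma adm_const A : M2det A = 1%C -> Mconj A = A -> adm (fun _ => A).
Proof.
  intros H1 H2. split; [apply mderiv_const|]. split; [intros z; rewrite H2; reflexivity|].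
  split; [intros _; exact H1|]. exists 1. split; [left; reflexivity|].
  intros _. rewrite Mscal_1. reflexivity.
Qed.

Lemma realsym_real f x : realsym f ->
  Im (m11 (f (RtoC x))) = 0 /\ Im (m12 (f (RtoC x))) = 0 /\
  Im (m21 (f (RtoC x))) = 0 /\ Im (m22 (f (RtoC x))) = 0.
Proof.
  intros H. specialize (H (RtoC x)). rewrite Cconj_RtoC in H.
  assert (Hr : forall c, c = Cconj c -> Im c = 0).
  { intros c Hc. apply (f_equal Im) in Hc. rewrite im_conj in Hc. lra. }
  repeat split; apply Hr.
  - exact (f_equal m11 H).
  - exact (f_equal m12 H).
  - exact (f_equal m21 H).
  - exact (f_equal m22 H).
Qed.

Lemma adm_analytic h Z : adm Z -> analytic_PSL2R_on_strip h Z.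
Proof.
  intros [[Z1 [Z2 [Z3 Z4]]] [Hr [Hd [s [Hs Hp]]]]].
  split.
  { intros z _. split; [|split; [|split]]; apply ex_derive_C_NormedModule;
    [apply Z1 | apply Z2 | apply Z3 | apply Z4]. }
  split; [intros x; apply (realsym_real Z x Hr)|].
  split; [intros z _; apply Hd|].
  exists s. split; [exact Hs | intros z _; apply Hp].
Qed.

(** * Elimination of Fourier modes *)

Definition cj (b : R) (Z f g : C -> M2) : Prop :=
  forall z, Z (z + RtoC b)%C *m f z *m M2inv1 (Z z) = g z.

Lemma cj_trans b Z Y f g h : cj b Z f g -> cj b Y g h -> cj b (fun z => Y z *m Z z) f h.
Proof.
  intros H1 H2 z. rewrite <- H2, <- H1, Minv_mul, !Mmul_assoc. reflexivity.
Qed.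

Lemma Cconj_plus_RtoC z b : Cconj (z + RtoC b)%C = (Cconj z + RtoC b)%C.
Proof. rewrite Cplus_conj, Cconj_RtoC. reflexivity. Qed.

Lemma cj_realsym b Z f g : adm Z -> cj b Z f g -> realsym f -> realsym g.
Proof.
  intros [_ [HZ _]] H Hf z. rewrite <- !H, !Mconj_mul, Mconj_inv, <- Hf, <- !HZ, Cconj_plus_RtoC.
  reflexivity.
Qed.

Lemma cj_det b Z f g : adm Z -> cj b Z f g -> (forall z, M2det (f z) = 1%C) ->
  forall z, M2det (g z) = 1%C.
Proof.
  intros [_ [_ [HZ _]]] H Hf z. rewrite <- H, !Mdet_mul, Mdet_inv, !HZ, Hf. ring.
Qed.

(* sl2 is spanned by three nilpotent matrices, which makes the exponential polynomial along each of them. *)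
Definition nil1 (a : M2) : M2 := mkM2 0 (m12 a + m11 a)%C 0 0.
Definition nil2 (a : M2) : M2 := mkM2 0 0 (m21 a - m11 a)%C 0.
Definition nil3 (a : M2) : M2 := mkM2 (m11 a) (- m11 a)%C (m11 a) (- m11 a)%C.
(** A polynomial substitute for exp: for traceless [a] it is $I+a$ up to second order, and every
    factor is unipotent, so the determinant is exactly one. *)
Definition uni (a : M2) : M2 := (I2 +m nil1 a) *m (I2 +m nil2 a) *m (I2 +m nil3 a).

Ltac nring := unfold uni, nil1, nil2, nil3; mring.

Lemma nil_sum a : mtr a = RtoC 0 -> nil1 a +m nil2 a +m nil3 a = a.
Proof.
  destruct a as [p q r s]; unfold nil1, nil2, nil3; munfold. intros H.
  f_equal; try ring. replace s with (p + s - p)%C by ring. rewrite H. ring.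
Qed.

Lemma uni_det a : M2det (uni a) = 1%C.
Proof. nring. Qed.

Lemma uni_expand a : mtr a = RtoC 0 -> uni a = I2 +m a +m
  (nil1 a *m nil2 a +m (nil1 a *m nil3 a +m (nil2 a *m nil3 a +m nil1 a *m nil2 a *m nil3 a))).
Proof.
  intros H. rewrite <- (nil_sum a H) at 2. unfold uni.
  generalize (nil1 a) (nil2 a) (nil3 a). mring.
Qed.

(** Each factor $I+n$ with $n^2=0$ has inverse $I-n$: the order is reversed and the odd terms change
    sign. *)
Lemma uni_inv_expand a : mtr a = RtoC 0 -> M2inv1 (uni a) = I2 +m RtoC (-1) *s a +m
  (nil3 a *m nil2 a +m (nil3 a *m nil1 a +m (nil2 a *m nil1 a +m
     RtoC (-1) *s (nil3 a *m nil2 a *m nil1 a)))).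
Proof.
  intros H. rewrite <- (nil_sum a H) at 2.
  replace (M2inv1 (uni a)) with
    ((I2 +m RtoC (-1) *s nil3 a) *m (I2 +m RtoC (-1) *s nil2 a) *m (I2 +m RtoC (-1) *s nil1 a))
    by nring.
  generalize (nil1 a) (nil2 a) (nil3 a). mring.
Qed.

Lemma lin_nil1 : lin nil1. Proof. split; nring. Qed.
Lemma lin_nil2 : lin nil2. Proof. split; nring. Qed.
Lemma lin_nil3 : lin nil3. Proof. split; nring. Qed.

Lemma Cmod_minus_le u v : Cmod (u - v)%C <= Cmod u + Cmod v.
Proof. unfold Cminus. rewrite <- (Cmod_opp v). apply Cmod_triangle. Qed.

Ltac cmods a := pose proof (Cmod_ge_0 (m11 a)); pose proof (Cmod_ge_0 (m12 a));
  pose proof (Cmod_ge_0 (m21 a)); pose proof (Cmod_ge_0 (m22 a)).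

Lemma nm_nil1 a : nm (nil1 a) <= 1 * nm a.
Proof.
  unfold nm, nil1; simpl. rewrite Cmod_0. cmods a.
  pose proof (Cmod_triangle (m12 a) (m11 a)). lra.
Qed.
Lemma nm_nil2 a : nm (nil2 a) <= 1 * nm a.
Proof.
  unfold nm, nil2; simpl. rewrite Cmod_0. cmods a.
  pose proof (Cmod_minus_le (m21 a) (m11 a)). lra.
Qed.
Lemma nm_nil3 a : nm (nil3 a) <= 4 * nm a.
Proof. unfold nm, nil3; simpl. rewrite !Cmod_opp. cmods a. lra. Qed.

Lemma Mconj_nil1 a : Mconj (nil1 a) = nil1 (Mconj a).
Proof. unfold nil1; munfold. rewrite Cplus_conj, !Cconj_RtoC. reflexivity. Qed.
Lemma Mconj_nil2 a : Mconj (nil2 a) = nil2 (Mconj a).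
Proof. unfold nil2; munfold. rewrite Cminus_conj, !Cconj_RtoC. reflexivity. Qed.
Lemma Mconj_nil3 a : Mconj (nil3 a) = nil3 (Mconj a).
Proof. unfold nil3; munfold. rewrite !Copp_conj. reflexivity. Qed.
Lemma Mconj_uni a : Mconj (uni a) = uni (Mconj a).
Proof.
  unfold uni. rewrite !Mconj_mul, !Mconj_add, Mconj_I2, Mconj_nil1, Mconj_nil2, Mconj_nil3.
  reflexivity.
Qed.

Lemma mtr_ev F z : (forall p, In p F -> mtr (snd p) = RtoC 0) -> mtr (ev F z) = RtoC 0.
Proof.
  induction F as [|[k a] F IH]; intros H; [unfold mtr; simpl; ring|].
  assert (Ha := H (k, a) (or_introl eq_refl)). assert (HF := IH (fun p Hp => H p (or_intror Hp))).
  simpl in *. unfold mtr in *; simpl.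
  replace (_ + _)%C with (e (IZR k) z * (m11 a + m22 a) + (m11 (ev F z) + m22 (ev F z)))%C by ring.
  rewrite Ha, HF. ring.
Qed.

Lemma adm_uni Y : (forall p, In p Y -> mtr (snd p) = RtoC 0) -> realsym (ev Y) ->
  adm (fun z => uni (ev Y z)).
Proof.
  intros Ht Hr.
  assert (Hd : forall T, lin T -> mderiv (fun z => I2 +m T (ev Y z))).
  { intros T HT. apply mderiv_add; [apply mderiv_const|].
    apply (mderiv_ext (ev (tmap (fun _ => T) Y))); [intros; apply ev_tmap_lin, HT | apply mderiv_ev]. }
  split.
  { exact (mderiv_mul _ _ (mderiv_mul _ _ (Hd _ lin_nil1) (Hd _ lin_nil2)) (Hd _ lin_nil3)). }
  split; [intros z; rewrite Hr, Mconj_uni; reflexivity|].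
  split; [intros; apply uni_det|].
  exists 1. split; [left; reflexivity|]. intros z. rewrite ev_2PI, Mscal_1. reflexivity.
Qed.

(* [S] inverts the linearised conjugation action of the cocycle [A] on the range of [Pi], with loss [D]. *)
Record solver (b : R) (A : M2) (Pi S : Z -> M2 -> M2) (D : R) : Prop := {
  Pi_lin : forall k, lin (Pi k);
  S_lin : forall k, lin (S k);
  Pi_conj : forall k a, Pi (- k)%Z (Mconj a) = Mconj (Pi k a);
  S_conj : forall k a, S (- k)%Z (Mconj a) = Mconj (S k a);
  Pi_idem : forall k a, Pi k (Pi k a) = Pi k a;
  Pi_le : forall k a, nm (Pi k a) <= 3 * nm a;
  S_le : forall k a, nm (S k a) <= D * nm (Pi k a);
  S_tr : forall k a, mtr (S k a) = RtoC 0;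
  S_eq : forall k a, e (IZR k) (RtoC b) *s S k a +m RtoC (-1) *s (A *m S k a *m M2inv1 A)
                     = RtoC (-1) *s Pi k a;
  D_ge_1 : 1 <= D }.

(** List form of the terms of degree two and three in [uni_expand]; [quad'] does the same for
    [uni_inv_expand]. *)
Definition quad (L1 L2 L3 : tp) : tp :=
  tmul L1 L2 ++ tmul L1 L3 ++ tmul L2 L3 ++ tmul (tmul L1 L2) L3.

Definition quad' (L1 L2 L3 : tp) : tp :=
  tmul L3 L2 ++ tmul L3 L1 ++ tmul L2 L1 ++ tscal (RtoC (-1)) (tmul (tmul L3 L2) L1).

Lemma Cmod_RtoC_m1 : Cmod (RtoC (-1)) = 1.
Proof. rewrite Cmod_R. apply Rabs_m1. Qed.

Lemma nrm_tmul_le h F G x y : 0 <= h -> nrm h F <= x -> nrm h G <= y -> nrm h (tmul F G) <= x * y.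
Proof.
  intros Hh Hx Hy. eapply Rle_trans; [apply nrm_tmul, Hh|].
  apply Rmult_le_compat; try apply nrm_ge_0; assumption.
Qed.

(** The constant is $13=1+4+4+4$, the cubic term being bounded by $4y^2$. *)
Lemma nrm_quad h L1 L2 L3 y : 0 <= h -> 0 <= y <= 1 ->
  nrm h L1 <= y -> nrm h L2 <= y -> nrm h L3 <= 4 * y ->
  nrm h (quad L1 L2 L3) <= 13 * (y * y) /\ nrm h (quad' L1 L2 L3) <= 13 * (y * y).
Proof.
  intros Hh Hy H1 H2 H3. unfold quad, quad'. rewrite !nrm_app.
  pose proof (nrm_tscal h (RtoC (-1)) (tmul (tmul L3 L2) L1)) as Hs.
  rewrite Cmod_RtoC_m1, Rmult_1_l in Hs.
  pose proof (nrm_tmul_le h L1 L2 _ _ Hh H1 H2) as H12.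
  pose proof (nrm_tmul_le h L1 L3 _ _ Hh H1 H3) as H13.
  pose proof (nrm_tmul_le h L2 L3 _ _ Hh H2 H3) as H23.
  pose proof (nrm_tmul_le h L2 L1 _ _ Hh H2 H1) as H21.
  pose proof (nrm_tmul_le h L3 L1 _ _ Hh H3 H1) as H31.
  pose proof (nrm_tmul_le h L3 L2 _ _ Hh H3 H2) as H32.
  pose proof (nrm_tmul_le h _ L3 _ _ Hh H12 H3) as H123.
  pose proof (nrm_tmul_le h _ L1 _ _ Hh H32 H1) as H321.
  assert (y * y * y <= y * y) by nra. nra.
Qed.

(** A Newton step with conjugation [uni] of $Y=S(F)$. The error is of size $y(y+f)$ and not $y^2$,
    where $y$ bounds $Y$ and $f$ bounds $F$, because the part of $F$ outside the range of [Pi] stays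
    and multiplies $Y$; iteration therefore converges only geometrically, but at the same width. *)
Lemma elim_step b A Pi S D h F : solver b A Pi S D -> 0 <= h ->
  M2det A = 1%C -> Mconj A = A -> nm A <= 4 -> realsym (ev F) ->
  D * nrm h (tmap Pi F) <= 1 -> nrm h F <= 1 ->
  exists Z F', adm Z /\ cj b Z (fun z => (I2 +m ev F z) *m A) (fun z => (I2 +m ev F' z) *m A) /\
    nrm h (tmap Pi F') <= 21000 * (D * nrm h (tmap Pi F)) * (D * nrm h (tmap Pi F) + nrm h F) /\
    nrm h F' <= nrm h F + nrm h (tmap Pi F)
      + 7000 * (D * nrm h (tmap Pi F)) * (D * nrm h (tmap Pi F) + nrm h F).
Proof.
  intros HS Hh HdA HcA HA HF Hy Hf.
  (* Symmetrising leaves the function unchanged and makes $Y$ real. *)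
  set (Fs := tsym F). set (Y := tmap S Fs).
  set (n := nrm h (tmap Pi F)) in *. set (f := nrm h F) in *.
  set (L1 := tmap (fun _ => nil1) Y). set (L2 := tmap (fun _ => nil2) Y).
  set (L3 := tmap (fun _ => nil3) Y).
  set (q := quad L1 L2 L3). set (q' := quad' L1 L2 L3).
  set (cA := fun (_ : Z) a => A *m a *m M2inv1 A).
  (* Chosen so that the conjugation at $z+b$ is $I+U$ and $A$ times its inverse at $z$ is $(I+V)A$;
     the new cocycle is then $(I+U)(I+F)(I+V)A$. *)
  set (U := tshift b (Y ++ q)). set (V := tmap cA (tscal (RtoC (-1)) Y ++ q')).
  set (Rem := tshift b q ++ tmap cA q' ++ tmul U Fs ++ tmul Fs V ++ tmul U V ++ tmul (tmul U Fs) V).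
  set (G := tmap (fun k a => a +m RtoC (-1) *s Pi k a) Fs).
  pose proof (D_ge_1 _ _ _ _ _ HS) as HD.
  assert (Hn0 : 0 <= n) by apply nrm_ge_0. assert (Hf0 : 0 <= f) by apply nrm_ge_0.
  assert (Hns : nrm h (tmap Pi Fs) <= n) by (apply nrm_tmap_tsym; apply HS).
  assert (Hfs : nrm h Fs <= f) by apply nrm_tsym.
  set (y := D * n) in *. assert (Hy0 : 0 <= y) by (unfold y; nra).
  assert (HY : nrm h Y <= y).
  { unfold Y. eapply Rle_trans; [apply nrm_tmap_le2; intros; apply (S_le _ _ _ _ _ HS)|].
    apply Rmult_le_compat_l; [lra | exact Hns]. }
  assert (HL1 : nrm h L1 <= y).
  { eapply Rle_trans; [apply nrm_tmap_le; intros; apply nm_nil1 | lra]. }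
  assert (HL2 : nrm h L2 <= y).
  { eapply Rle_trans; [apply nrm_tmap_le; intros; apply nm_nil2 | lra]. }
  assert (HL3 : nrm h L3 <= 4 * y).
  { eapply Rle_trans; [apply nrm_tmap_le; intros; apply nm_nil3 | lra]. }
  destruct (nrm_quad h L1 L2 L3 y Hh (conj Hy0 Hy) HL1 HL2 HL3) as [Hq Hq'].
  fold q in Hq. fold q' in Hq'.
  assert (HcAle : forall H, nrm h (tmap cA H) <= 16 * nrm h H).
  { intros H. apply nrm_tmap_le. intros k a. unfold cA.
    eapply Rle_trans; [apply nm_mul|]. rewrite nm_inv.
    pose proof (nm_mul A a). pose proof (nm_ge_0 A). pose proof (nm_ge_0 a).
    apply Rle_trans with (nm A * nm a * nm A); [apply Rmult_le_compat_r; assumption|].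
    replace (nm A * nm a * nm A) with (nm A * nm A * nm a) by ring.
    apply Rmult_le_compat_r; [assumption|]. nra. }
  assert (Hyy : y * y <= y) by (rewrite <- (Rmult_1_r y) at 3; apply Rmult_le_compat_l; assumption).
  assert (HU : nrm h U <= 14 * y).
  { unfold U. eapply Rle_trans; [apply nrm_tshift|]. rewrite nrm_app. lra. }
  assert (HV : nrm h V <= 224 * y).
  { unfold V. eapply Rle_trans; [apply HcAle|]. rewrite nrm_app.
    pose proof (nrm_tscal h (RtoC (-1)) Y) as Hs. rewrite Cmod_RtoC_m1, Rmult_1_l in Hs. lra. }
  (* The sum is at most $(13+16\cdot 13+2\cdot 14\cdot 224)y^2+(14+224)yf$, using $f\le 1$ in the
     triple product. *)
  assert (HRem : nrm h Rem <= 7000 * y * (y + f)).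
  { unfold Rem. rewrite !nrm_app.
    pose proof (nrm_tshift h b q) as B1. pose proof (HcAle q') as B2.
    pose proof (nrm_tmul_le h U Fs _ _ Hh HU Hfs) as B3.
    pose proof (nrm_tmul_le h Fs V _ _ Hh Hfs HV) as B4.
    pose proof (nrm_tmul_le h U V _ _ Hh HU HV) as B5.
    pose proof (nrm_tmul_le h _ V _ _ Hh B3 HV) as B6.
    assert (B8 : 0 <= y * f) by (apply Rmult_le_pos; assumption).
    assert (B9 : 0 <= y * y) by (apply Rmult_le_pos; assumption).
    assert (B7 : y * y * f <= y * y * 1) by (apply Rmult_le_compat_l; assumption). lra. }
  assert (HYt : forall p, In p Y -> mtr (snd p) = RtoC 0).
  { intros p Hp. unfold Y, tmap in Hp. apply in_map_iff in Hp. destruct Hp as [r [<- _]].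
    apply (S_tr _ _ _ _ _ HS). }
  assert (HYr : realsym (ev Y)) by (apply realsym_tmap_tsym; apply HS).
  assert (HcAlin : lin (cA 0%Z)) by (split; unfold cA; mring).
  exists (fun z => uni (ev Y z)), (G ++ Rem).
  split; [apply adm_uni; assumption|]. split; [|split].
  - intros z.
    assert (EL : forall w, ev L1 w = nil1 (ev Y w) /\ ev L2 w = nil2 (ev Y w) /\ ev L3 w = nil3 (ev Y w)).
    { intros w. repeat split; apply ev_tmap_lin; [apply lin_nil1 | apply lin_nil2 | apply lin_nil3]. }
    assert (EU : uni (ev Y (z + RtoC b)%C) = I2 +m ev U z).
    { rewrite uni_expand by (apply mtr_ev, HYt). unfold U, q, quad.
      rewrite ev_tshift, !ev_app, !ev_tmul.
      destruct (EL (z + RtoC b)%C) as [-> [-> ->]]. rewrite !Madd_assoc. reflexivity. }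
    assert (EV : A *m M2inv1 (uni (ev Y z)) = (I2 +m ev V z) *m A).
    { rewrite uni_inv_expand by (apply mtr_ev, HYt). unfold V, q', quad'.
      rewrite (ev_tmap_lin (cA 0%Z)) by exact HcAlin. unfold cA.
      rewrite !ev_app, !ev_tscal, !ev_tmul. destruct (EL z) as [-> [-> ->]].
      generalize (nil1 (ev Y z)) (nil2 (ev Y z)) (nil3 (ev Y z)) (ev Y z). intros a1 a2 a3 a.
      rewrite Mmul_add_l, Mmul_1_l.
      rewrite <- !Mmul_assoc, (Minv_l A HdA), Mmul_1_r.
      rewrite <- (Mmul_1_r A) at 2. rewrite <- Mmul_add_r, !Mmul_assoc, !Madd_assoc. reflexivity. }
    rewrite EU, <- !Mmul_assoc, EV, !Mmul_assoc. f_equal.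
    rewrite <- (ev_tsym F z HF). fold Fs.
    (* The linear parts of $U$ and $V$ together are the linearised action on $Y$, which by [S_eq]
       cancels exactly the [Pi] part of $F$. *)
    assert (EP : ev (tshift b Y) z +m ev (tmap cA (tscal (RtoC (-1)) Y)) z
                 = RtoC (-1) *s ev (tmap Pi Fs) z).
    { rewrite <- ev_tscal. unfold tshift, tscal, Y. rewrite !tmap_tmap, <- ev_tmap_add.
      f_equal. apply tmap_ext. intros k a. rewrite <- (S_eq _ _ _ _ _ HS). unfold cA. mring. }
    assert (EG : ev G z = ev Fs z +m RtoC (-1) *s ev (tmap Pi Fs) z).
    { unfold G. rewrite ev_tmap_add, tmap_id. f_equal.
      rewrite <- ev_tscal. unfold tscal. rewrite tmap_tmap. reflexivity. }
    assert (EU2 : ev U z = ev (tshift b Y) z +m ev (tshift b q) z).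
    { unfold U, tshift. rewrite tmap_app, ev_app. reflexivity. }
    assert (EV2 : ev V z = ev (tmap cA (tscal (RtoC (-1)) Y)) z +m ev (tmap cA q') z).
    { unfold V. rewrite tmap_app, ev_app. reflexivity. }
    rewrite ev_app, EG, <- EP. unfold Rem. rewrite !ev_app, !ev_tmul.
    set (u := ev U z) in *. set (v := ev V z) in *.
    transitivity (I2 +m ev Fs z +m u +m v +m (u *m ev Fs z +m (ev Fs z *m v +m (u *m v +m u *m ev Fs z *m v)))).
    { generalize (ev Fs z). clear. mring. }
    rewrite EU2 at 1. rewrite EV2 at 1. generalize (ev Fs z) (ev (tshift b Y) z) (ev (tshift b q) z)
      (ev (tmap cA (tscal (RtoC (-1)) Y)) z) (ev (tmap cA q') z). clear. mring.
  - rewrite tmap_app, nrm_app.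
    assert (H0 : nrm h (tmap Pi G) <= 0).
    { unfold G. rewrite tmap_tmap. rewrite <- (Rmult_0_l (nrm h Fs)). apply nrm_tmap_le.
      intros k a. destruct (Pi_lin _ _ _ _ _ HS k) as [-> ->].
      rewrite (Pi_idem _ _ _ _ _ HS).
      replace (_ +m _) with M0 by mring. rewrite nm_M0. lra. }
    assert (H1 : nrm h (tmap Pi Rem) <= 3 * nrm h Rem).
    { apply nrm_tmap_le. intros; apply (Pi_le _ _ _ _ _ HS). }
    lra.
  - rewrite nrm_app.
    assert (H0 : nrm h G <= nrm h Fs + nrm h (tmap Pi Fs)).
    { unfold nrm, G, tmap. rewrite !fsum_map, <- fsum_plus. apply fsum_le. intros [k a]; simpl.
      rewrite <- Rmult_plus_distr_r. apply Rmult_le_compat_r; [left; apply wt_pos|].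
      eapply Rle_trans; [apply nm_add|]. rewrite nm_scal, Cmod_RtoC_m1. lra. }
    lra.
Qed.

Lemma realsym_factor A F : M2det A = 1%C -> Mconj A = A ->
  realsym (fun z => (I2 +m ev F z) *m A) -> realsym (ev F).
Proof.
  intros Hd Hc Hr z. specialize (Hr z). cbv beta in Hr. rewrite Mconj_mul, Hc, Mconj_add, Mconj_I2 in Hr.
  apply (f_equal (fun M => M *m M2inv1 A)) in Hr.
  rewrite <- !Mmul_assoc, (Minv_r A Hd), !Mmul_1_r in Hr.
  apply (f_equal (fun M => RtoC (-1) *s I2 +m M)) in Hr. rewrite !Madd_assoc in Hr.
  replace (RtoC (-1) *s I2 +m I2) with M0 in Hr by mring. rewrite !Madd_0_l in Hr. exact Hr.
Qed.

(** One smallness condition covers any number of elimination steps, since $F$ grows only by a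
    geometric series. Hence [kappa] is arbitrary, a freedom that [step_resonant] relies on. *)
Lemma elim_modes b A Pi S D h F : solver b A Pi S D -> 0 <= h ->
  M2det A = 1%C -> Mconj A = A -> nm A <= 4 -> realsym (ev F) ->
  500000 * (D * D) * nrm h F <= 1 ->
  forall kappa, 0 < kappa ->
  exists Z F', adm Z /\ cj b Z (fun z => (I2 +m ev F z) *m A) (fun z => (I2 +m ev F' z) *m A) /\
    nrm h (tmap Pi F') <= kappa /\ nrm h F' <= 8 * nrm h F.
Proof.
  intros HS Hh HdA HcA HA HF HX.
  pose proof (D_ge_1 _ _ _ _ _ HS) as HD.
  set (X := nrm h F) in *. assert (HX0 : 0 <= X) by apply nrm_ge_0.
  assert (HXD : X <= D * X) by (rewrite <- (Rmult_1_l X) at 1; apply Rmult_le_compat_r; lra).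
  assert (HDX0 : 0 <= D * X) by lra.
  assert (HDX : D * X <= D * (D * X)) by
    (rewrite <- (Rmult_1_l (D * X)) at 1; apply Rmult_le_compat_r; lra).
  assert (HDn : forall x, 0 <= x -> x <= D * x) by
    (intros x Hx; rewrite <- (Rmult_1_l x) at 1; apply Rmult_le_compat_r; lra).
  (* The initial 3 is that of [Pi_le]. Each step halves $n$ and adds at most $7n/6\le (7/2)X2^{-m}$
     to the norm, increments which sum to $7X$. *)
  assert (Hm : forall m : nat, exists Z F', adm Z /\
    cj b Z (fun z => (I2 +m ev F z) *m A) (fun z => (I2 +m ev F' z) *m A) /\
    nrm h (tmap Pi F') <= 3 * X * (/ 2) ^ m /\ nrm h F' <= 8 * X - 7 * X * (/ 2) ^ m).
  { induction m as [|m IH].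
    - exists (fun _ => I2), F. split; [apply adm_const; [apply Mdet_I2 | apply Mconj_I2]|].
      split; [intros z; rewrite Mmul_1_l; replace (M2inv1 I2) with I2 by mring; apply Mmul_1_r|].
      rewrite pow_O, !Rmult_1_r. split; [|fold X; lra].
      apply nrm_tmap_le. intros; apply (Pi_le _ _ _ _ _ HS).
    - destruct IH as [Z [F1 [HZ [Hc [Hn Hf]]]]].
      set (n := nrm h (tmap Pi F1)) in *. set (f := nrm h F1) in *.
      assert (Hn0 : 0 <= n) by apply nrm_ge_0. assert (Hf0 : 0 <= f) by apply nrm_ge_0.
      assert (Hp : 0 < (/ 2) ^ m <= 1).
      { split; [apply pow_lt; lra|]. rewrite <- (pow1 m). apply pow_incr; lra. }
      assert (Hn3 : n <= 3 * X) by nra. assert (Hf8 : f <= 8 * X) by nra.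
      assert (HF1 : realsym (ev F1)).
      { assert (Hr : realsym (fun z => (I2 +m ev F1 z) *m A)).
        { apply (cj_realsym _ _ _ _ HZ Hc). intros z.
          rewrite Mconj_mul, HcA, Mconj_add, Mconj_I2, HF. reflexivity. }
        exact (realsym_factor A F1 HdA HcA Hr). }
      destruct (elim_step b A Pi S D h F1 HS Hh HdA HcA HA HF1) as [Z' [F2 [HZ' [Hc' [Hn' Hf']]]]].
      { fold n. apply Rle_trans with (D * (3 * X)); [apply Rmult_le_compat_l; lra | lra]. }
      { fold f. lra. }
      fold n f in Hn', Hf'.
      (* Here $Dn+f\le (3+8)DX$, and $42000\cdot 11<500000$. *)
      assert (Hk : 42000 * D * (D * n + f) <= 1).
      { assert (D * n <= D * (3 * X)) by (apply Rmult_le_compat_l; lra).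
        apply Rle_trans with (42000 * D * (11 * (D * X))); [|lra].
        apply Rmult_le_compat_l; lra. }
      assert (Hr : 42000 * (D * n) * (D * n + f) <= n).
      { replace (42000 * (D * n) * (D * n + f)) with (n * (42000 * D * (D * n + f))) by ring.
        rewrite <- (Rmult_1_r n) at 3. apply Rmult_le_compat_l; assumption. }
      exists (fun z => Z' z *m Z z), F2. split; [apply adm_mul; assumption|].
      split; [exact (cj_trans _ _ _ _ _ _ Hc Hc')|].
      simpl. split; lra. }
  intros kappa Hk.
  destruct (pow_lt_1_zero (/ 2) ltac:(rewrite Rabs_pos_eq; lra) (kappa / (3 * X + 1))) as [m Hmm].
  { apply Rdiv_lt_0_compat; lra. }
  destruct (Hm m) as [Z [F' [HZ [Hc [Hn Hf]]]]].
  assert (Hp : 0 < (/ 2) ^ m) by (apply pow_lt; lra).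
  exists Z, F'. split; [exact HZ|]. split; [exact Hc|]. split; [|nra].
  specialize (Hmm m (Nat.le_refl m)). rewrite Rabs_pos_eq in Hmm by lra.
  assert (Hb : (3 * X + 1) * (/ 2) ^ m < kappa).
  { apply Rmult_lt_reg_r with (/ (3 * X + 1)); [apply Rinv_0_lt_compat; lra|].
    replace ((3 * X + 1) * (/ 2) ^ m * / (3 * X + 1)) with ((/ 2) ^ m) by (field; lra). exact Hmm. }
  nra.
Qed.

(** * Solving the linearised equation without resonances *)

Definition hf : C := RtoC (/ 2).
Lemma hf2 : (hf + hf)%C = RtoC 1.
Proof. unfold hf. rewrite <- RtoC_plus. f_equal. field. Qed.
Lemma Cmod_hf : Cmod hf = / 2.
Proof. unfold hf. rewrite Cmod_R, Rabs_pos_eq; lra. Qed.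
Lemma conj_hf : Cconj hf = hf. Proof. apply Cconj_RtoC. Qed.
Lemma hf_eq : (hf * 2)%C = RtoC 1.
Proof. rewrite <- hf2. ring. Qed.

Definition tfree (a : M2) : M2 :=
  mkM2 (hf * (m11 a - m22 a))%C (m12 a) (m21 a) (- (hf * (m11 a - m22 a)))%C.
Definition sc (a : M2) : M2 := (hf * mtr a)%C *s I2.

Lemma lin_tfree : lin tfree. Proof. split; unfold tfree; mring. Qed.
Lemma lin_sc : lin sc. Proof. split; unfold sc; mring. Qed.

Lemma tfree_sc a : tfree a +m sc a = a.
Proof.
  destruct a as [p q r s]; unfold tfree, sc; munfold. f_equal; try ring.
  - replace (_ + _)%C with ((hf * 2) * p)%C by ring. rewrite hf_eq. ring.
  - replace (_ + _)%C with ((hf * 2) * s)%C by ring. rewrite hf_eq. ring.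
Qed.

Lemma mtr_tfree a : mtr (tfree a) = RtoC 0. Proof. unfold tfree; mring. Qed.

Lemma tfree_traceless a : mtr a = RtoC 0 -> tfree a = a.
Proof.
  intros H. rewrite <- (tfree_sc a) at 2. unfold sc. rewrite H.
  replace (hf * 0)%C with (RtoC 0) by ring. rewrite Mscal_0_l, Madd_0_r. reflexivity.
Qed.

Lemma nm_tfree a : nm (tfree a) <= 1 * nm a.
Proof.
  unfold nm, tfree; simpl. rewrite Cmod_opp, Cmod_mult, Cmod_hf.
  pose proof (Cmod_minus_le (m11 a) (m22 a)). lra.
Qed.

Lemma nm_sc a : nm (sc a) <= 1 * nm a.
Proof.
  unfold sc. rewrite nm_scal, nm_I2, Cmod_mult, Cmod_hf. unfold nm, mtr. cmods a.
  pose proof (Cmod_triangle (m11 a) (m22 a)). lra.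
Qed.

Lemma Mconj_tfree a : tfree (Mconj a) = Mconj (tfree a).
Proof.
  unfold tfree; munfold. rewrite Copp_conj, Cmult_conj, Cminus_conj, conj_hf. reflexivity.
Qed.

(* The determinant condition makes the scalar part [s] a fixed point of s |-> (G^2 - s^2) / 2, a contraction of the oscillation. *)
Lemma scalar_part_osc h G s : 0 <= h ->
  (forall z, RtoC 2 *s ev s z +m ev s z *m ev s z = ev G z *m ev G z) ->
  nrm h G <= / 4 -> nrm h s <= / 4 ->
  forall kappa, 0 < kappa -> exists s', (forall z, ev s' z = ev s z) /\ osc h s' <= osc h G + kappa.
Proof.
  intros Hh He HG Hs.
  assert (Ho := osc_ge_0 h G).
  assert (Hm : forall m : nat, exists s', (forall z, ev s' z = ev s z) /\ nrm h s' <= / 4 /\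
    osc h s' <= osc h G + (/ 4) ^ m * osc h s).
  { induction m as [|m [s1 [E1 [N1 O1]]]].
    - exists s. split; [reflexivity|]. split; [exact Hs|]. rewrite pow_O. lra.
    - exists (tscal hf (tmul G G) ++ tscal (- hf)%C (tmul s1 s1)). split; [|split].
      + intros z. rewrite ev_app, !ev_tscal, !ev_tmul, E1, <- He.
        replace (_ +m _) with ((hf * 2)%C *s ev s z) by (generalize (ev s z); mring).
        rewrite hf_eq. apply Mscal_1.
      + rewrite nrm_app.
        pose proof (nrm_tscal h hf (tmul G G)) as A1.
        pose proof (nrm_tscal h (- hf)%C (tmul s1 s1)) as A2.
        rewrite ?Cmod_opp, Cmod_hf in *.
        pose proof (nrm_tmul_le h G G _ _ Hh HG HG). pose proof (nrm_tmul_le h s1 s1 _ _ Hh N1 N1). lra.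
      + rewrite osc_app.
        pose proof (osc_tscal h hf (tmul G G)) as A1.
        pose proof (osc_tscal h (- hf)%C (tmul s1 s1)) as A2.
        rewrite ?Cmod_opp, Cmod_hf in *.
        pose proof (osc_tmul h G G Hh) as B1. pose proof (osc_tmul h s1 s1 Hh) as B2.
        pose proof (osc_ge_0 h s1). pose proof (osc_ge_0 h s).
        assert (C1 : nrm h G * osc h G <= / 4 * osc h G) by (apply Rmult_le_compat_r; lra).
        assert (C2 : nrm h s1 * osc h s1 <= / 4 * osc h s1) by (apply Rmult_le_compat_r; lra).
        simpl. lra. }
  intros kappa Hk. assert (Ho' := osc_ge_0 h s).
  destruct (pow_lt_1_zero (/ 4) ltac:(rewrite Rabs_pos_eq; lra) (kappa / (osc h s + 1))) as [m Hmm].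
  { apply Rdiv_lt_0_compat; lra. }
  specialize (Hmm m (Nat.le_refl m)).
  assert (Hp : 0 < (/ 4) ^ m) by (apply pow_lt; lra). rewrite Rabs_pos_eq in Hmm by lra.
  destruct (Hm m) as [s' [E [_ O]]]. exists s'. split; [exact E|].
  assert (Hb : (osc h s + 1) * (/ 4) ^ m < kappa).
  { apply Rmult_lt_reg_r with (/ (osc h s + 1)); [apply Rinv_0_lt_compat; lra|].
    replace ((osc h s + 1) * (/ 4) ^ m * / (osc h s + 1)) with ((/ 4) ^ m) by (field; lra). exact Hmm. }
  lra.
Qed.

(** Scalar modes are fixed by conjugation with constants and escape the solvers. The determinant
    condition allows the list to be replaced by one whose scalar part oscillates little. *)
Lemma absorb_scalar_part h F A : 0 <= h -> nm A <= 4 ->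
  (forall z, M2det (I2 +m ev F z) = 1%C) ->
  nrm h (tmap (fun _ => tfree) F) <= / 4 -> nrm h (tmap (fun _ => sc) F) <= / 4 ->
  forall kappa, 0 < kappa -> exists W, (forall z, ev W z = (I2 +m ev F z) *m A) /\
    osc h W <= 8 * osc h (tmap (fun _ => tfree) F) + kappa.
Proof.
  intros Hh HA Hd HG Hs kappa Hk.
  destruct (scalar_part_osc h (tmap (fun _ => tfree) F) (tmap (fun _ => sc) F)) with (kappa := kappa / 4)
    as [s' [E O]]; try assumption; [|lra|].
  (* With $G$ the traceless and $sI$ the scalar part, $G^2=-\det G$ turns $(1+s)^2+\det G=1$ into
     $2s+s^2=G^2$. *)
  { intros z. rewrite (ev_tmap_lin tfree _ _ lin_tfree), (ev_tmap_lin sc _ _ lin_sc).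
    specialize (Hd z). destruct (ev F z) as [p q r s]. unfold tfree, sc. munfold.
    assert (H1 : (p + s + p * s - q * r)%C = RtoC 0).
    { replace (p + s + p * s - q * r)%C with ((1 + p) * (1 + s) - (0 + q) * (0 + r) - 1)%C by ring.
      rewrite Hd. ring. }
    assert (H2 : (2 * (hf * (p + s)) + hf * (p + s) * (hf * (p + s)) -
       (hf * (p - s) * (hf * (p - s)) + q * r))%C = RtoC 0).
    { replace (_ - _)%C with ((hf * 2) * (p + s) + (hf * 2) * (hf * 2) * (p * s) - q * r)%C by ring.
      rewrite hf_eq. rewrite <- H1. ring. }
    apply Ceq_minus in H2. f_equal; try ring.
    - replace (_ + _)%C with (2 * (hf * (p + s)) + hf * (p + s) * (hf * (p + s)))%C by ring.
      rewrite H2. ring.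
    - replace (_ + _)%C with (2 * (hf * (p + s)) + hf * (p + s) * (hf * (p + s)))%C by ring.
      rewrite H2. ring. }
  set (G := tmap (fun _ => tfree) F) in *.
  exists (tmap (fun _ a => a *m A) ((0%Z, I2) :: G ++ s')). split.
  - intros z. rewrite (ev_tmap_lin (fun a => a *m A)) by apply lin_mul_r. f_equal.
    cbn [ev fst snd]. rewrite e_0_freq, Mscal_1, ev_app, E. f_equal.
    unfold G. rewrite (ev_tmap_lin tfree _ _ lin_tfree), (ev_tmap_lin sc _ _ lin_sc). apply tfree_sc.
  - assert (H1 : osc h (tmap (fun _ a => a *m A) ((0%Z, I2) :: G ++ s')) <= 4 * osc h ((0%Z, I2) :: G ++ s')).
    { apply osc_tmap_le. intros _ a. eapply Rle_trans; [apply nm_mul|].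
      rewrite Rmult_comm. apply Rmult_le_compat_r; [apply nm_ge_0 | exact HA]. }
    change ((0%Z, I2) :: G ++ s') with (((0%Z, I2) :: nil) ++ G ++ s') in *.
    assert (H0 : osc h ((0%Z, I2) :: nil) = 0) by (unfold osc; simpl; ring).
    rewrite !osc_app, H0 in H1. lra.
Qed.

(** * The adjoint action and its resolvent *)

Definition act (A a : M2) : M2 := A *m a *m M2inv1 A.

Lemma lin_act A : lin (act A). Proof. split; unfold act; mring. Qed.

Lemma nm_act A a : nm (act A a) <= nm A * nm A * nm a.
Proof.
  unfold act. eapply Rle_trans; [apply nm_mul|]. rewrite nm_inv.
  replace (nm A * nm A * nm a) with (nm A * nm a * nm A) by ring.
  apply Rmult_le_compat_r; [apply nm_ge_0 | apply nm_mul].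
Qed.

Lemma mtr_act A a : M2det A = 1%C -> mtr (act A a) = mtr a.
Proof.
  intros H. replace (mtr (act A a)) with (M2det A * mtr a)%C.
  - rewrite H. ring.
  - unfold act. mring.
Qed.

(* Cayley-Hamilton for the adjoint action; its eigenvalues are 1 and the squares of those of [A]. *)
Lemma act_cubic A a : M2det A = 1%C -> mtr a = RtoC 0 ->
  let s := (mtr A * mtr A - 2)%C in
  act A (act A (act A a)) =
    (s + 1)%C *s act A (act A a) +m (- (s + 1))%C *s act A a +m a.
Proof.
  intros Hd Ht s.
  assert (H : act A (act A (act A a)) =
    (mtr A * mtr A - M2det A)%C *s act A (act A a)
    +m (- (M2det A * (mtr A * mtr A - M2det A)))%C *s act A a +m (M2det A * M2det A * M2det A)%C *s a).
  { destruct a as [p q r w]. unfold mtr in Ht; cbn [m11 m22] in Ht.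
    assert (w = - p)%C as -> by (replace w with (p + w - p)%C by ring; rewrite Ht; ring).
    clear s Hd Ht. unfold act. mring. }
  rewrite H, Hd. unfold s.
  replace (mtr A * mtr A - 1)%C with (mtr A * mtr A - 2 + 1)%C by ring.
  replace (1 * 1 * 1)%C with (RtoC 1) by ring. rewrite Mscal_1. f_equal. f_equal. f_equal. ring.
Qed.

Definition low (M k : Z) : bool := andb (negb (k =? 0)%Z) (Z.abs k <=? M)%Z.

Lemma low_opp M k : low M (- k) = low M k.
Proof.
  unfold low. rewrite Z.abs_opp. f_equal. f_equal.
  destruct (Z.eqb_spec (- k) 0), (Z.eqb_spec k 0); lia.
Qed.

Definition pi_nr (M : Z) (k : Z) (a : M2) : M2 := if low M k then tfree a else M0.

(** Minus the resolvent $(z-T)^{-1}a$ of $T$ = [act A], written as a polynomial in $T$ over its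
    characteristic polynomial $(z-1)(z^2-sz+1)$, with $s$ the trace of $A^2$. Nothing is
    diagonalised, so $A$ may be parabolic or close to it. *)
Definition adj_sol (A : M2) (z : C) (a : M2) : M2 :=
  let s := (mtr A * mtr A - 2)%C in
  (- / ((z - 1) * (z * z - s * z + 1)))%C *s
  (act A (act A a) +m (z - (s + 1))%C *s act A a +m (z * z - (s + 1) * z + (s + 1))%C *s a).

Definition S_nr (b : R) (A : M2) (M : Z) (k : Z) (a : M2) : M2 :=
  if low M k then adj_sol A (e (IZR k) (RtoC b)) (tfree a) else M0.

Lemma lin_adj_sol A z : lin (adj_sol A z).
Proof.
  split.
  - intros a b. unfold adj_sol. destruct (lin_act A) as [H _]. rewrite !H.
    generalize (act A (act A a)) (act A (act A b)) (act A a) (act A b). mring.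
  - intros c a. unfold adj_sol. destruct (lin_act A) as [_ H]. rewrite !H.
    generalize (act A (act A a)) (act A a). mring.
Qed.

Lemma adj_sol_eq A z a : M2det A = 1%C -> mtr a = RtoC 0 ->
  ((z - 1) * (z * z - (mtr A * mtr A - 2) * z + 1))%C <> RtoC 0 ->
  z *s adj_sol A z a +m RtoC (-1) *s act A (adj_sol A z a) = RtoC (-1) *s a.
Proof.
  intros Hd Ht Hp. unfold adj_sol. destruct (lin_act A) as [H1 H2].
  rewrite H2, !H1, !H2, act_cubic by assumption. cbv zeta.
  set (s := (mtr A * mtr A - 2)%C) in *. set (p := ((z - 1) * (z * z - s * z + 1))%C) in *.
  generalize (act A (act A a)) (act A a). intros a2 a1.
  transitivity ((- (p * / p))%C *s a).
  - unfold p. set (ip := (/ _)%C). mring.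
  - rewrite Cinv_r by exact Hp. f_equal. rewrite <- RtoC_opp. reflexivity.
Qed.

Lemma Mconj_act A a : Mconj A = A -> Mconj (act A a) = act A (Mconj a).
Proof. intros H. unfold act. rewrite !Mconj_mul, Mconj_inv, H. reflexivity. Qed.

Lemma Cconj_mtr A : Mconj A = A -> Cconj (mtr A) = mtr A.
Proof. intros H. rewrite <- H at 2. unfold mtr; simpl. apply Cplus_conj. Qed.

Lemma Cmod_mtr A : Cmod (mtr A) <= nm A.
Proof. unfold mtr, nm. cmods A. pose proof (Cmod_triangle (m11 A) (m22 A)). lra. Qed.

Lemma e_opp_RtoC (x b : R) : e (- x) (RtoC b) = Cconj (e x (RtoC b)).
Proof. rewrite <- (Cconj_RtoC b) at 1. rewrite e_conj, Ropp_involutive. reflexivity. Qed.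

Lemma adj_sol_conj A z a : Mconj A = A ->
  ((z - 1) * (z * z - (mtr A * mtr A - 2) * z + 1))%C <> RtoC 0 ->
  adj_sol A (Cconj z) (Mconj a) = Mconj (adj_sol A z a).
Proof.
  intros HA Hp. unfold adj_sol. cbv zeta. rewrite !Mconj_scal, !Mconj_add, !Mconj_scal, !Mconj_act by assumption.
  rewrite Copp_conj, Cinv_conj by exact Hp.
  repeat (rewrite ?Cmult_conj, ?Cplus_conj, ?Cminus_conj, ?Cconj_RtoC).
  rewrite !Cconj_mtr by exact HA. reflexivity.
Qed.

Lemma nm_adj_sol A z a D : nm A <= 4 -> Cmod z = 1 -> 0 < D ->
  D <= Cmod ((z - 1) * (z * z - (mtr A * mtr A - 2) * z + 1))%C ->
  nm (adj_sol A z a) <= 615 / D * nm a.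
Proof.
  intros HA Hz HD Hp. unfold adj_sol. cbv zeta.
  set (s := (mtr A * mtr A - 2)%C) in *. set (p := ((z - 1) * (z * z - s * z + 1))%C) in *.
  assert (Hp0 : p <> RtoC 0) by (intros E; rewrite E, Cmod_0 in Hp; lra).
  rewrite nm_scal, Cmod_opp, Cmod_inv by exact Hp0.
  assert (Hs : Cmod (s + 1)%C <= 19).
  { unfold s. replace (mtr A * mtr A - 2 + 1)%C with (mtr A * mtr A - 1)%C by ring.
    eapply Rle_trans; [apply Cmod_minus_le|]. rewrite Cmod_mult, Cmod_1.
    pose proof (Cmod_mtr A). pose proof (Cmod_ge_0 (mtr A)). nra. }
  assert (H1 : Cmod (z - (s + 1))%C <= 20).
  { eapply Rle_trans; [apply Cmod_minus_le|]. lra. }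
  assert (H2 : Cmod (z * z - (s + 1) * z + (s + 1))%C <= 39).
  { eapply Rle_trans; [apply Cmod_triangle|].
    pose proof (Cmod_minus_le (z * z) ((s + 1) * z)) as H. rewrite !Cmod_mult, Hz in H. lra. }
  assert (HA2 : nm A * nm A <= 16) by (pose proof (nm_ge_0 A); nra).
  assert (Hact : forall x, nm (act A x) <= 16 * nm x).
  { intros x. eapply Rle_trans; [apply nm_act|]. apply Rmult_le_compat_r; [apply nm_ge_0 | exact HA2]. }
  pose proof (Hact a) as K1. pose proof (Hact (act A a)) as K2.
  (* $615=16\cdot 16+20\cdot 16+39$. *)
  assert (K : nm (act A (act A a) +m (z - (s + 1))%C *s act A a +m
     (z * z - (s + 1) * z + (s + 1))%C *s a) <= 615 * nm a).
  { eapply Rle_trans; [apply nm_add|]. eapply Rle_trans; [apply Rplus_le_compat_r, nm_add|].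
    rewrite !nm_scal. pose proof (nm_ge_0 a). pose proof (nm_ge_0 (act A a)).
    assert (Cmod (z - (s + 1))%C * nm (act A a) <= 20 * nm (act A a)) by (apply Rmult_le_compat_r; assumption).
    assert (Cmod (z * z - (s + 1) * z + (s + 1))%C * nm a <= 39 * nm a) by (apply Rmult_le_compat_r; assumption).
    lra. }
  replace (615 / D * nm a) with (/ D * (615 * nm a)) by (field; lra).
  apply Rmult_le_compat; [left; apply Rinv_0_lt_compat; lra | apply nm_ge_0 | | exact K].
  apply Rinv_le_contravar; assumption.
Qed.

Lemma solver_nr b A M D : M2det A = 1%C -> Mconj A = A -> nm A <= 4 -> 0 < D <= 1 ->
  (forall k, low M k = true -> let z := e (IZR k) (RtoC b) in
     D <= Cmod ((z - 1) * (z * z - (mtr A * mtr A - 2) * z + 1))%C) ->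
  solver b A (pi_nr M) (S_nr b A M) (615 / D).
Proof.
  intros Hd Hc HA [HD HD1] H.
  assert (Hnz : forall k, low M k = true -> let z := e (IZR k) (RtoC b) in
     ((z - 1) * (z * z - (mtr A * mtr A - 2) * z + 1))%C <> RtoC 0).
  { intros k Hk z E. specialize (H k Hk). cbv zeta in H. fold z in H. rewrite E, Cmod_0 in H. lra. }
  split; try (intros k; try intros a; unfold pi_nr, S_nr; rewrite ?low_opp).
  - destruct (low M k); [apply lin_tfree | split; intros; [rewrite Madd_0_r | rewrite Mscal_0_r]; reflexivity].
  - destruct (low M k); [|split; intros; [rewrite Madd_0_r | rewrite Mscal_0_r]; reflexivity].
    destruct lin_tfree as [t1 t2], (lin_adj_sol A (e (IZR k) (RtoC b))) as [l1 l2].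
    split; intros; [rewrite t1, l1 | rewrite t2, l2]; reflexivity.
  - destruct (low M k); [apply Mconj_tfree | symmetry; apply Mconj_M0].
  - destruct (low M k) eqn:E; [|symmetry; apply Mconj_M0].
    rewrite opp_IZR, e_opp_RtoC, Mconj_tfree. apply adj_sol_conj; [exact Hc | apply Hnz, E].
  - destruct (low M k); [|reflexivity]. apply tfree_traceless, mtr_tfree.
  - pose proof (nm_ge_0 a). pose proof (nm_tfree a). destruct (low M k); [lra | rewrite nm_M0; lra].
  - destruct (low M k) eqn:E.
    + apply nm_adj_sol; [exact HA | apply Cmod_e_RtoC | exact HD | apply H, E].
    + rewrite nm_M0. lra.
  - destruct (low M k) eqn:E; [|unfold mtr; simpl; ring].
    unfold adj_sol. set (c := (- / _)%C). cbv zeta.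
    assert (T1 := mtr_tfree a). assert (T2 := mtr_act A (tfree a) Hd). assert (T3 := mtr_act A (act A (tfree a)) Hd).
    rewrite T2 in T3. rewrite T1 in T2, T3.
    set (a2 := act A (act A (tfree a))) in *. set (a1 := act A (tfree a)) in *. set (a0 := tfree a) in *.
    set (u := (_ - _)%C). set (v := (_ + _)%C).
    transitivity (c * (mtr a2 + u * mtr a1 + v * mtr a0))%C.
    + unfold mtr; simpl. ring.
    + rewrite T1, T2, T3. ring.
  - destruct (low M k) eqn:E.
    + apply (adj_sol_eq A _ (tfree a) Hd (mtr_tfree a) (Hnz k E)).
    + unfold act. mring.
  - apply Rmult_le_reg_r with D; [exact HD|]. replace (615 / D * D) with 615 by (field; lra). lra.
Qed.

(** * Resonant modes and rotations *)

Lemma Ci2 : (Ci * Ci)%C = (- (1))%C.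
Proof. unfold Ci. apply injective_projections; simpl; ring. Qed.

Lemma conj_Ci : Cconj Ci = (- Ci)%C.
Proof. unfold Ci, Cconj. apply injective_projections; simpl; ring. Qed.

Definition rot (c s : C) : M2 := mkM2 c (- s)%C s c.

(* Eigenbasis of the adjoint action of the rotations: eigenvalues 1, (c + i s)^2 and (c - i s)^2. *)
Definition comb (j u v : C) : M2 :=
  mkM2 (u + v)%C (- j - Ci * u + Ci * v)%C (j - Ci * u + Ci * v)%C (- (u + v))%C.
Definition cJ (a : M2) : C := (hf * (m21 a - m12 a))%C.
Definition cP (a : M2) : C := (hf * hf * ((m11 a - m22 a) + Ci * (m12 a + m21 a)))%C.
Definition cM (a : M2) : C := (hf * hf * ((m11 a - m22 a) - Ci * (m12 a + m21 a)))%C.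

Lemma C2_hf : (2 * hf)%C = RtoC 1.
Proof. rewrite Cmult_comm. apply hf_eq. Qed.

Lemma hf_inv : hf = (/ 2)%C.
Proof. unfold hf. rewrite RtoC_inv; [reflexivity | lra]. Qed.

Lemma comb_coords a : comb (cJ a) (cP a) (cM a) = tfree a.
Proof.
  destruct a as [p q r s]. unfold comb, cJ, cP, cM, tfree. cbn [m11 m12 m21 m22].
  rewrite hf_inv. pose proof Ci2 as H. f_equal; field [H].
Qed.

Lemma cJ_comb j u v : cJ (comb j u v) = j.
Proof. unfold comb, cJ; cbn [m11 m12 m21 m22]. rewrite hf_inv. field. Qed.
Lemma cP_comb j u v : cP (comb j u v) = u.
Proof. unfold comb, cP; cbn [m11 m12 m21 m22]. rewrite hf_inv. pose proof Ci2 as H. field [H]. Qed.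
Lemma cM_comb j u v : cM (comb j u v) = v.
Proof. unfold comb, cM; cbn [m11 m12 m21 m22]. rewrite hf_inv. pose proof Ci2 as H. field [H]. Qed.

Lemma act_rot_comb c s j u v : (c * c + s * s)%C = RtoC 1 ->
  act (rot c s) (comb j u v) =
  comb j ((c + Ci * s) * (c + Ci * s) * u)%C ((c - Ci * s) * (c - Ci * s) * v)%C.
Proof.
  intros H. assert (H' : (s * s)%C = (1 - c * c)%C) by (rewrite <- H; ring).
  pose proof Ci2 as HI. unfold act, rot, comb; munfold. f_equal; ring [HI H'].
Qed.

Lemma comb_linear c d j u v j' u' v' :
  comb (c * j + d * j')%C (c * u + d * u')%C (c * v + d * v')%C = c *s comb j u v +m d *s comb j' u' v'.
Proof. unfold comb; munfold. f_equal; ring. Qed.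

Lemma nm_comb j u v : nm (comb j u v) <= 2 * Cmod j + 4 * Cmod u + 4 * Cmod v.
Proof.
  unfold nm, comb; simpl. rewrite Cmod_opp.
  pose proof (Cmod_triangle u v) as H1.
  assert (H2 : forall x y z, Cmod (x - Ci * y + Ci * z)%C <= Cmod x + Cmod y + Cmod z).
  { intros x y z. eapply Rle_trans; [apply Cmod_triangle|].
    pose proof (Cmod_minus_le x (Ci * y)) as H. rewrite !Cmod_mult, Cmod_Ci in *. lra. }
  pose proof (H2 j u v). pose proof (H2 (- j)%C u v) as H3. rewrite Cmod_opp in H3. lra.
Qed.

Lemma Cmod_cJ a : 2 * Cmod (cJ a) <= nm a.
Proof.
  unfold cJ, nm. rewrite Cmod_mult, Cmod_hf. cmods a.
  pose proof (Cmod_minus_le (m21 a) (m12 a)). lra.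
Qed.
Lemma Cmod_cP a : 4 * Cmod (cP a) <= nm a.
Proof.
  unfold cP, nm. rewrite !Cmod_mult, Cmod_hf.
  pose proof (Cmod_triangle (m11 a - m22 a) (Ci * (m12 a + m21 a))) as H.
  rewrite Cmod_mult, Cmod_Ci in H.
  pose proof (Cmod_minus_le (m11 a) (m22 a)). pose proof (Cmod_triangle (m12 a) (m21 a)). lra.
Qed.
Lemma Cmod_cM a : 4 * Cmod (cM a) <= nm a.
Proof.
  unfold cM, nm. rewrite !Cmod_mult, Cmod_hf.
  pose proof (Cmod_minus_le (m11 a - m22 a) (Ci * (m12 a + m21 a))) as H.
  rewrite Cmod_mult, Cmod_Ci in H.
  pose proof (Cmod_minus_le (m11 a) (m22 a)). pose proof (Cmod_triangle (m12 a) (m21 a)). lra.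
Qed.

Lemma cJ_conj a : cJ (Mconj a) = Cconj (cJ a).
Proof. unfold cJ; simpl. rewrite Cmult_conj, Cminus_conj, conj_hf. reflexivity. Qed.
Lemma cP_conj a : cP (Mconj a) = Cconj (cM a).
Proof.
  unfold cP, cM; simpl. rewrite !Cmult_conj, !Cminus_conj, Cmult_conj, Cplus_conj, conj_hf, conj_Ci. ring.
Qed.
Lemma cM_conj a : cM (Mconj a) = Cconj (cP a).
Proof.
  unfold cP, cM; simpl. rewrite !Cmult_conj, Cplus_conj, !Cminus_conj, Cmult_conj, Cplus_conj, conj_hf, conj_Ci. ring.
Qed.
Lemma comb_conj j u v : Mconj (comb j u v) = comb (Cconj j) (Cconj v) (Cconj u).
Proof.
  unfold comb; munfold.
  repeat rewrite ?Copp_conj, ?Cplus_conj, ?Cminus_conj, ?Cmult_conj, ?conj_Ci. f_equal; ring.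
Qed.

Lemma cJ_lin c a b d : cJ (c *s a +m d *s b) = (c * cJ a + d * cJ b)%C.
Proof. unfold cJ; munfold; ring. Qed.
Lemma cP_lin c a b d : cP (c *s a +m d *s b) = (c * cP a + d * cP b)%C.
Proof. unfold cP; munfold; ring. Qed.
Lemma cM_lin c a b d : cM (c *s a +m d *s b) = (c * cM a + d * cM b)%C.
Proof. unfold cM; munfold; ring. Qed.

Lemma lin_intro T : (forall c a d b, T (c *s a +m d *s b) = c *s T a +m d *s T b) -> lin T.
Proof.
  intros H. split.
  - intros a b. specialize (H 1%C a 1%C b). rewrite !Mscal_1 in H. exact H.
  - intros c a. specialize (H c a 0%C M0). rewrite !Mscal_0_l, !Madd_0_r in H. exact H.
Qed.

Lemma lin_diag (x y z : C) : lin (fun a => comb (x * cJ a) (y * cP a) (z * cM a)).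
Proof.
  apply lin_intro. intros. rewrite cJ_lin, cP_lin, cM_lin, <- comb_linear. f_equal; ring.
Qed.

Definition chi (t : bool) : C := if t then RtoC 1 else RtoC 0.
Definition off (N n k : Z) : bool := andb (negb (k =? n)%Z) (Z.abs k <=? N)%Z.

Lemma off_opp N n k : off N n (- k) = off N (- n) k.
Proof.
  unfold off. rewrite Z.abs_opp. f_equal. f_equal.
  destruct (Z.eqb_spec (- k) n), (Z.eqb_spec k (- n)); lia.
Qed.

Lemma Cconj_chi t : Cconj (chi t) = chi t.
Proof. destruct t; apply Cconj_RtoC. Qed.
Lemma chi_idem t : (chi t * chi t)%C = chi t.
Proof. destruct t; simpl; ring. Qed.
Lemma Cmod_chi t : Cmod (chi t) <= 1.
Proof. destruct t; simpl; rewrite ?Cmod_1, ?Cmod_0; lra. Qed.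

(** Each eigencoordinate has its own resonant frequency: 0 for the eigenvalue 1, $n$ for $w$ and
    $-n$ for its conjugate. The modes spared here are exactly those that the action of [Q n] makes
    constant. *)
Definition pi_res (N n k : Z) (a : M2) : M2 :=
  comb (chi (off N 0 k) * cJ a)%C (chi (off N n k) * cP a)%C (chi (off N (- n) k) * cM a)%C.

Definition S_res (b : R) (w : C) (N n k : Z) (a : M2) : M2 :=
  let z := e (IZR k) (RtoC b) in
  comb (- (chi (off N 0 k) / (z - 1)) * cJ a)%C (- (chi (off N n k) / (z - w)) * cP a)%C
       (- (chi (off N (- n) k) / (z - Cconj w)) * cM a)%C.

Lemma rot_det c s : (c * c + s * s)%C = RtoC 1 -> M2det (rot c s) = 1%C.
Proof. intros H. unfold rot; munfold. rewrite <- H. ring. Qed.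

Lemma sum_sq_RtoC c s : c * c + s * s = 1 -> (RtoC c * RtoC c + RtoC s * RtoC s)%C = RtoC 1.
Proof. intros H. rewrite <- !RtoC_mult, <- RtoC_plus, H. reflexivity. Qed.

Lemma solver_res b N n D c s : 0 < D <= 1 -> c * c + s * s = 1 ->
  let w := ((RtoC c + Ci * RtoC s) * (RtoC c + Ci * RtoC s))%C in
  (forall k, off N 0 k = true -> D <= Cmod (e (IZR k) (RtoC b) - 1)%C) ->
  (forall k, off N n k = true -> D <= Cmod (e (IZR k) (RtoC b) - w)%C) ->
  solver b (rot (RtoC c) (RtoC s)) (pi_res N n) (S_res b w N n) (3 / D).
Proof.
  intros [HD HD1] Hcs w H0 H1.
  (* The divisors of the third coordinate are the conjugates of those of the second at the opposite
     frequency. *)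
  assert (H2 : forall k, off N (- n) k = true -> D <= Cmod (e (IZR k) (RtoC b) - Cconj w)%C).
  { intros k Hk. rewrite <- off_opp in Hk. specialize (H1 _ Hk).
    rewrite opp_IZR, e_opp_RtoC in H1. rewrite <- (Cmod_conj (_ - Cconj w)%C), Cminus_conj, Cconj_conj.
    exact H1. }
  assert (Hw : Cconj w = ((RtoC c - Ci * RtoC s) * (RtoC c - Ci * RtoC s))%C).
  { unfold w. rewrite !Cmult_conj, !Cplus_conj, !Cmult_conj, !Cconj_RtoC, conj_Ci. ring. }
  assert (Hdiv : forall t x, (t = true -> D <= Cmod x) -> Cmod (chi t / x)%C <= / D).
  { intros t x Hx. destruct t; simpl.
    - specialize (Hx eq_refl). assert (x <> RtoC 0) by (intros E; rewrite E, Cmod_0 in Hx; lra).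
      unfold Cdiv. rewrite Cmult_1_l, Cmod_inv by assumption. apply Rinv_le_contravar; assumption.
    - unfold Cdiv. rewrite Cmult_0_l, Cmod_0. left. apply Rinv_0_lt_compat, HD. }
  assert (Hsol : forall t x y, (t = true -> D <= Cmod x) ->
     (x * (- (chi t / x) * y))%C = (- (1) * (chi t * y))%C).
  { intros t x y Hx. destruct t; simpl.
    - specialize (Hx eq_refl). assert (x <> RtoC 0) by (intros E; rewrite E, Cmod_0 in Hx; lra).
      field. assumption.
    - unfold Cdiv. ring. }
  assert (Hchi : forall t x, (chi t / x * (chi t))%C = (chi t / x)%C).
  { intros t x. unfold Cdiv. rewrite <- (chi_idem t) at 3. ring. }
  assert (Hid : forall k a, pi_res N n k (pi_res N n k a) = pi_res N n k a).
  { intros k a. unfold pi_res. rewrite cJ_comb, cP_comb, cM_comb.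
    rewrite !Cmult_assoc, !chi_idem. reflexivity. }
  (* This puts the projected matrix on the right of [S_le]. *)
  assert (HSP : forall k a, S_res b w N n k a = S_res b w N n k (pi_res N n k a)).
  { intros k a. unfold S_res, pi_res. rewrite cJ_comb, cP_comb, cM_comb.
    f_equal; rewrite <- (Hchi _ _) at 1; ring. }
  assert (Hconj : forall t x y, Cconj (- (chi t / x) * y)%C = (- (chi t / Cconj x) * Cconj y)%C).
  { intros t x y. rewrite Cmult_conj, Copp_conj. unfold Cdiv. rewrite Cmult_conj, Cconj_chi.
    (* At a vanishing divisor the default value of the inverse has imaginary part 0, so conjugation
       commutes with it there too. *)
    destruct (Ceq_dec x 0) as [-> | Hx]; [|rewrite Cinv_conj by exact Hx; reflexivity].
    rewrite Cconj_RtoC. f_equal. f_equal. f_equal.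
    unfold Cinv, Cconj; simpl. apply injective_projections; simpl; [reflexivity|].
    unfold Rdiv. rewrite Ropp_0, !Rmult_0_l, Ropp_0. reflexivity. }
  split.
  - intros k. apply lin_diag.
  - intros k. apply lin_diag.
  - intros k a. unfold pi_res. rewrite comb_conj, cJ_conj, cP_conj, cM_conj, !Cmult_conj, !Cconj_chi, !off_opp.
    rewrite Z.opp_involutive. reflexivity.
  - intros k a. unfold S_res. rewrite comb_conj, cJ_conj, cP_conj, cM_conj, !Hconj, !off_opp.
    rewrite !Cminus_conj, Cconj_conj, Cconj_RtoC, opp_IZR, e_opp_RtoC, Z.opp_involutive. reflexivity.
  - exact Hid.
  (* Each of the three eigencoordinates contributes at most [nm a], which is the origin of the 3 in
     [Pi_le]. *)
  - intros k a. unfold pi_res. eapply Rle_trans; [apply nm_comb|]. rewrite !Cmod_mult.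
    assert (forall t x, Cmod (chi t) * Cmod x <= Cmod x).
    { intros t x. rewrite <- (Rmult_1_l (Cmod x)) at 2. apply Rmult_le_compat_r; [apply Cmod_ge_0 | apply Cmod_chi]. }
    pose proof (H (off N 0 k) (cJ a)). pose proof (H (off N n k) (cP a)). pose proof (H (off N (- n) k) (cM a)).
    pose proof (Cmod_cJ a). pose proof (Cmod_cP a). pose proof (Cmod_cM a). lra.
  - intros k a. rewrite HSP. generalize (pi_res N n k a). intros p.
    unfold S_res. eapply Rle_trans; [apply nm_comb|]. rewrite !Cmod_mult, !Cmod_opp.
    assert (Hb : forall t x y, (t = true -> D <= Cmod x) -> Cmod (chi t / x)%C * Cmod y <= / D * Cmod y).
    { intros. apply Rmult_le_compat_r; [apply Cmod_ge_0 | apply Hdiv; assumption]. }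
    pose proof (Hb _ _ (cJ p) (H0 k)) as B0. pose proof (Hb _ _ (cP p) (H1 k)) as B1.
    pose proof (Hb _ _ (cM p) (H2 k)) as B2.
    assert (HiD : 0 < / D) by (apply Rinv_0_lt_compat, HD).
    pose proof (Rmult_le_compat_l _ _ _ (Rlt_le _ _ HiD) (Cmod_cJ p)).
    pose proof (Rmult_le_compat_l _ _ _ (Rlt_le _ _ HiD) (Cmod_cP p)).
    pose proof (Rmult_le_compat_l _ _ _ (Rlt_le _ _ HiD) (Cmod_cM p)).
    unfold Rdiv. lra.
  - intros k a. unfold S_res, comb, mtr; simpl. ring.
  - intros k a. fold (act (rot (RtoC c) (RtoC s)) (S_res b w N n k a)).
    unfold S_res, pi_res. rewrite act_rot_comb by (apply sum_sq_RtoC, Hcs). fold w. rewrite <- Hw.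
    rewrite <- comb_linear.
    replace (RtoC (-1)) with (- (1))%C by (rewrite <- RtoC_opp; reflexivity).
    transitivity (comb (- (1) * (chi (off N 0 k) * cJ a))%C (- (1) * (chi (off N n k) * cP a))%C
       (- (1) * (chi (off N (- n) k) * cM a))%C).
    + rewrite <- (Hsol _ _ _ (H0 k)), <- (Hsol _ _ _ (H1 k)), <- (Hsol _ _ _ (H2 k)). f_equal; ring.
    + unfold comb; munfold. f_equal; ring.
  - apply Rmult_le_reg_r with D; [exact HD|]. replace (3 / D * D) with 3 by (field; lra). lra.
Qed.

(* Q z is the rotation by the angle -nz/2, a function of z that is only 2pi-periodic up to sign. *)
Definition Qp : M2 := mkM2 hf (- (Ci * hf))%C (Ci * hf)%C hf.
Definition Qm : M2 := mkM2 hf (Ci * hf)%C (- (Ci * hf))%C hf.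
Definition Q (n : Z) (z : C) : M2 := e (IZR n / 2) z *s Qp +m e (- (IZR n / 2)) z *s Qm.

Lemma adm_Q n : adm (Q n).
Proof.
  split; [apply mderiv_add; apply mderiv_e|]. split; [|split].
  - intros z. unfold Q. rewrite Mconj_add, !Mconj_scal, !e_conj, Ropp_involutive.
    replace (Mconj Qp) with Qm; [replace (Mconj Qm) with Qp; [apply Madd_comm|]|];
    unfold Qp, Qm; munfold; rewrite !Copp_conj, !Cmult_conj, conj_Ci, conj_hf; f_equal; ring.
  - intros z. unfold Q. pose proof (e_opp_l (IZR n / 2) z) as H. revert H.
    generalize (e (- (IZR n / 2)) z) (e (IZR n / 2) z). intros u v H.
    unfold Qp, Qm; munfold. pose proof Ci2 as HI.
    replace (_ - _)%C with (2 * hf * (2 * hf) * (u * v))%C by (ring [HI]).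
    rewrite C2_hf, H. ring.
  - destruct (e_half_2PI n) as [s [Hs E]]. exists s. split; [exact Hs|]. intros z. unfold Q.
    assert (E' : e (- (IZR n / 2)) (RtoC (2 * PI)) = RtoC s).
    { pose proof (e_opp_l (IZR n / 2) (RtoC (2 * PI))) as H. rewrite E in H.
      assert (Hss : (RtoC s * RtoC s)%C = RtoC 1).
      { rewrite <- RtoC_mult. f_equal. destruct Hs; subst; ring. }
      replace (e _ _) with (e (- (IZR n / 2)) (RtoC (2 * PI)) * (RtoC s * RtoC s))%C by (rewrite Hss; ring).
      rewrite Cmult_assoc, H. ring. }
    rewrite !e_plus, E, E', Mscal_add, !Mscal_scal. f_equal; f_equal; ring.
Qed.

Lemma Q_plus n z w : Q n (z + w)%C = Q n w *m Q n z.
Proof.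
  unfold Q. rewrite !e_plus. unfold Qp, Qm; munfold. pose proof Ci2 as HI.
  rewrite hf_inv. f_equal; field [HI].
Qed.

Lemma Q_rot n z c s : Q n z *m rot c s = rot c s *m Q n z.
Proof. unfold Q, Qp, Qm, rot; munfold. f_equal; ring. Qed.

Lemma act_Q_comb n z j u v :
  act (Q n z) (comb j u v) = comb j (e (- IZR n) z * u)%C (e (IZR n) z * v)%C.
Proof.
  assert (E1 : e (- IZR n) z = (e (- (IZR n / 2)) z * e (- (IZR n / 2)) z)%C).
  { rewrite <- e_plus_freq. f_equal. field. }
  assert (E2 : e (IZR n) z = (e (IZR n / 2) z * e (IZR n / 2) z)%C).
  { rewrite <- e_plus_freq. f_equal. field. }
  rewrite E1, E2. clear E1 E2.
  pose proof (e_opp_l (IZR n / 2) z) as H. revert H. unfold Q.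
  generalize (e (- (IZR n / 2)) z) (e (IZR n / 2) z). intros x y H.
  unfold act, comb, Qp, Qm; munfold. pose proof Ci2 as HI.
  rewrite hf_inv. f_equal; field [HI H].
Qed.

Lemma act_Q_sc n z a : act (Q n z) (sc a) = sc a.
Proof.
  destruct (adm_Q n) as [_ [_ [H _]]]. specialize (H z). unfold act, sc.
  rewrite Mscal_mul_r, Mscal_mul_l, Mmul_1_r, Minv_r by exact H. reflexivity.
Qed.

(** Rotations commute and $Q(z+b)=Q(b)Q(z)$, so a constant rotation is merely multiplied by
    $Q(b)$. *)
Lemma Q_rot_const n b c s : c * c + s * s = 1 ->
  exists c' s', c' * c' + s' * s' = 1 /\
  forall z, Q n (z + RtoC b)%C *m rot (RtoC c) (RtoC s) *m M2inv1 (Q n z) = rot (RtoC c') (RtoC s').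
Proof.
  intros H.
  set (x := cos (- (IZR n / 2) * b)). set (y := sin (- (IZR n / 2) * b)).
  assert (Hxy : x * x + y * y = 1).
  { pose proof (sin2_cos2 (- (IZR n / 2) * b)) as E. unfold Rsqr in E. unfold x, y. lra. }
  exists (x * c - y * s), (x * s + y * c). split.
  - replace (_ + _) with ((x * x + y * y) * (c * c + s * s)) by ring. rewrite Hxy, H. ring.
  - intros z. rewrite Q_plus, <- !Mmul_assoc, (Mmul_assoc (Q n z)), Q_rot, <- Mmul_assoc, Minv_r by apply adm_Q.
    rewrite Mmul_1_r.
    assert (E1 : e (- (IZR n / 2)) (RtoC b) = (RtoC x + Ci * RtoC y)%C).
    { unfold e, x, y; simpl. rewrite Rmult_0_r, Ropp_0, exp_0. apply injective_projections; simpl; ring. }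
    assert (E2 : e (IZR n / 2) (RtoC b) = (RtoC x - Ci * RtoC y)%C).
    { unfold e, x, y; simpl. rewrite Rmult_0_r, Ropp_0, exp_0.
      replace (- (IZR n / 2) * b) with (- (IZR n / 2 * b)) by ring. rewrite cos_neg, sin_neg.
      apply injective_projections; simpl; ring. }
    unfold Q, Qp, Qm, rot. rewrite E1, E2. munfold. rewrite hf_inv.
    rewrite !RtoC_minus, !RtoC_plus, !RtoC_mult. pose proof Ci2 as HI. f_equal; field [HI].
Qed.

Lemma nm_rot c s : c * c + s * s = 1 -> nm (rot (RtoC c) (RtoC s)) <= 3.
Proof.
  intros H. unfold nm, rot; simpl. rewrite Cmod_opp, !Cmod_R.
  assert (H1 : Rabs c * Rabs c + Rabs s * Rabs s = 1).
  { rewrite <- !Rabs_mult, !Rabs_pos_eq by nra. exact H. }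
  pose proof (Rabs_pos c). pose proof (Rabs_pos s).
  pose proof (Rle_0_sqr (Rabs c - Rabs s)) as Hd. unfold Rsqr in Hd.
  assert (H4 : (Rabs c + Rabs s) * (Rabs c + Rabs s) <= 2) by lra.
  assert (Rabs c + Rabs s <= 3 / 2) by nra. lra.
Qed.

(** * Narrowing the strip: gain in the tail, and the two kinds of step *)

Lemma wt_ge_1 h k : 0 <= h -> 1 <= wt h k.
Proof. intros Hh. unfold wt. rewrite <- exp_0. apply exp_le, Rmult_le_pos; [apply Rabs_pos | exact Hh]. Qed.

Lemma wt_mono h h' k : h' <= h -> wt h' k <= wt h k.
Proof. intros H. apply exp_le, Rmult_le_compat_l; [apply Rabs_pos | exact H]. Qed.

Lemma wt_tail h h' N k : h' <= h -> (N <= Z.abs k)%Z ->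
  wt h' k <= exp (- (IZR N * (h - h'))) * wt h k.
Proof.
  intros H Hk. unfold wt. rewrite <- exp_plus. apply exp_le.
  apply IZR_le in Hk. rewrite abs_IZR in Hk.
  assert (IZR N * (h - h') <= Rabs (IZR k) * (h - h')) by (apply Rmult_le_compat_r; lra). lra.
Qed.

Lemma nrm_mono h h' F : h' <= h -> nrm h' F <= nrm h F.
Proof.
  intros H. apply fsum_le. intros [k a]; simpl.
  apply Rmult_le_compat_l; [apply nm_ge_0 | apply wt_mono, H].
Qed.

Lemma osc_mono h h' F : h' <= h -> osc h' F <= osc h F.
Proof.
  intros H. apply fsum_le. intros [k a]; simpl. destruct Z.eqb; [lra|].
  apply Rmult_le_compat_l; [apply nm_ge_0 | apply wt_mono, H].
Qed.

Lemma det_cancel A B : M2det A = 1%C -> M2det (B *m A) = 1%C -> M2det B = 1%C.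
Proof. intros H. rewrite Mdet_mul, H, Cmult_1_r. exact (fun h => h). Qed.

(** Traceless modes up to [M] are eliminated at width [h], those beyond gain from the passage to
    [h']. The 64 is the growth factor 8 of [elim_modes] times the 8 of [absorb_scalar_part]. *)
Lemma step_nonresonant b A M D h h' F : 0 <= h' <= h -> M2det A = 1%C -> Mconj A = A -> nm A <= 4 ->
  0 < D <= 1 ->
  (forall k, low M k = true -> let z := e (IZR k) (RtoC b) in
     D <= Cmod ((z - 1) * (z * z - (mtr A * mtr A - 2) * z + 1))%C) ->
  realsym (ev F) -> (forall z, M2det (I2 +m ev F z) = 1%C) ->
  500000 * (615 / D * (615 / D)) * nrm h F <= 1 ->
  forall kappa, 0 < kappa -> exists Z W, adm Z /\ cj b Z (fun z => (I2 +m ev F z) *m A) (ev W) /\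
    osc h' W <= 64 * exp (- (IZR M * (h - h'))) * nrm h F + kappa /\
    nm (ev W 0%C) <= nm A + 8 * nrm h F * nm A.
Proof.
  intros Hh HdA HcA HA HD Hdiv HF HdF Hsm kappa Hk.
  pose proof (solver_nr b A M D HdA HcA HA HD Hdiv) as HS.
  assert (HX : 500000 * nrm h F <= 1).
  { pose proof (D_ge_1 _ _ _ _ _ HS). pose proof (nrm_ge_0 h F).
    assert (1 <= 615 / D * (615 / D)) by nra. nra. }
  (* Multiplied by the 8 of [absorb_scalar_part] this is half of [kappa]; the other half is the
     error of that lemma. *)
  destruct (elim_modes b A _ _ _ h F HS) with (kappa := kappa / 16) as [Z [F' [HZ [Hc [Hn Hf]]]]]; try assumption; try lra.
  assert (HdF' : forall z, M2det (I2 +m ev F' z) = 1%C).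
  { intros z. apply (det_cancel A); [exact HdA|].
    apply (cj_det b Z (fun z => (I2 +m ev F z) *m A) (fun z => (I2 +m ev F' z) *m A)); try assumption.
    intros w. rewrite Mdet_mul, HdF, HdA. ring. }
  assert (Hf' : nrm h' F' <= nrm h F') by (apply nrm_mono; lra).
  assert (H1 : nrm h' (tmap (fun _ => tfree) F') <= 1 * nrm h' F') by (apply nrm_tmap_le; intros; apply nm_tfree).
  assert (H2 : nrm h' (tmap (fun _ => sc) F') <= 1 * nrm h' F') by (apply nrm_tmap_le; intros; apply nm_sc).
  destruct (absorb_scalar_part h' F' A) with (kappa := kappa / 2) as [W [HW Ho]]; try assumption; try lra.
  exists Z, W. split; [exact HZ|]. split; [|split].
  - intros z. rewrite HW. apply Hc.
  - set (x := exp (- (IZR M * (h - h')))) in *.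
    assert (Hx : 0 < x) by apply exp_pos.
    assert (H3 : osc h' (tmap (fun _ => tfree) F') <= nrm h (tmap (pi_nr M) F') + x * nrm h F').
    { unfold osc, nrm, tmap. rewrite !fsum_map, <- fsum_scal, <- fsum_plus. apply fsum_le.
      intros [k a]; cbn [fst snd]. unfold pi_nr, low.
      pose proof (nm_tfree a) as T1. pose proof (nm_ge_0 a) as T2. pose proof (nm_ge_0 (tfree a)) as T3.
      pose proof (wt_pos h k) as T4. pose proof (wt_pos h' k) as T5.
      assert (T6 : 0 <= x * (nm a * wt h k)) by (repeat apply Rmult_le_pos; lra).
      destruct (Z.eqb_spec k 0) as [Ek|Ek]; cbn [negb andb].
      - rewrite nm_M0. lra.
      - destruct (Z.leb_spec (Z.abs k) M) as [Hl|Hl].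
        + assert (nm (tfree a) * wt h' k <= nm (tfree a) * wt h k).
          { apply Rmult_le_compat_l; [assumption | apply wt_mono; lra]. }
          lra.
        + rewrite nm_M0. pose proof (wt_tail h h' M k ltac:(lra) ltac:(lia)) as T7. fold x in T7.
          apply Rle_trans with (nm a * (x * wt h k)); [|lra].
          apply Rmult_le_compat; lra. }
    assert (x * nrm h F' <= x * (8 * nrm h F)) by (apply Rmult_le_compat_l; lra).
    lra.
  - rewrite HW, Mmul_add_l, Mmul_1_l. eapply Rle_trans; [apply nm_add|]. apply Rplus_le_compat_l.
    eapply Rle_trans; [apply nm_mul|]. apply Rmult_le_compat_r; [apply nm_ge_0|].
    eapply Rle_trans; [apply (nm_ev_0 h); lra | exact Hf].
Qed.

(** [Q n] has frequencies $\pm n/2$ and is in general no [tp], but its adjoint action has integer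
    frequencies and shifts the three eigencoordinates by $0$, $-n$ and $n$. The phases come from
    evaluating [Q n] at $z+b$. *)
Definition rot_monomial (b : R) (n : Z) (p : Z * M2) : tp :=
  let (k, a) := p in
  (k, sc a +m comb (cJ a) 0 0) :: ((k - n)%Z, comb 0 (e (- IZR n) (RtoC b) * cP a)%C 0)
    :: ((k + n)%Z, comb 0 0 (e (IZR n) (RtoC b) * cM a)%C) :: nil.
Definition rot_tp (b : R) (n : Z) (F : tp) : tp := flat_map (rot_monomial b n) F.

Lemma act_add A a b : act A (a +m b) = act A a +m act A b.
Proof. apply lin_act. Qed.
Lemma act_scal A c a : act A (c *s a) = c *s act A a.
Proof. apply lin_act. Qed.

Lemma ev_rot_tp b n F z : ev (rot_tp b n F) z = act (Q n (z + RtoC b)%C) (ev F z).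
Proof.
  induction F as [|[k a] F IH].
  - symmetry. apply lin_M0, lin_act.
  - unfold rot_tp in *. cbn [flat_map]. rewrite ev_app, IH. cbn [rot_monomial ev fst snd].
    rewrite act_add, act_scal. f_equal.
    assert (E : act (Q n (z + RtoC b)%C) a = comb (cJ a) (e (- IZR n) (z + RtoC b)%C * cP a)%C
       (e (IZR n) (z + RtoC b)%C * cM a)%C +m sc a).
    { rewrite <- act_Q_comb, comb_coords, <- (act_Q_sc n (z + RtoC b)%C a), <- act_add, tfree_sc.
      reflexivity. }
    rewrite E. clear E IH.
    rewrite !e_plus, minus_IZR, plus_IZR. unfold Rminus. rewrite !e_plus_freq.
    generalize (sc a). intros x. destruct x. unfold cJ, cP, cM, comb; munfold. f_equal; ring.
Qed.

Lemma tfree_sc_comb x j u v : tfree (sc x +m comb j u v) = comb j u v.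
Proof. unfold tfree, sc, comb; munfold. rewrite hf_inv. f_equal; field. Qed.
Lemma sc_sc_comb x j u v : sc (sc x +m comb j u v) = sc x.
Proof. unfold sc, comb; munfold. rewrite hf_inv. f_equal; field. Qed.
Lemma tfree_comb j u v : tfree (comb j u v) = comb j u v.
Proof. apply tfree_traceless. unfold comb, mtr; cbn [m11 m22]. ring. Qed.
Lemma sc_comb j u v : sc (comb j u v) = M0.
Proof. unfold sc, comb; munfold. f_equal; ring. Qed.

Lemma nrm_sc_rot_tp b n h h' F : h' <= h -> nrm h' (tmap (fun _ => sc) (rot_tp b n F)) <= nrm h F.
Proof.
  intros Hh. unfold nrm, tmap, rot_tp. rewrite fsum_map, fsum_flat_map. apply fsum_le.
  intros [k a]. cbn [fsum rot_monomial fst snd].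
  rewrite sc_sc_comb, !sc_comb, nm_M0.
  pose proof (nm_sc a). pose proof (wt_mono h h' k Hh). pose proof (wt_pos h' k). pose proof (nm_ge_0 (sc a)).
  assert (nm (sc a) * wt h' k <= nm a * wt h k) by (apply Rmult_le_compat; lra). lra.
Qed.

Lemma nm_comb_J a : nm (comb (cJ a) 0 0) <= nm a.
Proof. eapply Rle_trans; [apply nm_comb|]. rewrite Cmod_0. pose proof (Cmod_cJ a). lra. Qed.
Lemma nm_comb_P a x y : nm (comb 0 (e x (RtoC y) * cP a)%C 0) <= nm a.
Proof.
  eapply Rle_trans; [apply nm_comb|]. rewrite Cmod_0, Cmod_mult, Cmod_e_RtoC. pose proof (Cmod_cP a). lra.
Qed.
Lemma nm_comb_M a x y : nm (comb 0 0 (e x (RtoC y) * cM a)%C) <= nm a.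
Proof.
  eapply Rle_trans; [apply nm_comb|]. rewrite Cmod_0, Cmod_mult, Cmod_e_RtoC. pose proof (Cmod_cM a). lra.
Qed.

(** A coordinate that is still nonconstant after the rotation was either nonresonant with frequency
    up to [N], hence seen by [pi_res], or belonged to the tail. Three monomials arise from each
    one. *)
Lemma osc_rot_tp b N n h h' F : 0 <= h' <= h ->
  osc h' (tmap (fun _ => tfree) (rot_tp b n F)) <=
  3 * wt h' n * (nrm h (tmap (pi_res N n) F) + exp (- (IZR N * (h - h'))) * nrm h F).
Proof.
  intros Hh. set (x := exp (- (IZR N * (h - h')))). assert (Hx : 0 < x) by apply exp_pos.
  unfold osc, nrm, tmap, rot_tp. rewrite !fsum_map, <- fsum_scal, <- fsum_plus, <- fsum_scal, fsum_flat_map.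
  apply fsum_le. intros [k a]. cbn [fsum rot_monomial fst snd].
  rewrite tfree_sc_comb, !tfree_comb.
  set (p := pi_res N n k a). set (w := wt h' n). set (v := wt h k).
  assert (Hw : 1 <= w) by (apply wt_ge_1; lra). assert (Hv : 0 < v) by apply wt_pos.
  pose proof (nm_ge_0 p) as Hp0. pose proof (nm_ge_0 a) as Ha0.
  (* Shifting the frequency by n costs a factor wt h' n. *)
  assert (Hgen : forall (l l0 : Z) (q : M2),
    (l = k \/ l = k - n \/ l = k + n)%Z -> (l = 0 <-> k = l0)%Z -> nm q <= nm a ->
    (off N l0 k = true -> nm q <= nm p) ->
    (if (l =? 0)%Z then 0 else nm q * wt h' l) <= w * (nm p * v + x * (nm a * v))).
  { intros l l0 q Hl Hl0 Hq Hqp.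
    assert (R1 : 0 <= nm p * v) by (apply Rmult_le_pos; lra).
    assert (R2 : 0 <= x * (nm a * v)) by (apply Rmult_le_pos; [lra|]; apply Rmult_le_pos; lra).
    destruct (Z.eqb_spec l 0) as [E|E]; [apply Rmult_le_pos; lra|].
    assert (Hwl : wt h' l <= w * wt h' k).
    { destruct Hl as [->|[->| ->]].
      - rewrite <- (Rmult_1_l (wt h' k)) at 1. apply Rmult_le_compat_r; [left; apply wt_pos | exact Hw].
      - unfold Z.sub. eapply Rle_trans; [apply wt_add_le; lra|]. rewrite wt_opp. unfold w. lra.
      - eapply Rle_trans; [apply wt_add_le; lra|]. unfold w. lra. }
    pose proof (nm_ge_0 q) as Hq0. pose proof (wt_pos h' l). pose proof (wt_pos h' k).
    destruct (Z.leb_spec (Z.abs k) N) as [Hk|Hk].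
    - assert (Ho : off N l0 k = true).
      { unfold off. destruct (Z.eqb_spec k l0) as [Ek|Ek]; [tauto|]. simpl. apply Z.leb_le, Hk. }
      specialize (Hqp Ho).
      apply Rle_trans with (nm p * (w * v)).
      + apply Rmult_le_compat; try lra. eapply Rle_trans; [exact Hwl|].
        apply Rmult_le_compat_l; [lra | apply wt_mono; lra].
      + assert (0 <= w * (x * (nm a * v))) by (apply Rmult_le_pos; lra). lra.
    - pose proof (wt_tail h h' N k ltac:(lra) ltac:(lia)) as T. fold x v in T.
      apply Rle_trans with (nm a * (w * (x * v))).
      + apply Rmult_le_compat; try lra. eapply Rle_trans; [exact Hwl|].
        apply Rmult_le_compat_l; lra.
      + assert (0 <= w * (nm p * v)) by (apply Rmult_le_pos; lra). lra. }
  assert (Hchi : forall l0 c, off N l0 k = true -> (chi (off N l0 k) * c)%C = c).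
  { intros l0 c ->. simpl. ring. }
  pose proof (Hgen k 0%Z (comb (cJ a) 0 0) ltac:(lia) ltac:(lia) (nm_comb_J a)) as G1.
  pose proof (Hgen (k - n)%Z n (comb 0 (e (- IZR n) (RtoC b) * cP a)%C 0) ltac:(lia) ltac:(lia) (nm_comb_P a _ _)) as G2.
  pose proof (Hgen (k + n)%Z (- n)%Z (comb 0 0 (e (IZR n) (RtoC b) * cM a)%C) ltac:(lia) ltac:(lia) (nm_comb_M a _ _)) as G3.
  assert (A1 : off N 0 k = true -> nm (comb (cJ a) 0 0) <= nm p).
  { intros H. replace (cJ a) with (cJ p); [apply nm_comb_J|].
    unfold p, pi_res. rewrite cJ_comb. apply Hchi, H. }
  assert (A2 : off N n k = true -> nm (comb 0 (e (- IZR n) (RtoC b) * cP a)%C 0) <= nm p).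
  { intros H. replace (cP a) with (cP p); [apply nm_comb_P|].
    unfold p, pi_res. rewrite cP_comb. apply Hchi, H. }
  assert (A3 : off N (- n) k = true -> nm (comb 0 0 (e (IZR n) (RtoC b) * cM a)%C) <= nm p).
  { intros H. replace (cM a) with (cM p); [apply nm_comb_M|].
    unfold p, pi_res. rewrite cM_comb. apply Hchi, H. }
  specialize (G1 A1). specialize (G2 A2). specialize (G3 A3). lra.
Qed.

(** A mode that becomes constant has weight 1, so the new constant terms cost no factor
    [wt h' n]. *)
Lemma nrm_rot_tp b n h h' F : 0 <= h' <= h ->
  nrm h' (tmap (fun _ => tfree) (rot_tp b n F)) <=
  osc h' (tmap (fun _ => tfree) (rot_tp b n F)) + 3 * nrm h F.
Proof.
  intros Hh. unfold osc, nrm, tmap, rot_tp. rewrite !fsum_map, <- fsum_scal, !fsum_flat_map, <- fsum_plus.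
  apply fsum_le. intros [k a]. cbn [fsum rot_monomial fst snd].
  rewrite tfree_sc_comb, !tfree_comb.
  assert (Hv : nm a <= nm a * wt h k).
  { rewrite <- (Rmult_1_r (nm a)) at 1. apply Rmult_le_compat_l; [apply nm_ge_0 | apply wt_ge_1; lra]. }
  assert (Hg : forall l q, nm q <= nm a ->
    nm q * wt h' l <= (if (l =? 0)%Z then 0 else nm q * wt h' l) + nm a * wt h k).
  { intros l q Hq. pose proof (nm_ge_0 a). pose proof (nm_ge_0 q).
    destruct (Z.eqb_spec l 0) as [->|]; [rewrite wt_0; lra | lra]. }
  pose proof (Hg k _ (nm_comb_J a)). pose proof (Hg (k - n)%Z _ (nm_comb_P a (- IZR n) b)).
  pose proof (Hg (k + n)%Z _ (nm_comb_M a (IZR n) b)). lra.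
Qed.

(** The resonant mode joins the constant part, which stays close to a rotation. Hence the bound 7/2
    does not depend on earlier steps and undoes any growth of the constant part. *)
Lemma step_resonant b N n D c s h h' F : 0 <= h' <= h -> 0 < D <= 1 -> c * c + s * s = 1 ->
  let w := ((RtoC c + Ci * RtoC s) * (RtoC c + Ci * RtoC s))%C in
  let A := rot (RtoC c) (RtoC s) in
  let x := wt h' n * exp (- (IZR N * (h - h'))) in
  (forall k, off N 0 k = true -> D <= Cmod (e (IZR k) (RtoC b) - 1)%C) ->
  (forall k, off N n k = true -> D <= Cmod (e (IZR k) (RtoC b) - w)%C) ->
  realsym (ev F) -> (forall z, M2det (I2 +m ev F z) = 1%C) ->
  500000 * (3 / D * (3 / D)) * nrm h F <= 1 -> x <= 1 ->
  forall kappa, 0 < kappa -> exists Z W, adm Z /\ cj b Z (fun z => (I2 +m ev F z) *m A) (ev W) /\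
    osc h' W <= 200 * x * nrm h F + kappa /\ nm (ev W 0%C) <= 7 / 2.
Proof.
  intros Hh HD Hcs w A x H0 H1 HF HdF Hsm Hx kappa Hk.
  pose proof (solver_res b N n D c s HD Hcs H0 H1) as HS. fold w A in HS.
  assert (HdA : M2det A = 1%C) by (apply rot_det, sum_sq_RtoC, Hcs).
  assert (HcA : Mconj A = A) by (unfold A, rot; munfold; rewrite Copp_conj, !Cconj_RtoC; reflexivity).
  assert (HA : nm A <= 4) by (pose proof (nm_rot c s Hcs); unfold A; lra).
  assert (HX0 : 0 <= nrm h F) by apply nrm_ge_0.
  assert (HX : 500000 * nrm h F <= 1).
  { pose proof (D_ge_1 _ _ _ _ _ HS). assert (1 <= 3 / D * (3 / D)) by nra. nra. }
  assert (Hw1 : 1 <= wt h' n) by (apply wt_ge_1; lra).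
  (* The rotation multiplies the leftover of the elimination by [wt h' n], so this factor is divided
     out in advance. The factor $48=2\cdot 3\cdot 8$ leaves half of [kappa], and 1/1000 ensures the
     smallness needed by [absorb_scalar_part]. *)
  set (kap := Rmin (kappa / 48) (1 / 1000) / wt h' n).
  assert (Hm : 0 < Rmin (kappa / 48) (1 / 1000)) by (apply Rmin_glb_lt; lra).
  assert (Hkap : 0 < kap) by (apply Rdiv_lt_0_compat; lra).
  assert (Hkw : wt h' n * kap <= kappa / 48 /\ wt h' n * kap <= 1 / 1000).
  { replace (wt h' n * kap) with (Rmin (kappa / 48) (1 / 1000)) by (unfold kap; field; lra).
    split; [apply Rmin_l | apply Rmin_r]. }
  destruct (elim_modes b A _ _ _ h F HS) with (kappa := kap) as [Z [F' [HZ [Hc [Hn Hf]]]]]; try assumption; try lra.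
  assert (HdF' : forall z, M2det (I2 +m ev F' z) = 1%C).
  { intros z. apply (det_cancel A); [exact HdA|].
    apply (cj_det b Z (fun z => (I2 +m ev F z) *m A) (fun z => (I2 +m ev F' z) *m A)); try assumption.
    intros y. rewrite Mdet_mul, HdF, HdA. ring. }
  set (G := rot_tp b n F').
  destruct (Q_rot_const n b c s Hcs) as [c' [s' [Hcs' HQ]]].
  set (A' := rot (RtoC c') (RtoC s')) in *.
  assert (HA' : nm A' <= 3) by (apply nm_rot, Hcs').
  assert (HdQ : forall z, M2det (Q n z) = 1%C) by apply adm_Q.
  assert (HcQ : cj b (Q n) (fun z => (I2 +m ev F' z) *m A) (fun z => (I2 +m ev G z) *m A')).
  { intros z. unfold G. rewrite ev_rot_tp, <- (HQ z). fold A. unfold act.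
    specialize (HdQ (z + RtoC b)%C). set (q := Q n (z + RtoC b)%C) in *.
    replace (I2 +m q *m ev F' z *m M2inv1 q) with (q *m (I2 +m ev F' z) *m M2inv1 q)
      by (rewrite Mmul_add_r, Mmul_add_l, Mmul_1_r, Minv_r by exact HdQ; reflexivity).
    rewrite <- !Mmul_assoc. f_equal. f_equal. rewrite (Mmul_assoc (M2inv1 q)), Minv_l by exact HdQ.
    rewrite Mmul_1_l. reflexivity. }
  assert (HdG : forall z, M2det (I2 +m ev G z) = 1%C).
  { intros z. apply (det_cancel A'); [apply rot_det, sum_sq_RtoC, Hcs'|].
    apply (cj_det b (Q n) (fun z => (I2 +m ev F' z) *m A) (fun z => (I2 +m ev G z) *m A'));
    [apply adm_Q | exact HcQ | intros y; rewrite Mdet_mul, HdF', HdA; ring]. }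
  pose proof (osc_rot_tp b N n h h' F' Hh) as HO. fold G in HO.
  set (ex := exp (- (IZR N * (h - h')))) in *.
  assert (Hex : 0 < ex) by apply exp_pos.
  assert (Hx0 : 0 <= x) by (unfold x; apply Rmult_le_pos; lra).
  assert (HO1 : osc h' (tmap (fun _ => tfree) G) <= 3 * (wt h' n * kap) + 24 * (x * nrm h F)).
  { eapply Rle_trans; [exact HO|].
    assert (B1 : wt h' n * nrm h (tmap (pi_res N n) F') <= wt h' n * kap) by (apply Rmult_le_compat_l; lra).
    assert (B2 : x * nrm h F' <= x * (8 * nrm h F)) by (apply Rmult_le_compat_l; lra).
    unfold x in *. lra. }
  assert (HxX : x * nrm h F <= nrm h F).
  { rewrite <- (Rmult_1_l (nrm h F)) at 2. apply Rmult_le_compat_r; assumption. }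
  pose proof (nrm_rot_tp b n h h' F' Hh) as HN. fold G in HN.
  pose proof (nrm_sc_rot_tp b n h h' F' ltac:(lra)) as HSc. fold G in HSc.
  destruct (absorb_scalar_part h' G A') with (kappa := kappa / 2) as [W [HW Ho]]; try assumption; try lra.
  exists (fun z => Q n z *m Z z), W. split; [apply adm_mul; [apply adm_Q | exact HZ]|]. split; [|split].
  - intros z. rewrite HW. exact (cj_trans _ _ _ _ _ _ Hc HcQ z).
  - assert (0 <= x * nrm h F) by (apply Rmult_le_pos; assumption). lra.
  - rewrite HW, Mmul_add_l, Mmul_1_l. eapply Rle_trans; [apply nm_add|].
    assert (HG0 : nm (ev G 0%C) <= 1 / 10).
    { rewrite <- (tfree_sc (ev G 0%C)).
      rewrite <- (ev_tmap_lin tfree G 0%C lin_tfree), <- (ev_tmap_lin sc G 0%C lin_sc).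
      eapply Rle_trans; [apply nm_add|].
      pose proof (nm_ev_0 h' (tmap (fun _ => tfree) G) ltac:(lra)).
      pose proof (nm_ev_0 h' (tmap (fun _ => sc) G) ltac:(lra)). lra. }
    pose proof (nm_mul (ev G 0%C) A') as HM.
    assert (nm (ev G 0%C) * nm A' <= 1 / 10 * 3).
    { apply Rmult_le_compat; try apply nm_ge_0; assumption. }
    lra.
Qed.

(** * One step of the scheme *)

Lemma Madd_sub A B : A +m (B +m RtoC (-1) *s A) = B.
Proof. mring. Qed.

(** The constant factor is the value at 0 and not the mean, because the value has determinant
    exactly one. Entries of frequency 0 cancel in the difference $W(z)-W(0)$, so [osc] alone
    controls $F$. *)
Lemma factor_constant h W : 0 <= h -> M2det (ev W 0%C) = 1%C -> exists F,
  (forall z, ev W z = (I2 +m ev F z) *m ev W 0%C) /\ nrm h F <= 2 * nm (ev W 0%C) * osc h W.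
Proof.
  intros Hh Hd. set (A := ev W 0%C) in *.
  set (V := filter (fun p => negb (fst p =? 0)%Z) W).
  assert (HV : forall z, ev W z +m RtoC (-1) *s ev W 0%C = ev V z +m RtoC (-1) *s ev V 0%C).
  { intros z. unfold V. clear. induction W as [|[k a] W IH]; [reflexivity|].
    cbn [filter fst]. destruct (Z.eqb_spec k 0) as [->|Hk]; cbn [negb ev fst snd].
    - rewrite <- IH, !e_0_freq. mring.
    - transitivity (e (IZR k) z *s a +m RtoC (-1) *s (e (IZR k) 0%C *s a)
        +m (ev W z +m RtoC (-1) *s ev W 0%C)); [mring|]. rewrite IH. mring. }
  assert (HnV : nrm h V = osc h W).
  { unfold nrm, osc, V. clear. induction W as [|[k a] W IH]; [reflexivity|].
    cbn [filter fst]. destruct (Z.eqb_spec k 0) as [->|Hk]; cbn [negb fsum fst snd].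
    - rewrite IH, Z.eqb_refl. ring.
    - rewrite IH. destruct (Z.eqb_spec k 0); [contradiction | reflexivity]. }
  set (c := RtoC (-1) *s ev V 0%C).
  exists (tmap (fun _ a => a *m M2inv1 A) (V ++ (0%Z, c) :: nil)). split.
  - intros z. rewrite (ev_tmap_lin (fun a => a *m M2inv1 A)) by apply lin_mul_r.
    rewrite ev_app. cbn [ev fst snd]. rewrite e_0_freq, Mscal_1, Madd_0_r. unfold c.
    rewrite <- HV, Mmul_add_l, <- Mmul_assoc, Minv_l by exact Hd.
    rewrite Mmul_1_l, Mmul_1_r. symmetry. apply Madd_sub.
  - eapply Rle_trans; [apply (nrm_tmap_le h _ (nm A))|].
    { intros k a. eapply Rle_trans; [apply nm_mul|]. rewrite nm_inv. lra. }
    rewrite nrm_app, HnV. unfold nrm; cbn [fsum fst snd]. rewrite wt_0. unfold c.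
    rewrite nm_scal, Cmod_RtoC_m1.
    pose proof (nm_ev_0 h V Hh). rewrite HnV in H. pose proof (nm_ge_0 A).
    replace (2 * nm A * osc h W) with (nm A * (2 * osc h W)) by ring.
    apply Rmult_le_compat_l; lra.
Qed.

Lemma Mconj_real A : Mconj A = A -> exists a b c d : R,
  A = mkM2 (RtoC a) (RtoC b) (RtoC c) (RtoC d).
Proof.
  destruct A as [x y z w]. unfold Mconj; cbn [m11 m12 m21 m22]. intros H. injection H as H1 H2 H3 H4.
  assert (Hr : forall u, Cconj u = u -> u = RtoC (fst u)).
  { intros [u v] Hu. unfold Cconj in Hu; simpl in Hu. injection Hu as Hv.
    unfold RtoC; simpl. f_equal. lra. }
  exists (fst x), (fst y), (fst z), (fst w). rewrite <- !Hr by assumption. reflexivity.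
Qed.

(** An upper triangular [P] moves the fixed point of the elliptic Moebius map [A] in the upper
    half-plane to $i$, whose stabiliser consists of the rotations. The norm of [P] is governed by
    the distance of the trace from $\pm 2$. *)
Lemma elliptic_normal_form A sg : M2det A = 1%C -> Mconj A = A -> nm A <= 4 -> 0 < sg <= 1 ->
  (forall t : R, mtr A = RtoC t -> 4 * (sg * sg) <= 4 - t * t) ->
  exists P c s, M2det P = 1%C /\ Mconj P = P /\ nm P <= 35 / (sg * sg) /\ c * c + s * s = 1 /\
    mtr A = RtoC (2 * c) /\ act P A = rot (RtoC c) (RtoC s).
Proof.
  intros Hd Hc HA Hs Ht. destruct (Mconj_real A Hc) as [a [b [c [d ->]]]].
  assert (Hdet : a * d - b * c = 1).
  { unfold M2det in Hd; cbn [m11 m12 m21 m22] in Hd.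
    rewrite <- !RtoC_mult, <- RtoC_minus in Hd. apply (f_equal fst) in Hd. exact Hd. }
  assert (Htr : mtr (mkM2 (RtoC a) (RtoC b) (RtoC c) (RtoC d)) = RtoC (a + d)).
  { unfold mtr; cbn [m11 m22]. rewrite RtoC_plus. reflexivity. }
  specialize (Ht _ Htr). unfold nm in HA; cbn [m11 m12 m21 m22] in HA. rewrite !Cmod_R in HA.
  pose proof (Rabs_pos a). pose proof (Rabs_pos b). pose proof (Rabs_pos c). pose proof (Rabs_pos d).
  set (co := (a + d) / 2). set (q := 1 - co * co).
  assert (Hq : sg * sg <= q) by (unfold q, co; lra).
  assert (Hsg : 0 < sg * sg) by nra.
  (* From $ad-bc=1$ and $ad\le ((a+d)/2)^2$; this keeps the lower left entry away from 0. *)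
  assert (Hbc : q <= - (b * c)).
  { unfold q, co. pose proof (Rle_0_sqr (a - d)) as Hsq. unfold Rsqr in Hsq. nra. }
  assert (Hbc' : q <= Rabs b * Rabs c).
  { rewrite <- Rabs_mult, <- Rabs_Ropp. eapply Rle_trans; [exact Hbc | apply Rle_abs]. }
  assert (Hc4 : q <= 4 * Rabs c) by nra.
  assert (Hc0 : c <> 0) by (intros E; rewrite E, Rabs_R0 in Hc4; lra).
  set (r0 := sqrt q).
  assert (Hr0 : r0 * r0 = q) by (apply sqrt_sqrt; lra).
  assert (Hr0p : 0 < r0) by (apply sqrt_lt_R0; lra).
  assert (Hr0s : sg <= r0) by nra.
  assert (Hr01 : r0 <= 1) by (unfold q in *; nra).
  (* The sense of rotation is an invariant of real conjugacy: the sine must have the sign of [c],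
     which makes the square root [r] real. *)
  assert (Hsi : exists si, si * si = q /\ 0 < c / si /\ Rabs si = r0).
  { destruct (Rlt_or_le 0 c) as [Hcp|Hcn].
    - exists r0. split; [exact Hr0|]. split; [apply Rdiv_lt_0_compat; lra | apply Rabs_pos_eq; lra].
    - exists (- r0). split; [lra|]. split; [|rewrite Rabs_Ropp; apply Rabs_pos_eq; lra].
      replace (c / - r0) with ((- c) / r0) by (field; lra). apply Rdiv_lt_0_compat; lra. }
  destruct Hsi as [si [Hsi2 [Hcsi Habs]]].
  assert (Hsi0 : si <> 0) by (intros E; rewrite E, Rabs_R0 in Habs; lra).
  set (r := sqrt (c / si)).
  assert (Hr : r * r = c / si) by (apply sqrt_sqrt; lra).
  assert (Hrp : 0 < r) by (apply sqrt_lt_R0; lra).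
  assert (Hrsi : r * r * r0 = Rabs c).
  { rewrite Hr, <- Habs. rewrite <- (Rabs_pos_eq (c / si)) by lra. rewrite <- Rabs_mult.
    f_equal. field. exact Hsi0. }
  assert (Hrr : sg / 4 <= r * r <= 4 / sg).
  { split.
    - apply Rmult_le_reg_r with r0; [exact Hr0p|]. nra.
    - apply Rmult_le_reg_r with r0; [exact Hr0p|]. rewrite Hrsi.
      apply Rle_trans with 4; [lra|]. apply Rmult_le_reg_r with sg; [lra|].
      replace (4 / sg * r0 * sg) with (4 * r0) by (field; lra). nra. }
  assert (Hr1 : r <= 5 / sg).
  { assert (1 <= 1 / sg) by (apply Rmult_le_reg_r with sg; [lra|]; replace (1 / sg * sg) with 1 by (field; lra); lra).
    assert (r <= r * r + 1) by nra. replace (5 / sg) with (4 / sg + 1 / sg) by (field; lra). lra. }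
  assert (Hr2 : / r <= 5 / sg).
  { apply Rmult_le_reg_r with (r * sg); [nra|].
    replace (/ r * (r * sg)) with sg by (field; lra). replace (5 / sg * (r * sg)) with (5 * r) by (field; lra).
    destruct (Rle_or_lt 1 r); [lra|]. nra. }
  set (x := (a - co) / (si * r)).
  assert (Hx : Rabs x <= 25 / (sg * sg)).
  { unfold x. unfold Rdiv at 1. rewrite Rabs_mult, Rabs_inv, Rabs_mult, Habs, (Rabs_pos_eq r) by lra.
    assert (Ha5 : Rabs (a - co) <= 5).
    { replace (a - co) with (a / 2 + - (d / 2)) by (unfold co; field).
      eapply Rle_trans; [apply Rabs_triang|]. rewrite Rabs_Ropp. unfold Rdiv.
      rewrite !Rabs_mult, (Rabs_pos_eq (/ 2)) by lra. lra. }
    replace (25 / (sg * sg)) with (5 * (/ sg * (5 / sg))) by (field; lra).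
    rewrite Rinv_mult. apply Rmult_le_compat; [apply Rabs_pos | | exact Ha5 |].
    - apply Rmult_le_pos; left; apply Rinv_0_lt_compat; lra.
    - apply Rmult_le_compat; [left; apply Rinv_0_lt_compat; lra | left; apply Rinv_0_lt_compat; lra | | exact Hr2].
      apply Rinv_le_contravar; lra. }
  exists (mkM2 (RtoC r) (RtoC (- x)) (RtoC 0) (RtoC (/ r))), co, si.
  split; [|split; [|split; [|split; [|split]]]].
  - unfold M2det; cbn [m11 m12 m21 m22]. rewrite <- !RtoC_mult, <- RtoC_minus. f_equal. field. lra.
  - unfold Mconj; cbn [m11 m12 m21 m22]. rewrite !Cconj_RtoC. reflexivity.
  - unfold nm; cbn [m11 m12 m21 m22]. rewrite !Cmod_R, Rabs_Ropp, Rabs_R0, (Rabs_pos_eq r), (Rabs_pos_eq (/ r)).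
    + assert (5 / sg <= 5 / (sg * sg)).
      { apply Rmult_le_reg_r with (sg * sg); [lra|]. replace (5 / sg * (sg * sg)) with (5 * sg) by (field; lra).
        replace (5 / (sg * sg) * (sg * sg)) with 5 by (field; lra). lra. }
      replace (35 / (sg * sg)) with (5 / (sg * sg) + 25 / (sg * sg) + 5 / (sg * sg)) by (field; lra). lra.
    + left; apply Rinv_0_lt_compat; lra.
    + lra.
  - rewrite Hsi2. unfold q. ring.
  - rewrite Htr. f_equal. unfold co. field.
  - unfold act, M2mul, M2inv1, rot; cbn [m11 m12 m21 m22].
    rewrite <- !RtoC_opp, <- !RtoC_mult, <- !RtoC_plus, <- !RtoC_mult, <- !RtoC_plus.
    assert (Hc' : c = r * r * si) by (rewrite Hr; field; exact Hsi0).
    assert (Hq' : si * si = a * d - b * c - co * co) by (rewrite Hsi2, Hdet; reflexivity).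
    assert (Hdco : d = 2 * co - a) by (unfold co; field).
    assert (Hb : b * (r * r * si) = a * d - co * co - si * si) by (rewrite <- Hc'; lra).
    f_equal; f_equal.
    + rewrite Hc'. unfold x. field. split; lra.
    + assert (Hbr : b = (a * d - co * co - si * si) / (r * r * si)).
      { rewrite <- Hb. field. split; lra. }
      rewrite Hbr, Hc'. unfold x. rewrite Hdco. field. split; lra.
    + rewrite Hc'. field. lra.
    + rewrite Hc', Hdco. unfold x. field. split; lra.
Qed.

Lemma Cmod_unit_conj (z : C) : Cmod z = 1 -> (z * Cconj z)%C = RtoC 1.
Proof. intros H. rewrite <- Cmod2_conj, H. f_equal. ring. Qed.

Lemma e_RtoC_unit x b : (e x (RtoC b) * Cconj (e x (RtoC b)))%C = RtoC 1.
Proof. apply Cmod_unit_conj, Cmod_e_RtoC. Qed.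

(* Resonance with a nonzero frequency forces the constant part to be elliptic, away from the parabolic ones. *)
Lemma resonant_elliptic (z : C) (t g : R) : Cmod z = 1 ->
  Cmod (z * z - (RtoC t * RtoC t - 2) * z + 1)%C < g ->
  Cmod (z - 1)%C * Cmod (z - 1)%C - g <= 4 - t * t.
Proof.
  intros Hz Hg. pose proof (Cmod_unit_conj z Hz) as Hzz. destruct z as [x y].
  assert (Hxy : x * x + y * y = 1).
  { apply (f_equal fst) in Hzz. simpl in Hzz. lra. }
  (* On the unit circle $z^2+1=2\,\mathrm{Re}(z)\,z$, so the polynomial is $z$ times a real number;
     moreover $|z-1|^2=2-2x$. *)
  assert (E : ((x, y) * (x, y) - (RtoC t * RtoC t - 2) * (x, y) + 1)%C
     = ((x, y) * RtoC (2 * x - t * t + 2))%C).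
  { unfold RtoC. apply injective_projections; simpl; nra. }
  rewrite E, Cmod_mult, Hz, Rmult_1_l, Cmod_R in Hg. apply Rabs_def2 in Hg.
  assert (Hm : Cmod ((x, y) - 1)%C * Cmod ((x, y) - 1)%C = 2 - 2 * x).
  { unfold Cmod. rewrite sqrt_sqrt; simpl; nra. }
  rewrite Hm. lra.
Qed.

(** The polynomial factors as $(z-w)(z-\bar w)$, so one factor is below $g$; if it is the second,
    conjugation replaces $n$ by $-n$. *)
Lemma resonant_frequency b n c s g A : mtr A = RtoC (2 * c) -> c * c + s * s = 1 -> 0 < g ->
  let w := ((RtoC c + Ci * RtoC s) * (RtoC c + Ci * RtoC s))%C in
  let z := e (IZR n) (RtoC b) in
  Cmod (z * z - (mtr A * mtr A - 2) * z + 1)%C < g * g ->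
  exists n', (n' = n \/ n' = - n)%Z /\ Cmod (e (IZR n') (RtoC b) - w)%C < g.
Proof.
  intros Ht Hcs Hg w z H.
  assert (Hw : Cconj w = ((RtoC c - Ci * RtoC s) * (RtoC c - Ci * RtoC s))%C).
  { unfold w. rewrite !Cmult_conj, !Cplus_conj, !Cmult_conj, !Cconj_RtoC, conj_Ci. ring. }
  assert (E : (z * z - (mtr A * mtr A - 2) * z + 1)%C = ((z - w) * (z - Cconj w))%C).
  { rewrite Hw, Ht, RtoC_mult. unfold w. pose proof Ci2 as HI.
    assert (Hs : (RtoC s * RtoC s)%C = (1 - RtoC c * RtoC c)%C).
    { rewrite <- (sum_sq_RtoC c s Hcs). ring. }
    ring [HI Hs]. }
  rewrite E, Cmod_mult in H.
  destruct (Rlt_or_le (Cmod (z - w)) g) as [H1|H1].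
  - exists n. split; [left; reflexivity | exact H1].
  - exists (- n)%Z. split; [right; reflexivity|].
    rewrite opp_IZR, e_opp_RtoC. fold z. rewrite <- Cmod_conj, Cminus_conj, Cconj_conj.
    destruct (Rlt_or_le (Cmod (z - Cconj w)) g) as [H2|H2]; [exact H2|]. nra.
Qed.

(** Here [d1] and [d2] bound the divisors $|e^{ikb}-1|$ up to [M] and up to [2 * N], and $g^2$ is
    the threshold for resonance. [X] bounds the perturbation in the basis where the constant part is
    a rotation, the factor in front of $8\eta$ being the square of the bound on [P]. *)
Lemma kam_step b W h h' M N d1 d2 g eta eta' K K' : 0 <= h' <= h -> (0 <= M <= N)%Z ->
  0 < d2 <= d1 -> d1 <= 1 -> 0 < g <= 1 -> 2 * (g * g) <= d1 * d1 -> 2 * g <= d2 ->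
  (forall k, low M k = true -> d1 <= Cmod (e (IZR k) (RtoC b) - 1)%C) ->
  (forall k, low (2 * N) k = true -> d2 <= Cmod (e (IZR k) (RtoC b) - 1)%C) ->
  realsym (ev W) -> (forall z, M2det (ev W z) = 1%C) ->
  osc h W <= eta -> nm (ev W 0%C) <= K -> K <= 4 -> 0 < eta' ->
  let X := 1225 * (4 / d1) ^ 4 * (8 * eta) in
  let x := exp (Rabs (IZR M) * h' - IZR N * (h - h')) in
  500000 * (615 / (d1 * (g * g)) * (615 / (d1 * (g * g)))) * (8 * eta) <= 1 ->
  64 * exp (- (IZR M * (h - h'))) * (8 * eta) <= eta' / 2 ->
  K + 256 * eta <= K' -> 7 / 2 <= K' ->
  500000 * (6 / d2 * (6 / d2)) * X <= 1 -> x <= 1 -> 200 * x * X <= eta' / 2 ->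
  exists Z W', adm Z /\ cj b Z (ev W) (ev W') /\ osc h' W' <= eta' /\ nm (ev W' 0%C) <= K'.
Proof.
  intros Hh HMN Hd2 Hd1 Hg Hgd1 Hgd2 HD1 HD2 Hr Hdet Ho HK HK4 Heta' X x Hnr1 Hnr2 HK1 HK2 Hre1 Hx1 Hre2.
  set (A := ev W 0%C) in *.
  assert (HdA : M2det A = 1%C) by apply Hdet.
  assert (HcA : Mconj A = A).
  { unfold A. rewrite <- Hr. f_equal. apply Cconj_RtoC. }
  assert (HA : nm A <= 4) by lra.
  destruct (factor_constant h W ltac:(lra) HdA) as [F [EF HF]]. fold A in EF, HF.
  pose proof (osc_ge_0 h W) as Ho0. pose proof (nm_ge_0 A) as HA0.
  assert (Heta : 0 <= eta) by lra.
  assert (HF8 : nrm h F <= 8 * eta).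
  { eapply Rle_trans; [exact HF|]. rewrite Rmult_assoc.
    assert (nm A * osc h W <= 4 * eta) by (apply Rmult_le_compat; lra). lra. }
  assert (HdF : forall z, M2det (I2 +m ev F z) = 1%C).
  { intros z. apply (det_cancel A); [exact HdA|]. rewrite <- EF. apply Hdet. }
  assert (HrF : realsym (ev F)).
  { apply (realsym_factor A F HdA HcA). intros z. rewrite <- !EF. apply Hr. }
  assert (Hgg : 0 < g * g) by nra.
  assert (HDnr : 0 < d1 * (g * g) <= 1) by (split; nra).
  destruct (classic (exists n, low M n = true /\ let z := e (IZR n) (RtoC b) in
     Cmod (z * z - (mtr A * mtr A - 2) * z + 1)%C < g * g)) as [[n [Hn Hnres]]|Hnon].
  - cbv zeta in Hnres.
    destruct (Mconj_real A HcA) as [a11 [a12 [a21 [a22 EA]]]].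
    (* Resonance gives $4-t^2\ge d_1^2-g^2\ge d_1^2/2$, more than the $d_1^2/4$ asked for here. *)
    destruct (elliptic_normal_form A (d1 / 4) HdA HcA HA ltac:(lra)) as [P [c [s [HdP [HcP [HnP [Hcs [Htr HPA]]]]]]]].
    { intros t Ht. rewrite Ht in Hnres. apply resonant_elliptic in Hnres; [|apply Cmod_e_RtoC].
      pose proof (HD1 n Hn) as H1. assert (d1 * d1 <= Cmod (e (IZR n) (RtoC b) - 1) * Cmod (e (IZR n) (RtoC b) - 1)) by nra.
      nra. }
    destruct (resonant_frequency b n c s g A Htr Hcs ltac:(lra) Hnres) as [n' [Hn' Hres]].
    set (w := ((RtoC c + Ci * RtoC s) * (RtoC c + Ci * RtoC s))%C) in *.
    assert (HnM : (Z.abs n' <= M)%Z).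
    { unfold low in Hn. apply andb_prop in Hn. destruct Hn as [_ Hn]. apply Z.leb_le in Hn. lia. }
    set (F1 := tmap (fun _ => act P) F).
    assert (EF1 : forall z, ev F1 z = act P (ev F z)) by (intros z; apply ev_tmap_lin, lin_act).
    assert (HcF1 : cj b (fun _ => P) (ev W) (fun z => (I2 +m ev F1 z) *m rot (RtoC c) (RtoC s))).
    { intros z. rewrite EF1, EF, <- HPA. unfold act.
      replace (I2 +m P *m ev F z *m M2inv1 P) with (P *m (I2 +m ev F z) *m M2inv1 P)
        by (rewrite Mmul_add_r, Mmul_add_l, Mmul_1_r, Minv_r by exact HdP; reflexivity).
      rewrite <- !Mmul_assoc. f_equal. f_equal. rewrite (Mmul_assoc (M2inv1 P)), Minv_l by exact HdP.
      rewrite Mmul_1_l. reflexivity. }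
    assert (HdF1 : forall z, M2det (I2 +m ev F1 z) = 1%C).
    { intros z. apply (det_cancel (rot (RtoC c) (RtoC s))); [apply rot_det, sum_sq_RtoC, Hcs|].
      apply (cj_det b (fun _ => P) (ev W) _ (adm_const P HdP HcP) HcF1 Hdet). }
    assert (HrF1 : realsym (ev F1)).
    { intros z. rewrite !EF1, HrF, Mconj_act by exact HcP. reflexivity. }
    assert (HnF1 : nrm h F1 <= X).
    { assert (HPP : nm P * nm P <= 1225 * (4 / d1) ^ 4).
      { replace (1225 * (4 / d1) ^ 4) with (35 / (d1 / 4 * (d1 / 4)) * (35 / (d1 / 4 * (d1 / 4)))) by (field; lra).
        apply Rmult_le_compat; try apply nm_ge_0; exact HnP. }
      unfold F1. eapply Rle_trans; [apply (nrm_tmap_le h _ (nm P * nm P)); intros; apply nm_act|].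
      unfold X. apply Rmult_le_compat; [|apply nrm_ge_0 | exact HPP | exact HF8].
      apply Rmult_le_pos; apply nm_ge_0. }
    assert (Hxn : wt h' n' * exp (- (IZR N * (h - h'))) <= x).
    { unfold wt, x. rewrite <- exp_plus. apply exp_le. unfold Rminus at 1. apply Rplus_le_compat_r.
      apply Rmult_le_compat_r; [lra|]. rewrite <- abs_IZR, (Rabs_pos_eq (IZR M)) by (apply IZR_le; lia).
      apply IZR_le, HnM. }
    assert (Hxp : 0 < wt h' n' * exp (- (IZR N * (h - h')))).
    { apply Rmult_lt_0_compat; apply exp_pos. }
    destruct (step_resonant b N n' (d2 / 2) c s h h' F1 Hh ltac:(lra) Hcs) with (kappa := eta' / 2)
      as [Z [W' [HZ [Hc' [Ho' Hn0]]]]]; try assumption; try lra.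
    + intros k Hk. apply Rle_trans with d2; [lra|]. apply HD2.
      unfold off in Hk. apply andb_prop in Hk. destruct Hk as [Hk1 Hk2].
      unfold low. rewrite Hk1. cbn [andb]. apply Z.leb_le. apply Z.leb_le in Hk2. lia.
    (* Uniqueness of the resonance: $|e^{ikb}-w|\ge |e^{i(k-n')b}-1|-g\ge d_2-g\ge d_2/2$. The
       difference of two frequencies up to [N] is why [HD2] reaches [2 * N]. *)
    + intros k Hk. fold w. unfold off in Hk. apply andb_prop in Hk. destruct Hk as [Hk1 Hk2].
      apply negb_true_iff, Z.eqb_neq in Hk1. apply Z.leb_le in Hk2.
      assert (Hl : low (2 * N) (k - n') = true).
      { unfold low. apply andb_true_intro. split; [apply negb_true_iff, Z.eqb_neq; lia | apply Z.leb_le; lia]. }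
      specialize (HD2 _ Hl).
      assert (E : Cmod (e (IZR k) (RtoC b) - e (IZR n') (RtoC b))%C = Cmod (e (IZR (k - n')) (RtoC b) - 1)%C).
      { replace (e (IZR k) (RtoC b)) with (e (IZR (k - n')) (RtoC b) * e (IZR n') (RtoC b))%C.
        - replace (_ - _)%C with ((e (IZR (k - n')) (RtoC b) - 1) * e (IZR n') (RtoC b))%C by ring.
          rewrite Cmod_mult, Cmod_e_RtoC, Rmult_1_r. reflexivity.
        - rewrite <- e_plus_freq, <- plus_IZR. f_equal. f_equal. ring. }
      rewrite <- E in HD2.
      replace (e (IZR k) (RtoC b) - e (IZR n') (RtoC b))%C
        with ((e (IZR k) (RtoC b) - w) - (e (IZR n') (RtoC b) - w))%C in HD2 by ring.
      pose proof (Cmod_minus_le (e (IZR k) (RtoC b) - w) (e (IZR n') (RtoC b) - w)). lra.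
    + replace (3 / (d2 / 2)) with (6 / d2) by (field; lra).
      eapply Rle_trans; [apply Rmult_le_compat_l; [|exact HnF1] | exact Hre1].
      assert (0 < 6 / d2) by (apply Rdiv_lt_0_compat; lra). nra.
    + exists (fun z => Z z *m P), W'. split; [apply adm_mul; [exact HZ | apply adm_const; assumption]|].
      split; [|split; [|lra]].
      * intros z. exact (cj_trans b (fun _ => P) Z _ _ _ HcF1 Hc' z).
      * eapply Rle_trans; [exact Ho'|].
        assert (200 * (wt h' n' * exp (- (IZR N * (h - h')))) * nrm h F1 <= 200 * x * X).
        { apply Rmult_le_compat; [lra | apply nrm_ge_0 | lra | exact HnF1]. }
        lra.
  - destruct (step_nonresonant b A M (d1 * (g * g)) h h' F) with (kappa := eta' / 2)
      as [Z [W' [HZ [Hc [Ho' Hn0]]]]]; try assumption; try lra.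
    + intros k Hk z. rewrite Cmod_mult. apply Rmult_le_compat; [lra | lra | apply HD1, Hk|].
      apply Rnot_lt_le. intros Hlt. apply Hnon. exists k. split; [exact Hk | exact Hlt].
    + eapply Rle_trans; [apply Rmult_le_compat_l; [|exact HF8] | exact Hnr1].
      assert (0 < 615 / (d1 * (g * g))) by (apply Rdiv_lt_0_compat; lra). nra.
    + exists Z, W'. split; [exact HZ|]. split; [|split].
      * intros z. rewrite EF. apply Hc.
      * eapply Rle_trans; [exact Ho'|].
        assert (64 * exp (- (IZR M * (h - h'))) * nrm h F <= 64 * exp (- (IZR M * (h - h'))) * (8 * eta)).
        { apply Rmult_le_compat_l; [|exact HF8]. pose proof (exp_pos (- (IZR M * (h - h')))). lra. }
        lra.
      * eapply Rle_trans; [exact Hn0|].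
        assert (8 * nrm h F * nm A <= 64 * eta * 4) by (pose proof (nrm_ge_0 h F); apply Rmult_le_compat; lra).
        lra.
Qed.

(** * Small divisors *)

(** From $\sin u\ge u-u^3/6$. The loss of a factor 3 is made up for by $\pi\ge 3$ in [abs_sin_ge],
    where $\pi\le 4$ keeps the argument below 2. *)
Lemma sin_ge_third u : 0 <= u <= 2 -> u / 3 <= sin u.
Proof.
  intros Hu. pose proof PI2_1 as HPI.
  assert (u <= PI) by (unfold PI2 in *; lra).
  destruct (sin_bound u 0 ltac:(lra) ltac:(lra)) as [H1 _].
  unfold sin_approx, sum_f_R0, sin_term in H1. simpl in H1. nra.
Qed.

Lemma abs_sin_ge y p : Rabs (y - IZR p) <= / 2 -> Rabs (y - IZR p) <= Rabs (sin (PI * y)).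
Proof.
  intros H. set (d := y - IZR p) in *.
  assert (E : Rabs (sin (PI * y)) = Rabs (sin (PI * d))).
  { replace (PI * y) with (PI * d + IZR p * PI) by (unfold d; ring).
    rewrite sin_plus.
    assert (Hs : sin (IZR p * PI) = 0) by (apply sin_eq_0_1; exists p; reflexivity).
    assert (Hc : Rabs (cos (IZR p * PI)) = 1).
    { pose proof (sin2_cos2 (IZR p * PI)) as Hsc. rewrite Hs in Hsc. unfold Rsqr in Hsc.
      assert (Hc2 : (cos (IZR p * PI) - 1) * (cos (IZR p * PI) + 1) = 0) by lra.
      apply Rmult_integral in Hc2. destruct Hc2 as [Hc2|Hc2].
      - replace (cos (IZR p * PI)) with 1 by lra. apply Rabs_R1.
      - replace (cos (IZR p * PI)) with (-1) by lra. apply Rabs_m1. }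
    rewrite Hs, Rmult_0_r, Rplus_0_r, Rabs_mult, Hc, Rmult_1_r. reflexivity. }
  rewrite E.
  assert (Hpi : 3 <= PI <= 4) by (pose proof PI2_3_2; pose proof PI_4; unfold PI2 in *; lra).
  assert (Hpos : forall x, 0 <= x <= / 2 -> x <= sin (PI * x)).
  { intros x Hx. assert (3 * x <= PI * x <= 4 * x) by (split; apply Rmult_le_compat_r; lra).
    eapply Rle_trans; [|apply sin_ge_third; lra]. lra. }
  destruct (Rle_or_lt 0 d) as [Hd|Hd].
  - rewrite (Rabs_pos_eq d) in * by lra. eapply Rle_trans; [apply Hpos; lra | apply Rle_abs].
  - rewrite (Rabs_left d) in * by lra. eapply Rle_trans; [apply Hpos; lra|].
    replace (PI * - d) with (- (PI * d)) by ring. rewrite sin_neg.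
    rewrite <- Rabs_Ropp. apply Rle_abs.
Qed.

Lemma Cmod_e_minus_1 (x : R) : Cmod (e 1 (RtoC x) - 1)%C = 2 * Rabs (sin (x / 2)).
Proof.
  apply Rsqr_inj; [apply Cmod_ge_0 | pose proof (Rabs_pos (sin (x / 2))); lra|].
  rewrite Rsqr_mult, <- Rsqr_abs.
  unfold Cmod, e. rewrite Rsqr_sqrt by (apply Rplus_le_le_0_compat; apply pow2_ge_0). simpl.
  rewrite !Rmult_1_l, Ropp_0, exp_0, !Rmult_1_l.
  pose proof (sin2_cos2 x) as H. unfold Rsqr in *.
  replace (cos x) with (1 - 2 * sin (x / 2) * sin (x / 2)) in *
    by (rewrite <- cos_2a_sin; f_equal; field).
  lra.
Qed.

(** Since $|e^{2ik\omega}-1|=2|\sin k\omega|$, the condition on $\omega/2\pi$ is applied with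
    denominator $2k$, hence the factor $2^t$. The real exponent is rounded up to an integer so that
    powers can be handled algebraically. *)
Lemma diophantine_divisors omega : diophantine (omega / (2 * PI)) ->
  exists (c : R) (t : nat), 0 < c <= 1 /\ forall k, k <> 0%Z ->
    c / Rabs (IZR k) ^ t <= Cmod (e (IZR k) (RtoC (2 * omega)) - 1)%C.
Proof.
  intros [gamma [tau [Hg [Htau H]]]].
  destruct (INR_unbounded tau) as [t Ht].
  assert (H2t : 0 < 2 ^ t) by (apply pow_lt; lra).
  exists (Rmin 1 (gamma / 2 ^ t)), t.
  assert (Hg2 : 0 < gamma / 2 ^ t) by (apply Rdiv_lt_0_compat; assumption).
  split; [split; [apply Rmin_glb_lt; lra | apply Rmin_l]|].
  intros k Hk. pose proof PI_RGT_0 as HPI.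
  assert (Hk1 : 1 <= Rabs (IZR k)).
  { rewrite <- abs_IZR. apply IZR_le. lia. }
  assert (Hkt : 0 < Rabs (IZR k) ^ t) by (apply pow_lt; lra).
  set (y := IZR (2 * k) * (omega / (2 * PI))).
  replace (e (IZR k) (RtoC (2 * omega))) with (e 1 (RtoC (IZR k * (2 * omega)))).
  2:{ unfold e; simpl. rewrite !Rmult_1_l, !Rmult_0_r. reflexivity. }
  rewrite Cmod_e_minus_1.
  replace (IZR k * (2 * omega) / 2) with (PI * y) by (unfold y; rewrite mult_IZR; field; lra).
  (* [p] is an integer nearest to [y]. *)
  destruct (archimed (y - / 2)) as [Hp1 Hp2]. set (p := up (y - / 2)) in *.
  assert (Hyp : Rabs (y - IZR p) <= / 2) by (apply Rabs_le; lra).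
  pose proof (abs_sin_ge y p Hyp) as Hsin.
  specialize (H p (2 * k)%Z ltac:(lia)). fold y in H.
  assert (Hpow : / (2 ^ t * Rabs (IZR k) ^ t) <= Rpower (Rabs (IZR (2 * k))) (- tau)).
  { rewrite <- Rpow_mult_distr. rewrite mult_IZR, Rabs_mult, (Rabs_pos_eq 2) by lra.
    rewrite <- (Rpower_pow t) by lra. rewrite <- Rpower_Ropp. apply Rle_Rpower; lra. }
  apply Rle_trans with (gamma / 2 ^ t / Rabs (IZR k) ^ t).
  - apply Rmult_le_compat_r; [left; apply Rinv_0_lt_compat; assumption | apply Rmin_r].
  - apply Rle_trans with (gamma * / (2 ^ t * Rabs (IZR k) ^ t)); [right; field; lra|].
    apply Rle_trans with (gamma * Rpower (Rabs (IZR (2 * k))) (- tau)).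
    + apply Rmult_le_compat_l; lra.
    + pose proof (Rabs_pos (sin (PI * y))). lra.
Qed.

Lemma exp_ge_pow u n : 0 <= u -> (u / INR (S n)) ^ S n <= exp u.
Proof.
  intros Hu. assert (Hn : 0 < INR (S n)) by (apply lt_0_INR; lia).
  replace (exp u) with (exp (u / INR (S n)) ^ S n).
  - apply pow_incr. split; [apply Rdiv_le_0_compat; lra|].
    pose proof (exp_ineq1_le (u / INR (S n))). lra.
  - rewrite <- Rpower_pow by apply exp_pos. unfold Rpower. rewrite ln_exp. f_equal. field. lra.
Qed.

(** With $d_1\sim\mu^{-2t}$ and $g\sim\mu^{-4t-1}$, the nonresonant step needs $\eta$ small against
    $(d_1g^2)^2\sim\mu^{-20t-4}$; one more power of $\mu$ beats the constants. *)
Definition eta (t : nat) (mu : R) : R := / ((mu ^ t) ^ 20 * mu ^ 5).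

Lemma pow_ge_1 x n : 1 <= x -> 1 <= x ^ n.
Proof. intros H. rewrite <- (pow1 n). apply pow_incr. lra. Qed.

Lemma Rdiv_le_1 x y : 0 < y -> x <= y -> x / y <= 1.
Proof. intros Hy H. apply Rmult_le_reg_r with y; [exact Hy|]. unfold Rdiv. rewrite Rmult_assoc, Rinv_l; lra. Qed.

(** The cutoffs are $M=\mu^2$ and $N=\mu^4$, which dictate [d1] and [d2]; [g] is a power of $\mu$
    smaller than [d2]. As $h-h'=1/\mu$, the tails gain $e^{-\mu}$ and $e^{-\mu^3}$, and the latter
    also outweighs the rotation cost $e^{\mu^2h'}$. *)
Lemma scale_parameters c t : 0 < c <= 1 -> exists L, forall mu, L <= mu ->
  let h := 1 + 2 / mu in let h' := 1 + 1 / mu in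
  let d1 := c / (mu ^ t) ^ 2 in let d2 := c / (2 ^ t * (mu ^ t) ^ 4) in
  let g := / ((mu ^ t) ^ 4 * mu) in
  let X := 1225 * (4 / d1) ^ 4 * (8 * eta t mu) in
  let x := exp (mu ^ 2 * h' - mu ^ 4 * (h - h')) in
  2 <= mu /\ 0 < d2 <= d1 /\ d1 <= 1 /\ 0 < g <= 1 /\ 2 * (g * g) <= d1 * d1 /\ 2 * g <= d2 /\
  500000 * (615 / (d1 * (g * g)) * (615 / (d1 * (g * g)))) * (8 * eta t mu) <= 1 /\
  64 * exp (- (mu ^ 2 * (h - h'))) * (8 * eta t mu) <= eta t (2 * mu) / 2 /\
  256 * eta t mu <= 1 / (2 * mu) /\
  500000 * (6 / d2 * (6 / d2)) * X <= 1 /\ x <= 1 /\ 200 * x * X <= eta t (2 * mu) / 2.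
Proof.
  intros Hc. set (q := 2 ^ t). assert (Hq : 1 <= q) by (apply pow_ge_1; lra).
  set (n8 := INR (S (8 * t))). assert (Hn8 : 0 < n8) by (apply lt_0_INR; lia).
  (* One threshold per inequality: [L1] and [L2] for the two conditions on [g], [L3] and [L4] for
     the nonresonant step, [L6] and [L7] for the resonant one. They are added up below, with 512 for
     the drift of the constant part and [n8] for the exponential. *)
  set (L1 := 2 / (c * c)). set (L2 := 2 * q / c).
  set (L3 := 500000 * (615 * 615) * 8 / (c * c)). set (L4 := 32768 * q ^ 20).
  set (L6 := 500000 * 36 * 1225 * 2048 * q ^ 2 / c ^ 6).
  set (L7 := 200 * 1225 * 2048 * 64 * q ^ 20 / c ^ 4).
  assert (Hcc : 0 < c * c) by nra.
  assert (P1 : 0 < L1) by (apply Rdiv_lt_0_compat; lra).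
  assert (P2 : 0 < L2) by (apply Rdiv_lt_0_compat; lra).
  assert (P3 : 0 < L3) by (apply Rdiv_lt_0_compat; lra).
  assert (Hq20 : 1 <= q ^ 20) by (apply pow_ge_1; exact Hq).
  assert (P4 : 0 < L4) by (unfold L4; lra).
  assert (Hq2 : 1 <= q ^ 2) by (apply pow_ge_1; exact Hq).
  assert (P6 : 0 < L6) by (apply Rdiv_lt_0_compat; [lra | apply pow_lt; lra]).
  assert (P7 : 0 < L7) by (apply Rdiv_lt_0_compat; [lra | apply pow_lt; lra]).
  exists (L1 + L2 + L3 + L4 + 512 + L6 + L7 + n8). intros mu Hmu.
  set (a := mu ^ t). assert (Ha : 1 <= a) by (apply pow_ge_1; lra).
  intros h h' d1 d2 g X x.
  assert (Ha2 : 1 <= a ^ 2) by (apply pow_ge_1; exact Ha).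
  assert (Ha4 : 1 <= a ^ 4) by (apply pow_ge_1; exact Ha).
  assert (Ha20 : 1 <= a ^ 20) by (apply pow_ge_1; exact Ha).
  assert (Ha8 : 1 <= a ^ 8) by (apply pow_ge_1; exact Ha).
  assert (Hm5 : 1 <= mu ^ 5) by (apply pow_ge_1; lra).
  assert (Hc4 : 0 < c ^ 4) by (apply pow_lt; lra).
  assert (Hc6 : 0 < c ^ 6) by (apply pow_lt; lra).
  assert (Hhh : h - h' = 1 / mu) by (unfold h, h'; field; lra).
  assert (He' : eta t (2 * mu) = / (32 * q ^ 20 * (a ^ 20 * mu ^ 5))).
  { unfold eta. f_equal. rewrite Rpow_mult_distr. fold q a. ring. }
  assert (He : eta t mu = / (a ^ 20 * mu ^ 5)) by reflexivity.
  assert (HX : X = 1225 * 2048 / (c ^ 4 * a ^ 12 * mu ^ 5)).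
  { unfold X, d1. rewrite He. fold a. field. lra. }
  assert (Hx : x <= exp (- (mu ^ 2))).
  { unfold x. rewrite Hhh. apply exp_le. unfold h'.
    replace (mu ^ 2 * (1 + 1 / mu) - mu ^ 4 * (1 / mu)) with (mu ^ 2 + mu - mu ^ 3) by (field; lra). nra. }
  (* Passing from [X], of size $\mu^{-12t-5}$, to [eta], of size $\mu^{-20t-5}$, requires a gain of
     $\mu^{8t}$; the additional $\mu$ absorbs [L7]. *)
  assert (Hex : a ^ 8 * mu * exp (- (mu ^ 2)) <= 1).
  { rewrite exp_Ropp. apply Rdiv_le_1; [apply exp_pos|].
    apply Rle_trans with ((mu ^ 2 / n8) ^ S (8 * t)); [|apply exp_ge_pow; nra].
    replace (a ^ 8 * mu) with (mu ^ S (8 * t)).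
    - apply pow_incr. split; [lra|]. apply Rmult_le_reg_r with n8; [exact Hn8|].
      replace (mu ^ 2 / n8 * n8) with (mu * mu) by (field; lra). apply Rmult_le_compat_l; lra.
    - unfold a. rewrite <- pow_mult, (Nat.mul_comm t 8). simpl. ring. }
  assert (Hxp : 0 < x) by apply exp_pos.
  assert (Hpos : 0 < 32 * q ^ 20 * (a ^ 20 * mu ^ 5)) by (repeat apply Rmult_lt_0_compat; lra).
  assert (Hup : forall u v : R, 1 <= u -> 0 <= v -> v <= u * v).
  { intros u v Hu Hv. rewrite <- (Rmult_1_l v) at 1. apply Rmult_le_compat_r; assumption. }
  split; [lra|]. split; [|split; [|split; [|split; [|split; [|split; [|split; [|split; [|split; [|split]]]]]]]]].
  - split; [apply Rdiv_lt_0_compat; [lra|]; apply Rmult_lt_0_compat; fold q a; lra|].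
    unfold d1, d2. fold q a. apply Rmult_le_compat_l; [lra|]. apply Rinv_le_contravar; [lra|].
    assert (a ^ 2 <= a ^ 4) by (apply Rle_pow; [exact Ha | lia]). nra.
  - unfold d1. fold a. apply Rdiv_le_1; lra.
  - unfold g. fold a. assert (1 <= a ^ 4 * mu) by nra. split; [apply Rinv_0_lt_compat; lra|].
    rewrite <- Rinv_1. apply Rinv_le_contravar; lra.
  - unfold g, d1. fold a.
    apply Rle_trans with ((c / a ^ 2 * (c / a ^ 2)) * (L1 / (a ^ 4 * mu * mu))).
    + right. unfold L1. field. lra.
    + rewrite <- (Rmult_1_r (c / a ^ 2 * (c / a ^ 2))) at 2. apply Rmult_le_compat_l.
      * assert (0 < c / a ^ 2) by (apply Rdiv_lt_0_compat; lra). nra.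
      * assert (mu <= a ^ 4 * mu * mu) by nra. apply Rdiv_le_1; lra.
  - unfold g, d2. fold q a.
    apply Rle_trans with (c / (q * a ^ 4) * (L2 / mu)); [right; unfold L2; field; lra|].
    rewrite <- (Rmult_1_r (c / (q * a ^ 4))) at 2. apply Rmult_le_compat_l.
    + left. apply Rdiv_lt_0_compat; [lra|]. apply Rmult_lt_0_compat; lra.
    + apply Rdiv_le_1; lra.
  - apply Rle_trans with (L3 / mu); [right|apply Rdiv_le_1; lra].
    unfold g, d1, L3. rewrite He. fold a. field. lra.
  - rewrite Hhh, He, He'. replace (mu ^ 2 * (1 / mu)) with mu by (field; lra).
    assert (H1 : L4 * exp (- mu) <= 1).
    { rewrite exp_Ropp. apply Rdiv_le_1; [apply exp_pos|]. pose proof (exp_ineq1_le mu). lra. }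
    apply Rle_trans with (/ (32 * q ^ 20 * (a ^ 20 * mu ^ 5)) / 2 * (L4 * exp (- mu))).
    + right. unfold L4. field. lra.
    + rewrite <- (Rmult_1_r (/ (32 * q ^ 20 * (a ^ 20 * mu ^ 5)) / 2)) at 2. apply Rmult_le_compat_l; [|exact H1].
      left. apply Rdiv_lt_0_compat; [|lra]. apply Rinv_0_lt_compat; exact Hpos.
  - rewrite He. apply Rle_trans with (1 / (2 * mu) * (512 / (a ^ 20 * mu ^ 4))); [right; field; lra|].
    rewrite <- (Rmult_1_r (1 / (2 * mu))) at 2. apply Rmult_le_compat_l.
    + left. apply Rdiv_lt_0_compat; lra.
    + assert (mu <= mu ^ 4) by (rewrite <- (pow_1 mu) at 1; apply Rle_pow; [lra | lia]).
      pose proof (Hup (a ^ 20) (mu ^ 4) Ha20 ltac:(lra)). apply Rdiv_le_1; lra.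
  - apply Rle_trans with (L6 / (a ^ 4 * mu ^ 5)).
    + right. rewrite HX. unfold d2, L6. fold q a. field. lra.
    + assert (mu <= mu ^ 5) by (rewrite <- (pow_1 mu) at 1; apply Rle_pow; [lra | lia]).
      pose proof (Hup (a ^ 4) (mu ^ 5) Ha4 ltac:(lra)). apply Rdiv_le_1; lra.
  - eapply Rle_trans; [exact Hx|]. rewrite <- exp_0. apply exp_le. nra.
  - rewrite He', HX.
    apply Rle_trans with (/ (32 * q ^ 20 * (a ^ 20 * mu ^ 5)) / 2 * (L7 / mu * (a ^ 8 * mu * x))).
    + right. unfold L7. field. lra.
    + rewrite <- (Rmult_1_r (/ (32 * q ^ 20 * (a ^ 20 * mu ^ 5)) / 2)) at 2. apply Rmult_le_compat_l.
      { left. apply Rdiv_lt_0_compat; [|lra]. apply Rinv_0_lt_compat; exact Hpos. }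
      assert (a ^ 8 * mu * x <= 1).
      { eapply Rle_trans; [|exact Hex]. apply Rmult_le_compat_l; [nra | exact Hx]. }
      assert (L7 / mu <= 1) by (apply Rdiv_le_1; lra).
      assert (0 <= L7 / mu) by (apply Rdiv_le_0_compat; lra).
      assert (0 <= a ^ 8 * mu * x) by (apply Rmult_le_pos; [nra | lra]).
      nra.
Qed.

(** * Convergence *)

Lemma ccos_e z : ccos z = (hf * (e 1 z + e (-1) z))%C.
Proof.
  unfold ccos, e, hf, RtoC. apply injective_projections; simpl;
  replace (- (-1 * snd z)) with (snd z) by ring; replace (- (1 * snd z)) with (- snd z) by ring;
  replace (-1 * fst z) with (- fst z) by ring; rewrite Rmult_1_l, cos_neg, sin_neg; field.
Qed.

Lemma B_E_entries t1 omega E z : let c := (RtoC t1 * ccos (z + RtoC omega)%C)%C in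
  B_E t1 omega E z = mkM2 (RtoC E * RtoC E - RtoC E * c - 1)%C (c - RtoC E)%C (RtoC E) (- (1))%C.
Proof.
  intros c. unfold B_E, A_E, M2mul; cbn [m11 m12 m21 m22].
  change (Tseq t1 1) with t1. change (Tseq t1 0) with 0. fold c.
  replace (RtoC (-1)) with (- (1))%C by (rewrite <- RtoC_opp; reflexivity).
  f_equal; ring.
Qed.

Lemma B_E_det t1 omega E z : M2det (B_E t1 omega E z) = 1%C.
Proof. rewrite B_E_entries. unfold M2det; cbn [m11 m12 m21 m22]. ring. Qed.

Lemma B_E_realsym t1 omega E : realsym (B_E t1 omega E).
Proof.
  intros z. rewrite !B_E_entries. set (c := (RtoC t1 * ccos (z + RtoC omega))%C).
  assert (Hc : (RtoC t1 * ccos (Cconj z + RtoC omega))%C = Cconj c).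
  { unfold c. rewrite Cmult_conj, Cconj_RtoC. f_equal.
    rewrite <- Cconj_plus_RtoC, !ccos_e, !e_conj, Cmult_conj, conj_hf, Cplus_conj. f_equal.
    replace (- (1)) with (-1) by ring. replace (- -1) with 1 by ring. ring. }
  rewrite Hc. unfold Mconj; cbn [m11 m12 m21 m22].
  rewrite !Cminus_conj, !Cmult_conj, Copp_conj, !Cconj_RtoC. reflexivity.
Qed.

Definition E12 : M2 := mkM2 0 1 0 0.

(* kappa (e^{iz} - e^{-iz}) is the zero-mean solution g of g(z + 2 omega) - g(z) = t1 cos (z + omega). *)
Lemma near_minus_identity t1 omega : e 1 (RtoC (2 * omega)) <> RtoC 1 ->
  exists Cst, 0 < Cst /\ forall E, Rabs E <= 1 -> exists Z W, adm Z /\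
    cj (2 * omega) Z (B_E t1 omega E) (ev W) /\ osc 3 W <= Cst * Rabs E /\
    nm (ev W 0%C) <= 2 + Cst * Rabs E.
Proof.
  intros Hne. set (v := e 1 (RtoC omega)).
  assert (Hv2 : e 1 (RtoC (2 * omega)) = (v * v)%C).
  { unfold v. rewrite <- e_plus. f_equal. rewrite <- RtoC_plus. f_equal. ring. }
  assert (Hvc : (v * Cconj v)%C = RtoC 1) by apply e_RtoC_unit.
  assert (Hd : (v - Cconj v)%C <> RtoC 0).
  { intros H. apply Hne. rewrite Hv2. rewrite <- Hvc. f_equal. apply Ceq_minus, H. }
  set (kap := (hf * RtoC t1 / (v - Cconj v))%C).
  assert (Hkap : (kap * (v - Cconj v))%C = (hf * RtoC t1)%C) by (unfold kap; field; exact Hd).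
  (* [kap] is purely imaginary, so that $g$ is real on the real axis. *)
  assert (Hkc : Cconj kap = (- kap)%C).
  { unfold kap. rewrite Cdiv_conj by exact Hd. rewrite Cminus_conj, Cconj_conj, Cmult_conj, conj_hf, Cconj_RtoC.
    field. split; [exact Hd|]. intros H. apply Hd.
    replace (v - Cconj v)%C with (- (Cconj v - v))%C by ring. rewrite H. ring. }
  set (gf := fun z => (kap * (e 1 z - e (-1) z))%C).
  set (Gt := ((1%Z, kap *s I2) :: ((-1)%Z, (- kap)%C *s I2) :: nil) : tp).
  assert (HGt : forall z, ev Gt z = gf z *s I2).
  { intros z. unfold Gt, gf; cbn [ev fst snd]. generalize (e 1 z) (e (-1) z). mring. }
  assert (Hgr : forall z, gf (Cconj z) = Cconj (gf z)).
  { intros z. unfold gf. rewrite Cmult_conj, Cminus_conj, Hkc, !e_conj.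
    replace (- (1)) with (-1) by ring. replace (- -1) with 1 by ring. ring. }
  assert (Hgc : forall z, gf (z + RtoC (2 * omega))%C = (gf z + RtoC t1 * ccos (z + RtoC omega))%C).
  { intros z. unfold gf. rewrite ccos_e, !e_plus.
    assert (Hm2 : e (-1) (RtoC (2 * omega)) = (Cconj v * Cconj v)%C).
    { replace (-1) with (- (1)) by ring. rewrite e_opp_RtoC, Hv2. apply Cmult_conj. }
    assert (Hm1 : e (-1) (RtoC omega) = Cconj v).
    { replace (-1) with (- (1)) by ring. apply e_opp_RtoC. }
    rewrite Hm2, Hm1, Hv2. fold v.
    replace (RtoC t1 * (hf * (e 1 z * v + e (-1) z * Cconj v)))%C
      with ((hf * RtoC t1) * (e 1 z * v + e (-1) z * Cconj v))%C by ring.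
    rewrite <- Hkap. ring [Hvc]. }
  (* Width 3 exceeds every initial width $1+2/\mu$, which is at most 2. *)
  set (gam := nrm 3 Gt). assert (Hgam : 0 <= gam) by apply nrm_ge_0.
  exists (3 + 3 * gam + gam * gam). split; [nra|]. intros E HE.
  (* After conjugation the cosine has cancelled and the cocycle is $-(I+E(K_0+gK_1+g^2E_{12}))$. *)
  set (K0 := mkM2 (- RtoC E)%C 1 (- (1))%C 0). set (K1 := mkM2 (- (1))%C (RtoC E) 0 1).
  set (V := (0%Z, K0) :: tmap (fun _ a => a *m K1) Gt ++ tmap (fun _ a => a *m E12) (tmul Gt Gt)).
  set (W := tscal (RtoC (-1)) ((0%Z, I2) :: tscal (RtoC E) V)).
  exists (fun z => I2 +m ev Gt z *m E12), W.
  assert (HnK : nm K0 <= 3 /\ nm K1 <= 3 /\ nm E12 <= 1).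
  { unfold nm, K0, K1, E12; cbn [m11 m12 m21 m22].
    rewrite ?Cmod_opp, ?Cmod_1, ?Cmod_0, !Cmod_R. lra. }
  assert (Hn1 : nrm 3 (tmap (fun _ a => a *m K1) Gt) <= 3 * gam).
  { apply nrm_tmap_le. intros _ a. eapply Rle_trans; [apply nm_mul|]. rewrite Rmult_comm.
    apply Rmult_le_compat_r; [apply nm_ge_0 | apply HnK]. }
  assert (Hn2 : nrm 3 (tmap (fun _ a => a *m E12) (tmul Gt Gt)) <= gam * gam).
  { apply Rle_trans with (1 * nrm 3 (tmul Gt Gt)).
    - apply nrm_tmap_le. intros _ a. eapply Rle_trans; [apply nm_mul|]. rewrite Rmult_comm.
      apply Rmult_le_compat_r; [apply nm_ge_0 | apply HnK].
    - rewrite Rmult_1_l. apply nrm_tmul. lra. }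
  assert (HnV : nrm 3 V <= 3 + 3 * gam + gam * gam).
  { unfold V. change (nrm 3 ((0%Z, K0) :: ?x)) with (nm K0 * wt 3 0 + nrm 3 x).
    rewrite nrm_app, wt_0. lra. }
  assert (HnEV : nrm 3 (tscal (RtoC E) V) <= (3 + 3 * gam + gam * gam) * Rabs E).
  { eapply Rle_trans; [apply nrm_tscal|]. rewrite Cmod_R, Rmult_comm.
    apply Rmult_le_compat_r; [apply Rabs_pos | exact HnV]. }
  split; [|split; [|split]].
  - split; [|split; [|split]].
    + apply mderiv_add; [apply mderiv_const|]. apply (mderiv_mul (ev Gt)); [apply mderiv_ev | apply mderiv_const].
    + intros z. rewrite !HGt, Hgr, Mconj_add, Mconj_mul, Mconj_scal, Mconj_I2.
      replace (Mconj E12) with E12; [reflexivity|].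
      unfold E12, Mconj; cbn [m11 m12 m21 m22]. rewrite !Cconj_RtoC. reflexivity.
    + intros z. rewrite HGt. unfold E12. mring.
    + exists 1. split; [left; reflexivity|]. intros z. rewrite ev_2PI, Mscal_1. reflexivity.
  - intros z. rewrite B_E_entries, !HGt, Hgc.
    unfold W. rewrite ev_tscal. cbn [ev fst snd]. rewrite ev_tscal. unfold V. cbn [ev fst snd].
    rewrite !e_0_freq, !Mscal_1, ev_app, (ev_tmap_lin (fun a => a *m K1)) by apply lin_mul_r.
    rewrite (ev_tmap_lin (fun a => a *m E12)) by apply lin_mul_r. rewrite ev_tmul, HGt.
    replace (RtoC (-1)) with (- (1))%C by (rewrite <- RtoC_opp; reflexivity).
    set (c := (RtoC t1 * ccos (z + RtoC omega))%C). unfold K0, K1, E12.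
    generalize (gf z) (RtoC E) c. clear. mring.
  - unfold W. eapply Rle_trans; [apply osc_tscal|]. rewrite Cmod_RtoC_m1, Rmult_1_l.
    unfold osc at 1; cbn [fsum fst snd]. rewrite Z.eqb_refl, Rplus_0_l.
    eapply Rle_trans; [apply osc_le_nrm | exact HnEV].
  - eapply Rle_trans; [apply (nm_ev_0 3); lra|]. unfold W.
    eapply Rle_trans; [apply nrm_tscal|]. rewrite Cmod_RtoC_m1, Rmult_1_l.
    change (nm I2 * wt 3 0 + nrm 3 (tscal (RtoC E) V) <= 2 + (3 + 3 * gam + gam * gam) * Rabs E).
    rewrite wt_0, nm_I2. lra.
Qed.

(** * Compactness and the passage to the limit *)

Lemma bounded_subsequence (u : nat -> R) (K : R) : (forall n, Rabs (u n) <= K) ->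
  exists (phi : nat -> nat) (l : R), (forall n, (n <= phi n)%nat) /\ Un_cv (fun n => u (phi n)) l.
Proof.
  intros H. destruct (Bolzano_Weierstrass u (fun x => - K <= x <= K)) as [l Hl].
  { apply compact_P3. }
  { intros n. apply Rabs_le_between, H. }
  assert (Hn : forall n, exists p, (n <= p)%nat /\ Rabs (u p - l) < / INR (S n)).
  { intros n. assert (Hp : 0 < / INR (S n)) by (apply Rinv_0_lt_compat, lt_0_INR; lia).
    destruct (Hl (disc l (mkposreal _ Hp)) n) as [p [Hp1 Hp2]].
    - exists (mkposreal _ Hp). intros x Hx. exact Hx.
    - exists p. split; assumption. }
  (* The indices are chosen independently and need not increase: $n\le\varphi(n)$ is enough for
     limits and is stable under composition. *)
  exists (fun n => proj1_sig (constructive_indefinite_description _ (Hn n))), l. split.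
  - intros n. destruct constructive_indefinite_description as [p Hp]; simpl. apply Hp.
  - intros eps Heps. destruct (archimed_cor1 eps Heps) as [N [HN HN0]]. exists N. intros n Hnn.
    destruct constructive_indefinite_description as [p Hp]; simpl. unfold Rdist.
    eapply Rlt_le_trans; [apply Hp|]. apply Rle_trans with (/ INR N); [|lra].
    apply Rinv_le_contravar; [apply lt_0_INR; lia | apply le_INR; lia].
Qed.

Lemma Un_cv_reindex u l (phi : nat -> nat) : (forall n, (n <= phi n)%nat) -> Un_cv u l ->
  Un_cv (fun n => u (phi n)) l.
Proof.
  intros Hp Hu eps He. destruct (Hu eps He) as [N HN]. exists N. intros n Hn.
  apply HN. specialize (Hp n). lia.
Qed.

Lemma bounded_matrix_subsequence (A : nat -> M2) (K : R) :
  (forall n, Mconj (A n) = A n) -> (forall n, nm (A n) <= K) ->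
  exists (phi : nat -> nat) (L : M2), (forall n, (n <= phi n)%nat) /\
    forall eps, 0 < eps -> exists N, forall n, (N <= n)%nat ->
      nm (A (phi n) +m RtoC (-1) *s L) < eps.
Proof.
  intros Hc HK.
  assert (Hb : forall n, Rabs (fst (m11 (A n))) <= K /\ Rabs (fst (m12 (A n))) <= K /\
     Rabs (fst (m21 (A n))) <= K /\ Rabs (fst (m22 (A n))) <= K).
  { intros n. specialize (HK n). unfold nm in HK. cmods (A n).
    pose proof (re_le_Cmod (m11 (A n))). pose proof (re_le_Cmod (m12 (A n))).
    pose proof (re_le_Cmod (m21 (A n))). pose proof (re_le_Cmod (m22 (A n))).
    unfold Re in *. lra. }
  destruct (bounded_subsequence (fun n => fst (m11 (A n))) K) as [p1 [l1 [Hp1 H1]]]; [apply Hb|].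
  destruct (bounded_subsequence (fun n => fst (m12 (A (p1 n)))) K) as [p2 [l2 [Hp2 H2]]]; [intros; apply Hb|].
  destruct (bounded_subsequence (fun n => fst (m21 (A (p1 (p2 n))))) K) as [p3 [l3 [Hp3 H3]]]; [intros; apply Hb|].
  destruct (bounded_subsequence (fun n => fst (m22 (A (p1 (p2 (p3 n)))))) K) as [p4 [l4 [Hp4 H4]]]; [intros; apply Hb|].
  assert (Hp34 : forall n, (n <= p3 (p4 n))%nat) by (intros n; specialize (Hp4 n); specialize (Hp3 (p4 n)); lia).
  assert (Hp24 : forall n, (n <= p2 (p3 (p4 n)))%nat) by (intros n; specialize (Hp34 n); specialize (Hp2 (p3 (p4 n))); lia).
  exists (fun n => p1 (p2 (p3 (p4 n)))), (mkM2 (RtoC l1) (RtoC l2) (RtoC l3) (RtoC l4)). split.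
  { intros n. specialize (Hp24 n). specialize (Hp1 (p2 (p3 (p4 n)))). lia. }
  apply (Un_cv_reindex _ _ (fun n => p2 (p3 (p4 n))) Hp24) in H1.
  apply (Un_cv_reindex _ _ (fun n => p3 (p4 n)) Hp34) in H2.
  apply (Un_cv_reindex _ _ p4 Hp4) in H3.
  intros eps He.
  destruct (H1 (eps / 4) ltac:(lra)) as [N1 K1]. destruct (H2 (eps / 4) ltac:(lra)) as [N2 K2].
  destruct (H3 (eps / 4) ltac:(lra)) as [N3 K3]. destruct (H4 (eps / 4) ltac:(lra)) as [N4 K4].
  exists (N1 + N2 + N3 + N4)%nat. intros n Hn.
  specialize (K1 n ltac:(lia)). specialize (K2 n ltac:(lia)).
  specialize (K3 n ltac:(lia)). specialize (K4 n ltac:(lia)). unfold Rdist in *.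
  set (k := p1 (p2 (p3 (p4 n)))) in *.
  destruct (Mconj_real (A k) (Hc k)) as [a [b [c [d E]]]]. rewrite E in *. simpl in K1, K2, K3, K4.
  unfold nm, Madd, M2scal; cbn [m11 m12 m21 m22].
  rewrite <- !RtoC_mult, <- !RtoC_plus, !Cmod_R.
  replace (a + -1 * l1) with (a - l1) by ring. replace (b + -1 * l2) with (b - l2) by ring.
  replace (c + -1 * l3) with (c - l3) by ring. replace (d + -1 * l4) with (d - l4) by ring. lra.
Qed.

Lemma almost_reducible_intro b h B : 0 < h -> realsym B ->
  (forall eps, 0 < eps -> exists Z W, adm Z /\ cj b Z B (ev W) /\ osc h W <= eps /\ nm (ev W 0%C) <= 4) ->
  almost_reducible b B.
Proof.
  intros Hh HB H.
  assert (HS : forall n : nat, exists ZW : (C -> M2) * tp, adm (fst ZW) /\ cj b (fst ZW) B (ev (snd ZW)) /\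
     osc h (snd ZW) <= / INR (S n) /\ nm (ev (snd ZW) 0%C) <= 4).
  { intros n. destruct (H (/ INR (S n))) as [Z [W HZW]].
    - apply Rinv_0_lt_compat, lt_0_INR. lia.
    - exists (Z, W). exact HZW. }
  set (ZW := fun n => proj1_sig (constructive_indefinite_description _ (HS n))).
  assert (HZW : forall n, adm (fst (ZW n)) /\ cj b (fst (ZW n)) B (ev (snd (ZW n))) /\
     osc h (snd (ZW n)) <= / INR (S n) /\ nm (ev (snd (ZW n)) 0%C) <= 4).
  { intros n. unfold ZW. destruct constructive_indefinite_description as [x Hx]; exact Hx. }
  clearbody ZW.
  destruct (bounded_matrix_subsequence (fun n => ev (snd (ZW n)) 0%C) 4) as [phi [L [Hphi HL]]].
  { intros n. destruct (HZW n) as [Ha [Hc _]]. rewrite <- (cj_realsym _ _ _ _ Ha Hc HB). f_equal. apply Cconj_RtoC. }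
  { intros n. apply HZW. }
  exists h. split; [exact Hh|]. exists (fun n => fst (ZW (phi n))). split.
  { intros n. apply adm_analytic, HZW. }
  exists L. intros eps Heps. destruct (HL (eps / 2) ltac:(lra)) as [N1 HN1].
  (* The oscillation enters twice through [nm_ev_sub], so a quarter of [eps] leaves half for the
     constant part. *)
  destruct (archimed_cor1 (eps / 4) ltac:(lra)) as [N2 [HN2 HN20]].
  exists (N1 + N2)%nat. intros n Hn z Hz M.
  destruct (HZW (phi n)) as [_ [Hc [Ho _]]]. unfold M. rewrite Hc.
  specialize (HN1 n ltac:(lia)). specialize (Hphi n).
  set (W := snd (ZW (phi n))) in *.
  assert (Ho' : osc h W < eps / 4).
  { eapply Rle_lt_trans; [exact Ho|]. eapply Rle_lt_trans; [|exact HN2].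
    apply Rinv_le_contravar; [apply lt_0_INR; lia | apply le_INR; lia]. }
  pose proof (nm_ev_sub h W z ltac:(lra) (Rlt_le _ _ Hz)) as Hs.
  assert (Hf : nm (ev W z +m RtoC (-1) *s L) < eps).
  { replace (ev W z +m RtoC (-1) *s L) with
      ((ev W z +m RtoC (-1) *s ev W 0%C) +m (ev W 0%C +m RtoC (-1) *s L)) by mring.
    eapply Rle_lt_trans; [apply nm_add|]. lra. }
  unfold nm, Madd, M2scal in Hf; cbn [m11 m12 m21 m22] in Hf.
  assert (Hm : forall x y : C, (x + RtoC (-1) * y)%C = (x - y)%C).
  { intros x y. replace (RtoC (-1)) with (- (1))%C by (rewrite <- RtoC_opp; reflexivity). ring. }
  rewrite !Hm in Hf.
  pose proof (Cmod_ge_0 (m11 (ev W z) - m11 L)). pose proof (Cmod_ge_0 (m12 (ev W z) - m12 L)).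
  pose proof (Cmod_ge_0 (m21 (ev W z) - m21 L)). pose proof (Cmod_ge_0 (m22 (ev W z) - m22 L)).
  repeat split; lra.
Qed.

(** The invariant reproduces itself under doubling: the remaining width $1+1/\mu$ is the initial
    width $1+2/(2\mu)$ of the next scale, and the bound on the constant part may grow by $1/(2\mu)$,
    which dominates $256\eta$. The scale is an integer so that its powers can serve as cutoffs. *)
Lemma step_at_scale b c t : 0 < c <= 1 ->
  (forall k, k <> 0%Z -> c / Rabs (IZR k) ^ t <= Cmod (e (IZR k) (RtoC b) - 1)%C) ->
  exists L, forall m : Z, L <= IZR m -> 2 <= IZR m /\ forall W,
    let mu := IZR m in
    realsym (ev W) -> (forall z, M2det (ev W z) = 1%C) ->
    osc (1 + 2 / mu) W <= eta t mu -> nm (ev W 0%C) <= 4 - 1 / mu ->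
    exists Z W', adm Z /\ cj b Z (ev W) (ev W') /\
      osc (1 + 2 / (2 * mu)) W' <= eta t (2 * mu) /\ nm (ev W' 0%C) <= 4 - 1 / (2 * mu).
Proof.
  intros Hc Hdiv. destruct (scale_parameters c t Hc) as [L HL]. exists L. intros m Hm.
  specialize (HL (IZR m) Hm). cbv zeta in HL.
  destruct HL as [H2 [Hd2 [Hd1 [Hg [Hg1 [Hg2 [Hn1 [Hn2 [HK [Hr1 [Hx Hr2]]]]]]]]]]].
  split; [exact H2|]. intros W mu Hr Hdet Ho HA. fold mu in H2, Hd2, Hd1, Hg, Hg1, Hg2, Hn1, Hn2, HK, Hr1, Hx, Hr2.
  assert (Hm2 : (2 <= m)%Z) by (apply le_IZR; exact H2).
  assert (HM : IZR (m ^ 2) = mu ^ 2) by (unfold mu; rewrite (pow_IZR m 2); reflexivity).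
  assert (HN : IZR (m ^ 4) = mu ^ 4) by (unfold mu; rewrite (pow_IZR m 4); reflexivity).
  assert (Hmu1 : 0 < 1 / mu <= 1 / 2).
  { split; [apply Rdiv_lt_0_compat; lra|]. apply Rmult_le_compat_l; [lra|]. apply Rinv_le_contravar; lra. }
  assert (Hh2 : 2 / mu = 2 * (1 / mu)) by (field; lra).
  assert (Hhalf : 1 / (2 * mu) = 1 / mu / 2) by (field; lra).
  assert (Hetap : forall x, 0 < x -> 0 < eta t x).
  { intros x Hx0. apply Rinv_0_lt_compat. apply Rmult_lt_0_compat; [apply pow_lt|]; apply pow_lt; exact Hx0. }
  replace (1 + 2 / (2 * mu)) with (1 + 1 / mu) by (field; lra).
  assert (Hlow : forall K k, low K k = true -> k <> 0%Z /\ (Z.abs k <= K)%Z).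
  { intros K k Hk. unfold low in Hk. apply andb_prop in Hk. destruct Hk as [Hk1 Hk2].
    apply negb_true_iff, Z.eqb_neq in Hk1. apply Z.leb_le in Hk2. split; assumption. }
  assert (Hle : forall K k, low K k = true -> c / IZR K ^ t <= Cmod (e (IZR k) (RtoC b) - 1)%C).
  { intros K k Hk. destruct (Hlow K k Hk) as [Hk0 HkK]. eapply Rle_trans; [|apply Hdiv, Hk0].
    apply Rmult_le_compat_l; [lra|].
    assert (1 <= Rabs (IZR k)) by (rewrite <- abs_IZR; apply IZR_le; lia).
    apply Rinv_le_contravar; [apply pow_lt; lra|]. apply pow_incr. split; [lra|].
    rewrite <- abs_IZR. apply IZR_le, HkK. }
  apply (kam_step b W (1 + 2 / mu) (1 + 1 / mu) (m ^ 2) (m ^ 4) (c / (mu ^ t) ^ 2) (c / (2 ^ t * (mu ^ t) ^ 4))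
    (/ ((mu ^ t) ^ 4 * mu)) (eta t mu) (eta t (2 * mu)) (4 - 1 / mu) (4 - 1 / (2 * mu)));
    rewrite ?HM, ?HN; try assumption; try lra.
  - split; [apply Z.pow_nonneg; lia | apply Z.pow_le_mono_r; lia].
  - intros k Hk. specialize (Hle _ k Hk). rewrite HM in Hle.
    replace ((mu ^ t) ^ 2) with ((mu ^ 2) ^ t); [exact Hle|]. rewrite <- !pow_mult. f_equal. lia.
  - intros k Hk. specialize (Hle _ k Hk). rewrite mult_IZR, HN, Rpow_mult_distr in Hle.
    replace ((mu ^ t) ^ 4) with ((mu ^ 4) ^ t); [exact Hle|]. rewrite <- !pow_mult. f_equal. lia.
  - apply Hetap. lra.
  - rewrite (Rabs_pos_eq (mu ^ 2)) by (apply pow2_ge_0). exact Hx.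
  - rewrite (Rabs_pos_eq (mu ^ 2)) by (apply pow2_ge_0). exact Hr2.
Qed.

Theorem theorem9 (t1 omega : R) :
  diophantine (omega / (2 * PI)) ->
  exists eps : R, 0 < eps /\
    forall E : R, - eps <= E <= eps ->
      almost_reducible (2 * omega) (B_E t1 omega E).
Proof.
  intros Hdio. destruct (diophantine_divisors omega Hdio) as [c [t [Hc Hdiv]]].
  set (b := 2 * omega) in *.
  destruct (step_at_scale b c t Hc Hdiv) as [L HL].
  destruct (near_minus_identity t1 omega) as [Cst [HCst Hinit]].
  { intros H. specialize (Hdiv 1%Z ltac:(lia)). fold b in H. rewrite H in Hdiv.
    replace (1 - 1)%C with (RtoC 0) in Hdiv by ring. rewrite Cmod_0, Rabs_R1, pow1 in Hdiv. lra. }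
  destruct (INR_unbounded L) as [j0 Hj0].
  set (m := fun k : nat => (2 ^ Z.of_nat (j0 + k))%Z).
  assert (Hm : forall k, INR k < IZR (m k) /\ L <= IZR (m k)).
  { intros k. unfold m. rewrite <- (pow_IZR 2 (j0 + k)).
    assert (Hlt : INR (j0 + k) < 2 ^ (j0 + k)).
    { replace 2 with (INR 2) by (simpl; ring). rewrite <- pow_INR. apply lt_INR, Nat.pow_gt_lin_r. lia. }
    rewrite plus_INR in Hlt. pose proof (pos_INR j0). pose proof (pos_INR k). lra. }
  assert (Hm2 : forall k, 2 <= IZR (m k)) by (intros k; apply (HL (m k)), Hm).
  assert (HmS : forall k, IZR (m (S k)) = 2 * IZR (m k)).
  { intros k. unfold m. rewrite <- !(pow_IZR 2), Nat.add_succ_r. reflexivity. }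
  assert (Heta : forall k, 0 < eta t (IZR (m k)) <= / IZR (m k)).
  { intros k. specialize (Hm2 k). set (mu := IZR (m k)) in *.
    assert (H1 : 1 <= (mu ^ t) ^ 20) by (apply pow_ge_1, pow_ge_1; lra).
    assert (H2 : mu <= mu ^ 5) by (rewrite <- (pow_1 mu) at 1; apply Rle_pow; [lra | lia]).
    assert (H3 : mu <= (mu ^ t) ^ 20 * mu ^ 5).
    { rewrite <- (Rmult_1_l mu) at 1. apply Rmult_le_compat; lra. }
    unfold eta. split; [apply Rinv_0_lt_compat; lra | apply Rinv_le_contravar; lra]. }
  (* Small enough for the conjugated cocycle to satisfy the invariant at the first admissible
     scale. *)
  exists (Rmin 1 (eta t (IZR (m 0%nat)) / Cst)). split.
  { apply Rmin_glb_lt; [lra|]. apply Rdiv_lt_0_compat; [apply Heta | exact HCst]. }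
  intros E HE.
  assert (HE1 : Rabs E <= 1) by (apply Rabs_le; pose proof (Rmin_l 1 (eta t (IZR (m 0%nat)) / Cst)); lra).
  assert (HE2 : Cst * Rabs E <= eta t (IZR (m 0%nat))).
  { apply Rmult_le_reg_l with (/ Cst); [apply Rinv_0_lt_compat, HCst|].
    rewrite <- Rmult_assoc, Rinv_l, Rmult_1_l by lra. rewrite Rmult_comm.
    apply Rabs_le. pose proof (Rmin_r 1 (eta t (IZR (m 0%nat)) / Cst)). unfold Rdiv in *. lra. }
  assert (Hr : realsym (B_E t1 omega E)) by apply B_E_realsym.
  assert (HS : forall k, exists Z W, adm Z /\ cj b Z (B_E t1 omega E) (ev W) /\
    osc (1 + 2 / IZR (m k)) W <= eta t (IZR (m k)) /\ nm (ev W 0%C) <= 4 - 1 / IZR (m k)).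
  { assert (Hinv : forall k, 0 < / IZR (m k) <= / 2).
    { intros k. specialize (Hm2 k). split; [apply Rinv_0_lt_compat; lra | apply Rinv_le_contravar; lra]. }
    induction k as [|k [Z [W [HZ [Hcj [Ho Hn]]]]]].
    - destruct (Hinit E HE1) as [Z [W [HZ [Hcj [Ho Hn]]]]]. exists Z, W.
      (* As $\eta\le 1/\mu\le 1/2$, the initial bound $2+\eta$ is below $4-1/\mu$. *)
      specialize (Hinv 0%nat). specialize (Heta 0%nat). unfold Rdiv.
      split; [exact HZ|]. split; [exact Hcj|]. split; [|lra].
      eapply Rle_trans; [apply (osc_mono 3); lra | lra].
    - destruct (HL (m k) (proj2 (Hm k))) as [_ Hstep].
      destruct (Hstep W) as [Z' [W' [HZ' [Hcj' HW']]]]; try assumption.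
      + apply (cj_realsym b Z _ _ HZ Hcj Hr).
      + apply (cj_det b Z _ _ HZ Hcj). intros z. apply B_E_det.
      + exists (fun z => Z' z *m Z z), W'. split; [apply adm_mul; assumption|].
        split; [exact (cj_trans b Z Z' _ _ _ Hcj Hcj') | rewrite HmS; exact HW']. }
  (* Width 1 lies below all the widths $1+2/\mu$ and so serves every scale at once. *)
  apply (almost_reducible_intro b 1); [lra | exact Hr|].
  intros eps Heps. destruct (archimed_cor1 eps Heps) as [k [Hk Hk0]].
  destruct (HS k) as [Z [W [HZ [Hcj [Ho Hn]]]]]. exists Z, W.
  specialize (Hm2 k). specialize (Heta k). destruct (Hm k) as [Hmk _].
  assert (0 < / IZR (m k)) by (apply Rinv_0_lt_compat; lra).
  assert (/ IZR (m k) <= / INR k) by (apply Rinv_le_contravar; [apply lt_0_INR; lia | lra]).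
  unfold Rdiv in *. split; [exact HZ|]. split; [exact Hcj|]. split; [|lra].
  eapply Rle_trans; [apply (osc_mono (1 + 2 * / IZR (m k))); lra | lra].
Qed.
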